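(* Let $b$ be a rational function of degree $n$ that is a nonextreme point of the unit ball of $H^\infty$, and let $T=(M_z,H(b))$. Then there are $0\le m\le n$ and points $\lambda_1,\dots,\lambda_m\in\mathbb T$ (not necessarily distinct) such that, with $a(z)=\frac1{2^m}\prod_{i=1}^m(z-\lambda_i)$, one has $H(b)=M(\overline a)$; when $m=0$, $H(b)=H^2$. Moreover every nonzero (closed) $T$-invariant subspace of $H(b)$ is of the form $\left[\prod_{j=1}^k(z-\lambda_{i_j})\theta\right]$, where $0\le k\le m$, the indices $i_1,\dots,i_k\in\{1,2,\dots,m\}$ are distinct, and $\theta$ is an inner function such that $\prod_{j=1}^k(z-\lambda_{i_j})\theta\in H(b)$. (When $k=0$, $\left[\prod_{j=1}^k(z-\lambda_{i_j})\theta\right]$ is interpreted as $[\theta]$.)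
   Context: $\mathbb D$ is the open unit disc, $\mathbb T$ the unit circle, $H^2$ the Hardy space, $H^\infty$ the bounded analytic functions on $\mathbb D$ with the sup norm, $T_\phi f=P(\phi f)$ the Toeplitz operator on $H^2$ ($P$ the orthogonal projection of $L^2(\mathbb T)$ onto $H^2$). For $b$ in the closed unit ball of $H^\infty$, the de Branges–Rovnyak space $H(b)$ is the range of $(I-T_bT_{\overline b})^{1/2}$ on $H^2$ with the range norm; equivalently, the reproducing kernel Hilbert space on $\mathbb D$ with kernel $\frac{1-\overline{b(\lambda)}b(z)}{1-\overline\lambda z}$. When $b$ is a nonextreme point of the unit ball of $H^\infty$, multiplication by $z$ is a bounded operator on $H(b)$, denoted $(M_z,H(b))$. $M(\overline a)=T_{\overline a}H^2$, and the equality $H(b)=M(\overline a)$ (or $H(b)=H^2$) is equality of sets, with equivalent norms. For $f\in H(b)$, $[f]$ is the closure in $H(b)$ of $\{pf:p\text{ a polynomial}\}$. *)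

(* Defs.v *)
From HB Require Import structures.
From mathcomp Require Import all_boot all_order all_algebra.
From mathcomp Require Import complex.
From mathcomp Require Import all_classical all_reals all_analysis.

Set Implicit Arguments.
Unset Strict Implicit.
Unset Printing Implicit Defensive.
Import Order.TTheory GRing.Theory Num.Theory.
Import numFieldNormedType.Exports.

Local Open Scope classical_set_scope.
Local Open Scope complex_scope.
Local Open Scope ring_scope.

(* A function on the unit circle is represented by a function R[i] -> R[i] of
   which only the values on the circle matter, and an element of L^2(T) by any
   of its representatives: the subspaces below are sets of functions that are
   stable under almost everywhere equality on T.  Elements of H^2 are given by
   their boundary values, i.e. H^2 is the closed subspace of L^2(T) on which P
   projects.  Only for H^oo are the values on the open disc used. *)

Section UnitCircle.
Context {R : realType}.
Local Notation C := R[i].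
Implicit Types (f g h : C -> C) (S A : (C -> C) -> C -> C).

Definition circ (t : R) : C := cos t +i* sin t.

Definition arcT : set R := `[0, 2 * pi]%classic.

Definition ae_eqT f g : Prop :=
  {ae @lebesgue_measure R, forall t, arcT t -> f (circ t) = g (circ t)}.

Definition intT f : C :=
  (((2 * pi)^-1 * Rintegral (@lebesgue_measure R) arcT (fun t => complex.Re (f (circ t))))
   +i*
   ((2 * pi)^-1 * Rintegral (@lebesgue_measure R) arcT (fun t => complex.Im (f (circ t))))).

Definition L2T : set (C -> C) := [set f : C -> C |
  [/\ measurable_fun arcT (fun t => complex.Re (f (circ t))),
      measurable_fun arcT (fun t => complex.Im (f (circ t))) &
      (\int[@lebesgue_measure R]_(t in arcT)
          ((ComplexField.Normc.normc (f (circ t))) ^+ 2)%:E < +oo)%E]].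

Definition conjT f : C -> C := fun z => (f z)^*%C.

Definition dotT f g : C := intT (f \* conjT g).

Definition norm2 f : R := Num.sqrt (complex.Re (dotT f f)).

(* vanishing of the Fourier coefficients of index - n.+1 *)
Definition H2 : set (C -> C) := [set f : C -> C |
  L2T f /\ forall n : nat, intT (fun z => f z * z ^+ n.+1) = 0].

Definition inner_fun (theta : C -> C) : Prop :=
  H2 theta /\ ae_eqT (fun z => `|theta z|) (cst 1).

Definition projH2 f : C -> C :=
  xget (cst 0) [set g : C -> C | H2 g /\ forall h, H2 h -> dotT (f \- g) h = 0].

Definition toeplitz (phi : C -> C) f : C -> C := projH2 (phi \* f).

Definition bounded_op A : Prop :=
  [/\ forall f, H2 f -> H2 (A f),
      forall (c : C) f g, H2 f -> H2 g ->
        ae_eqT (A (c \*o f \+ g)) (c \*o A f \+ A g) &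
      exists K : R, forall f, H2 f -> norm2 (A f) <= K * norm2 f].

(* On R[i], 0 <= z means that z is real and nonnegative. *)
Definition positive_op A : Prop :=
  bounded_op A /\ forall f, H2 f -> 0 <= dotT (A f) f.

Definition sqrt_op S : (C -> C) -> C -> C :=
  xget (fun f : C -> C => f) [set A : (C -> C) -> C -> C | positive_op A /\
                   forall f, H2 f -> ae_eqT (A (A f)) (S f)].

Definition range_space A : set (C -> C) := [set f : C -> C |
  H2 f /\ exists2 g, H2 g & ae_eqT (A g) f].

Definition range_norm A f : R :=
  inf [set x | exists2 g, H2 g /\ ae_eqT (A g) f & x = norm2 g].

Definition same_space (V : set (C -> C)) (nV : (C -> C) -> R)
    (W : set (C -> C)) (nW : (C -> C) -> R) : Prop :=
  V = W /\ exists c1 c2 : R,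
    [/\ 0 < c1, 0 < c2 & forall f, V f -> c1 * nW f <= nV f <= c2 * nW f].

(* (I - T_b T_{\bar b})^{1/2} *)
Definition Hb_op (b : C -> C) : (C -> C) -> C -> C :=
  sqrt_op (fun f => f \- toeplitz b (toeplitz (conjT b) f)).

Definition Hb (b : C -> C) : set (C -> C) := range_space (Hb_op b).

Definition Hb_norm (b : C -> C) : (C -> C) -> R := range_norm (Hb_op b).

(* M(\bar a) and its range norm, as functions of a *)
Definition Mbar (a : C -> C) : set (C -> C) := range_space (toeplitz (conjT a)).

Definition Mbar_norm (a : C -> C) : (C -> C) -> R :=
  range_norm (toeplitz (conjT a)).

Definition Hb_closure (b : C -> C) (V : set (C -> C)) : set (C -> C) :=
  [set f : C -> C | Hb b f /\
     forall e : R, 0 < e -> exists2 g, V g & Hb_norm b (f \- g) < e].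

Definition cyclic_sub (b f : C -> C) : set (C -> C) :=
  Hb_closure b [set g : C -> C | exists p : {poly C}, g = (fun z => p.[z] * f z)].

Definition closed_subspace (b : C -> C) (M : set (C -> C)) : Prop :=
  [/\ M `<=` Hb b,
      M (cst 0),
      forall (c : C) f g, M f -> M g -> M (c \*o f \+ g) &
      Hb_closure b M `<=` M].

Definition shift_invariant (M : set (C -> C)) : Prop :=
  forall f, M f -> M (fun z => z * f z).

Definition nonzero_sub (M : set (C -> C)) : Prop :=
  exists2 f, M f & ~ ae_eqT f (cst 0).

Definition Hinf_ball : set (C -> C) := [set f : C -> C |
  forall z : C, `|z| < 1 -> derivable (f : C^o -> C^o) z 1 /\ `|f z| <= 1].

Definition extreme_Hinf_ball (b : C -> C) : Prop :=
  Hinf_ball b /\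
  forall (f g : C -> C) (t : R), Hinf_ball f -> Hinf_ball g -> 0 < t < 1 ->
    (forall z : C, `|z| < 1 -> b z = t%:C * f z + (1 - t)%:C * g z) ->
    forall z : C, `|z| < 1 -> f z = b z /\ g z = b z.

(* The values of b at the zeros of q are not constrained; for b in the unit
   ball of H^oo there are none in the closed disc. *)
Definition rational_of_degree (b : C -> C) (n : nat) : Prop :=
  exists p q : {poly C},
    [/\ q != 0, coprimep p q, maxn (size p).-1 (size q).-1 = n &
        forall z, q.[z] != 0 -> b z = p.[z] / q.[z]].

End UnitCircle.

(* Main.v *)
Require Import Defs.
From HB Require Import structures.
From mathcomp Require Import all_boot all_order all_algebra.
From mathcomp Require Import complex.
From mathcomp Require Import all_classical all_reals all_analysis.
From mathcomp Require Import measurable_realfun.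
From mathcomp Require Import ring lra.
Set Implicit Arguments.
Unset Strict Implicit.
Unset Printing Implicit Defensive.
Import Order.TTheory GRing.Theory Num.Theory.
Import numFieldNormedType.Exports.

Local Open Scope classical_set_scope.
Local Open Scope complex_scope.
Local Open Scope ring_scope.


(** Why the theorem holds.  Write [b = p / q] in lowest terms; [q] has no zero in
    the closed disc and [|p| <= |q|] there.  On the circle
    [z ^+ n * (|q| ^+ 2 - |p| ^+ 2)] is the polynomial [defect p q n].

    If it is zero, [b] is extreme: [b = t f + (1 - t) g] gives
    [t (1 - t) |f - g| ^+ 2 <= 1 - |b| ^+ 2], so that [q (f - g)] tends to [0] at the
    circle, and it vanishes by the mean value property ([disc_zero]).  The functions
    of the unit ball are only known to have a derivative at each point, so the
    mean value property rests on Goursat's subdivision argument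
    ([square_subdivision], [goursat_local], [mean_step]).

    Otherwise its zeros on the circle have even multiplicity, because
    [|q| ^+ 2 - |p| ^+ 2 >= 0] ([even_multiplicity]).  Let the [lambda i] be these
    zeros with half their multiplicity; there are at most [n] of them, as the
    degree of [defect p q n] is at most [2 n].  Then [1 - |b| ^+ 2] and [|a| ^+ 2] are
    comparable on the circle, and Bezout's identity writes the conjugate of [b]
    there as [h + g a] with [h] a polynomial and [g] bounded ([boundary_data]).

    Let [S = I - T_b T_(conj b)] and let [P] be the projection onto [H2].  For [u] in [H2],
    [<S u, u>] is the integral of [(1 - |b| ^+ 2) |u| ^+ 2] plus the square of
    [|(I - P) (conj b u)|] ([defect_form]).  The last term is bounded by a multiple of
    [|a u| ^+ 2], as [h] preserves [H2] ([hankel_bound]).  Hence the norms of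
    [S^(1/2) u] and of [T_a u = a u] are comparable, and Douglas' lemma, applied in
    both directions, identifies the ranges of the adjoints [S^(1/2)] and [T_(conj a)],
    with equivalent norms ([Hb_operator]).

    As the zeros of [a] are unimodular, [conj a] is on the circle a unimodular
    constant times [z ^- m * a].  So [a H2] is contained in [H(b)], boundedly
    ([Mul_a_range]), and every element of [H(b)] is the sum of a polynomial and an
    element of [a H2] ([range_decomp]).  Given a closed invariant subspace [M],
    [{h | a h in M}] is a closed shift-invariant subspace of [H2], hence equal to
    [theta H2] by [beurling], and it contains [M].  Division by [theta] does not leave
    [H(b)] ([inner_division]); so the elements of [M] are the [theta (p + a v)] with
    [theta p] in [M], and [theta a H2] is contained in [M].  The polynomials [p] with
    [theta p] in [M] form an ideal containing [a]; its generator [c] divides [a], that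
    is, [c] is a product of some of the factors [z - lambda i], and the density of
    polynomials in [H2] gives [M = [c theta]] ([invariant_subspace],
    [invariant_cyclic]).

    The preparation is the Hilbert space [L2] of classes of square integrable
    functions on the circle: its completeness ([L2_limit]), Riesz representation
    ([riesz]), Douglas' lemma ([douglas]), square roots of positive operators
    ([sqrt_exists]), and the uniqueness of Fourier coefficients ([fourier_unique]),
    from which Beurling's theorem is deduced. *)

Notation Re := complex.Re.
Notation Im := complex.Im.
Notation nm := ComplexField.Normc.normc.

(** * Moduli, real parts and conjugates of complex numbers *)

Section ComplexFacts.
Context {R : realType}.
Local Notation C := R[i].
Implicit Types (x y z : C) (r : R).

Lemma nmE z : `|z| = (nm z)%:C. Proof. by []. Qed.
Lemma nm_ge0 z : 0 <= nm z. Proof. by case: z => a b; exact: sqrtr_ge0. Qed.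
Lemma nmM x y : nm (x * y) = nm x * nm y.
Proof. exact: ComplexField.Normc.normcM. Qed.
Lemma nm_le r z : (`|z| <= r%:C) = (nm z <= r).
Proof. by rewrite nmE lecR. Qed.
Lemma nmD x y : nm (x + y) <= nm x + nm y.
Proof. exact: le_normcD. Qed.
Lemma nmN x : nm (- x) = nm x. Proof. exact: normcN. Qed.
Lemma nmB x y : nm (x - y) = nm (y - x). Proof. by rewrite -nmN opprB. Qed.
Lemma nm0 : nm (0 : C) = 0. Proof. exact: ComplexField.Normc.normc0. Qed.
Lemma nm1 : nm (1 : C) = 1. Proof. exact: ComplexField.Normc.normc1. Qed.
Lemma nmX z n : nm (z ^+ n) = nm z ^+ n.
Proof. by elim: n => [|n IH]; rewrite ?expr0 ?nm1// !exprS nmM IH. Qed.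
Lemma nm_eq0 z : nm z = 0 -> z = 0.
Proof. exact: ComplexField.Normc.eq0_normc. Qed.
Lemma nmJ z : nm (z^*%C) = nm z.
Proof. by case: z => a b /=; rewrite sqrrN. Qed.
Lemma nmR r : nm r%:C = `|r|.
Proof. by rewrite /= expr0n addr0 sqrtr_sqr. Qed.
Lemma nm_sqr z : nm z ^+ 2 = Re z ^+ 2 + Im z ^+ 2.
Proof. by case: z => a b /=; rewrite sqr_sqrtr// addr_ge0// sqr_ge0. Qed.
Lemma nm_mulJ z : z * z^*%C = (nm z ^+ 2)%:C.
Proof.
rewrite nm_sqr; case: z => a b /=; apply/eqP; rewrite eq_complex /=.
by apply/andP; split; apply/eqP; ring.
Qed.
Lemma Re_le z : `|Re z| <= nm z.
Proof.
rewrite -(ler_pXn2r (ltn0Sn 1)) ?nnegrE ?nm_ge0// nm_sqr.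
by rewrite real_normK ?num_real// lerDl sqr_ge0.
Qed.
Lemma Im_le z : `|Im z| <= nm z.
Proof.
rewrite -(ler_pXn2r (ltn0Sn 1)) ?nnegrE ?nm_ge0// nm_sqr.
by rewrite real_normK ?num_real// lerDr sqr_ge0.
Qed.
Lemma nm_le_ReIm z : nm z <= `|Re z| + `|Im z|.
Proof.
rewrite -(ler_pXn2r (ltn0Sn 1)) ?nnegrE ?nm_ge0// ?addr_ge0// nm_sqr.
rewrite sqrrD !real_normK ?num_real// lerD2r lerDl.
by rewrite mulrn_wge0// mulr_ge0.
Qed.
Lemma ReD x y : Re (x + y) = Re x + Re y. Proof. by case: x y => ? ? []. Qed.
Lemma ImD x y : Im (x + y) = Im x + Im y. Proof. by case: x y => ? ? []. Qed.
Lemma ReN x : Re (- x) = - Re x. Proof. by case: x. Qed.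
Lemma ImN x : Im (- x) = - Im x. Proof. by case: x. Qed.
Lemma ReM x y : Re (x * y) = Re x * Re y - Im x * Im y.
Proof. by case: x y => ? ? []. Qed.
Lemma ImM x y : Im (x * y) = Re x * Im y + Im x * Re y.
Proof. by case: x y => ? ? []. Qed.
Lemma ReJ x : Re (x^*%C) = Re x. Proof. by case: x. Qed.
Lemma ImJ x : Im (x^*%C) = - Im x. Proof. by case: x. Qed.
Lemma cD r s : (r + s)%:C = r%:C + s%:C. Proof. exact: rmorphD. Qed.
Lemma cN r : (- r)%:C = - r%:C. Proof. exact: rmorphN. Qed.
Lemma cM r s : (r * s)%:C = r%:C * s%:C. Proof. exact: rmorphM. Qed.
Lemma conjM x y : (x * y)^*%C = x^*%C * y^*%C. Proof. exact: rmorphM. Qed.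
Lemma conjD x y : (x + y)^*%C = x^*%C + y^*%C. Proof. exact: rmorphD. Qed.
Lemma conjN x : (- x)^*%C = - x^*%C. Proof. exact: rmorphN. Qed.
Lemma conj0 : (0 : C)^*%C = 0. Proof. exact: rmorph0. Qed.
Lemma conj1 : (1 : C)^*%C = 1. Proof. exact: rmorph1. Qed.
Lemma conjV x : (x^-1)^*%C = (x^*%C)^-1. Proof. exact: fmorphV. Qed.
Lemma cV r : (r^-1)%:C = (r%:C)^-1. Proof. exact: fmorphV. Qed.
Lemma conjX x n : (x ^+ n)^*%C = x^*%C ^+ n. Proof. exact: rmorphXn. Qed.
Lemma cplxP x y : Re x = Re y -> Im x = Im y -> x = y.
Proof. by case: x y => ? ? [] ? ? /= -> ->. Qed.

End ComplexFacts.

(** * Complex Hilbert spaces: orthogonal projections and Douglas' lemma *)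

Definition closedV {R : realType} {V : lmodType R[i]} (nrm : V -> R) (W : set V) : Prop :=
  forall h, (forall e : R, 0 < e -> exists2 w, W w & nrm (h - w) < e) -> W h.

Definition subspace {K : pzRingType} {V : lmodType K} (W : set V) : Prop :=
  W 0 /\ forall c u v, W u -> W v -> W (c *: u + v).

Section Hilbert.
Context {R : realType} {V : lmodType R[i]} (dot : V -> V -> R[i]).
Local Notation C := R[i].
Implicit Types (u v w : V) (c : C) (W : set V).

Definition nrm u : R := Num.sqrt (Re (dot u u)).

Hypothesis dotDl : forall u v w, dot (u + v) w = dot u w + dot v w.
Hypothesis dotZl : forall c u v, dot (c *: u) v = c * dot u v.
Hypothesis dotC : forall u v, (dot u v)^*%C = dot v u.
Hypothesis dot_ge0 : forall u, 0 <= dot u u.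
Hypothesis dot_eq0 : forall u, dot u u = 0 -> u = 0.

Lemma dotDr u v w : dot u (v + w) = dot u v + dot u w.
Proof. by rewrite -dotC dotDl conjD !dotC. Qed.
Lemma dotZr c u v : dot u (c *: v) = c^*%C * dot u v.
Proof. by rewrite -dotC dotZl conjM dotC. Qed.
Lemma dotNl u v : dot (- u) v = - dot u v.
Proof. by rewrite -scaleN1r dotZl mulN1r. Qed.
Lemma dotNr u v : dot u (- v) = - dot u v.
Proof. by rewrite -dotC dotNl conjN dotC. Qed.
Lemma dotBl u v w : dot (u - v) w = dot u w - dot v w.
Proof. by rewrite dotDl dotNl. Qed.
Lemma dotBr u v w : dot u (v - w) = dot u v - dot u w.
Proof. by rewrite dotDr dotNr. Qed.
Lemma dot0l v : dot 0 v = 0. Proof. by rewrite -(scale0r 0) dotZl mul0r. Qed.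
Lemma dot0r v : dot v 0 = 0. Proof. by rewrite -dotC dot0l conj0. Qed.

Lemma Re_dot_ge0 u : 0 <= Re (dot u u).
Proof. by have := dot_ge0 u; rewrite lecE => /andP[]. Qed.
Lemma nrm_ge0 u : 0 <= nrm u. Proof. exact: sqrtr_ge0. Qed.
Lemma dotE u : dot u u = (nrm u ^+ 2)%:C.
Proof.
rewrite sqr_sqrtr ?Re_dot_ge0//; have /ger0_Im := dot_ge0 u.
by case: (dot u u) => a b /= ->.
Qed.
Lemma nrm2E u : nrm u ^+ 2 = Re (dot u u).
Proof. by rewrite sqr_sqrtr ?Re_dot_ge0. Qed.
Lemma nrm_eq0 u : nrm u = 0 -> u = 0.
Proof. by move=> h; apply: dot_eq0; rewrite dotE h expr0n. Qed.
Lemma nrm0 : nrm 0 = 0. Proof. by rewrite /nrm dot0l sqrtr0. Qed.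
Lemma nrmZ c u : nrm (c *: u) = nm c * nrm u.
Proof.
have h : nrm (c *: u) ^+ 2 = (nm c * nrm u) ^+ 2.
  apply: complexI; rewrite -dotE dotZl dotZr dotE mulrA nm_mulJ -cM.
  by rewrite exprMn.
by apply/eqP; rewrite -(eqrXn2 (ltn0Sn 1)) ?mulr_ge0 ?nrm_ge0 ?nm_ge0// h.
Qed.
Lemma nrmN u : nrm (- u) = nrm u.
Proof. by rewrite -scaleN1r nrmZ nmN nm1 mul1r. Qed.
Lemma nrmB u v : nrm (u - v) = nrm (v - u).
Proof. by rewrite -nrmN opprB. Qed.

Lemma cauchy_schwarz u v : nm (dot u v) <= nrm u * nrm v.
Proof.
have [v0|vN0] := eqVneq (nrm v) 0.
  by rewrite (nrm_eq0 v0) dot0r nm0 nrm0 mulr0.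
have vp : 0 < nrm v ^+ 2 by rewrite exprn_gt0// lt_def vN0 nrm_ge0.
have vC : (nrm v ^+ 2)%:C != 0 by rewrite eq_complex /= eqxx andbT lt0r_neq0.
set d := dot u v.
have : 0 <= dot (u - (d / (nrm v ^+ 2)%:C) *: v) (u - (d / (nrm v ^+ 2)%:C) *: v).
  exact: dot_ge0.
have -> : dot (u - (d / (nrm v ^+ 2)%:C) *: v) (u - (d / (nrm v ^+ 2)%:C) *: v)
  = (nrm u ^+ 2 - nm d ^+ 2 / nrm v ^+ 2)%:C.
  rewrite !(dotBl, dotBr, dotZl, dotZr) -/d -[dot v u]dotC -/d !dotE.
  rewrite conjM conjV conjc_real.
  rewrite cD cN (cM (nm d ^+ 2)) -nm_mulJ cV.
  by move: vC; move: (_ ^+ 2)%:C (nrm v ^+ 2)%:C => M N N0; field.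
rewrite ler0c subr_ge0 ler_pdivrMr// -exprMn.
by rewrite ler_pXn2r ?nnegrE ?mulr_ge0 ?nrm_ge0 ?nm_ge0.
Qed.

Lemma nrmD2 u v : nrm (u + v) ^+ 2 = nrm u ^+ 2 + 2 * Re (dot u v) + nrm v ^+ 2.
Proof.
rewrite !nrm2E !(dotDl, dotDr) !ReD -[dot v u]dotC ReJ; ring.
Qed.

Lemma nrmD u v : nrm (u + v) <= nrm u + nrm v.
Proof.
rewrite -(ler_pXn2r (ltn0Sn 1)) ?nnegrE ?addr_ge0 ?nrm_ge0// nrmD2.
have := le_trans (Re_le _) (cauchy_schwarz u v).
move/(le_trans (ler_norm _)); nra.
Qed.

Lemma nrm_tri u v w : nrm (u - w) <= nrm (u - v) + nrm (v - w).
Proof. by apply: le_trans (nrmD _ _); rewrite addrA subrK. Qed.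

Lemma pythagoras u v : dot u v = 0 -> nrm (u + v) ^+ 2 = nrm u ^+ 2 + nrm v ^+ 2.
Proof. by move=> h; rewrite nrmD2 h mulr0 addr0. Qed.

Lemma subD W u v : subspace W -> W u -> W v -> W (u + v).
Proof. by move=> [_ h] Wu Wv; have := h 1 u v Wu Wv; rewrite scale1r. Qed.
Lemma subZ W c u : subspace W -> W u -> W (c *: u).
Proof. by move=> [w0 h] Wu; have := h c u 0 Wu w0; rewrite addr0. Qed.
Lemma subB W u v : subspace W -> W u -> W v -> W (u - v).
Proof.
by move=> hW Wu Wv; rewrite addrC -scaleN1r; case: hW => _; apply.
Qed.

(** A geometric rate is asked for, so that minimizing sequences can be chosen
    with their rate and no subsequence has to be extracted. *)
Hypothesis complete : forall f : nat -> V,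
  (forall k, nrm (f k.+1 - f k) <= 2^-1 ^+ k) ->
  exists h, forall k, nrm (f k - h) <= 2 * 2^-1 ^+ k.

Lemma half_pow_lt (e : R) : 0 < e -> exists k, (2^-1 : R) ^+ k < e.
Proof.
move=> e0; have [k hk] : exists k : nat, e^-1 < k%:R.
  exists (Num.truncn e^-1).+1.
  by have := truncnS_gt (e^-1).
exists k; rewrite exprVn -[ltRHS]invrK ltf_pV2 ?posrE ?exprn_gt0 ?invr_gt0//.
apply: lt_trans hk _; rewrite -natrX ltr_nat; exact: ltn_expl.
Qed.

Lemma cauchy_complete (f : nat -> V) :
  (forall e : R, 0 < e -> exists N, forall i j, (N <= i)%N -> (N <= j)%N ->
     nrm (f i - f j) <= e) ->
  exists h, forall e : R, 0 < e -> exists N, forall i, (N <= i)%N -> nrm (f i - h) <= e.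
Proof.
move=> fC.
have hk (k : nat) : exists N, forall i j, (N <= i)%N -> (N <= j)%N ->
     nrm (f i - f j) <= 2^-1 ^+ k by apply: fC; rewrite exprn_gt0.
have [s hs] := choice hk.
pose t := fix t (k : nat) : nat := if k is k'.+1 then maxn (t k') (s k) else s 0%N.
have st k : (s k <= t k)%N by case: k => [|k] //=; rewrite leq_maxr.
have mt k : (t k <= t k.+1)%N by rewrite /= leq_maxl.
have [|h hh] := complete (f := f \o t).
  by move=> k; apply: hs => //; rewrite (leq_trans (st k)).
exists h => e e0.
have [k hek] := @half_pow_lt (e / 3) ltac:(by rewrite divr_gt0).
exists (t k) => i hi.
apply: le_trans (nrm_tri _ (f (t k)) _) _.
have h1 : nrm (f i - f (t k)) <= 2^-1 ^+ k.
  by apply: hs => //; exact: leq_trans (st k) hi.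
have h2 := hh k; rewrite /= in h2; lra.
Qed.

(** The representing vector minimizes [|u| ^+ 2 - 2 Re (l u)] over [W].  The minimum
    is reached in the closure of [W], since [W] itself may not be complete. *)
Theorem riesz W (l : V -> C) (K : R) : subspace W ->
  (forall c u v, W u -> W v -> l (c *: u + v) = c * l u + l v) ->
  (forall u, W u -> nm (l u) <= K * nrm u) ->
  exists h, [/\ forall e : R, 0 < e -> exists2 w, W w & nrm (h - w) < e,
                forall u, W u -> l u = dot u h & 0 <= K -> nrm h <= K].
Proof.
move=> hW ll lK.
have W0 := hW.1.
have lD u v : W u -> W v -> l (u + v) = l u + l v.
  by move=> Wu Wv; have := ll 1 u v Wu Wv; rewrite scale1r mul1r.
have l0 : l 0 = 0.
  by have := lD _ _ W0 W0; rewrite addr0 => /esym/eqP; rewrite -subr_eq0 addrK => /eqP.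
have lZ c u : W u -> l (c *: u) = c * l u.
  by move=> Wu; have := ll c u 0 Wu W0; rewrite addr0 l0 addr0.
pose Phi u := nrm u ^+ 2 - 2 * Re (l u).
pose S := [set Phi u | u in W].
have Phi_lb u : W u -> - K ^+ 2 <= Phi u.
  move=> Wu; have := le_trans (Re_le _) (lK u Wu).
  move/(le_trans (ler_norm _)); rewrite /Phi; have := sqr_ge0 (nrm u - K); nra.
have Sinf : has_inf S.
  split; first by exists (Phi 0), 0.
  by exists (- K ^+ 2) => _ [u Wu <-]; exact: Phi_lb.
set I := inf S.
have IPhi u : W u -> I <= Phi u.
  by move=> Wu; apply: ge_inf; [exact: Sinf.2 | exists u].
(* parallelogram law: a minimizing sequence of Phi is a Cauchy sequence *)
have par u v : W u -> W v ->
    nrm (u - v) ^+ 2 = 2 * Phi u + 2 * Phi v - 4 * Phi (2^-1 *: (u + v)).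
  move=> Wu Wv; rewrite /Phi nrmZ lZ; last exact: subD.
  rewrite lD//.
  have -> : nm (2^-1 : C) = 2^-1.
    have -> : (2^-1 : C) = (2^-1)%:C by rewrite fmorphV rmorph_nat.
    by rewrite nmR ger0_norm.
  have -> : Re (2^-1 * (l u + l v)) = 2^-1 * (Re (l u) + Re (l v)).
    have -> : (2^-1 : C) = (2^-1)%:C by rewrite fmorphV rmorph_nat.
    by rewrite ReM ReD /= mul0r subr0.
  rewrite exprMn !nrmD2 dotNr ReN nrmN; by field.
have parle u v e d : W u -> W v -> Phi u <= I + e -> Phi v <= I + d ->
    nrm (u - v) ^+ 2 <= 2 * e + 2 * d.
  move=> Wu Wv hu hv; rewrite par//.
  have := IPhi (2^-1 *: (u + v)) (subZ _ hW (subD hW Wu Wv)); lra.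
have ek0 k : 0 < (4^-1 * 4^-1 ^+ k : R) by rewrite mulr_gt0// exprn_gt0.
have exu k : exists u, W u /\ Phi u < I + 4^-1 * 4^-1 ^+ k.
  have [_ [u Wu <-] hu] := inf_adherent (ek0 k) Sinf.
  by exists u.
have [f hf] := choice exu.
have fW k : W (f k) by case: (hf k).
have fP k : Phi (f k) <= I + 4^-1 * 4^-1 ^+ k by case: (hf k) => _ /ltW.
have [k|h hh] := complete (f := f).
  rewrite -(ler_pXn2r (ltn0Sn 1)) ?nnegrE ?nrm_ge0 ?exprn_ge0//.
  apply: le_trans (parle _ _ _ _ (fW _) (fW _) (fP _) (fP _)) _.
  rewrite exprAC expr2 -invfM -natrM [in X in X <= _]exprS.
  have := ek0 k; lra.
have lim u (e : R) : 0 < e -> exists k, nrm (f k - h) <= e /\ 4^-1 * 4^-1 ^+ k <= e :> R.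
  move=> e0; have [k hk] := @half_pow_lt (e / 2) ltac:(by rewrite divr_gt0).
  exists k; split; first by have := hh k; lra.
  have : (4^-1 : R) ^+ k <= 2^-1 ^+ k.
    by rewrite lerXn2r// ?nnegrE ?invr_ge0// lef_pV2 ?posrE// ler_nat.
  have : 0 < (4^-1 : R) ^+ k by rewrite exprn_gt0.
  lra.
have lh u : W u -> l u = dot u h.
  move=> Wu; apply/eqP; rewrite -subr_eq0 -oppr_eq0 opprB; set d := _ - _; apply/eqP/nm_eq0.
  (* first variation of Phi at the minimum, in the direction c *: u *)
  have var c : 0 <= 2 * Re (c * d) + nm c ^+ 2 * nrm u ^+ 2.
    rewrite leNgt; apply/negP; set e := (X in X < 0) => e0; rewrite -oppr_gt0 in e0.
    set B : R := 2 * nm c * nrm u + 1.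
    have B0 : 0 < B.
      by rewrite ltr_wpDl// !mulr_ge0 ?nm_ge0 ?nrm_ge0.
    have [k [hk1 hk2]] := lim u (- e / (2 * B)) ltac:(by rewrite divr_gt0// mulr_gt0).
    have := IPhi (c *: u + f k) (hW.2 _ _ _ Wu (fW k)).
    rewrite /Phi nrmD2 nrmZ ll// ReD.
    have := fP k; rewrite /Phi => h1.
    have -> : dot (c *: u) (f k) = c * dot u h + dot (c *: u) (f k - h).
      by rewrite dotBr !dotZl addrC subrK.
    rewrite ReD exprMn.
    have h2 := le_trans (ler_norm _) (le_trans (Re_le _) (cauchy_schwarz (c *: u) (f k - h))).
    rewrite nrmZ in h2.
    have h3 : 2 * (nm c * nrm u * nrm (f k - h)) + 4^-1 * 4^-1 ^+ k <= - e / 2.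
      have -> : - e / 2 = B * (- e / (2 * B)) by field; rewrite lt0r_neq0.
      have := nm_ge0 c; have := nrm_ge0 u; move=> a1 a2; set y := _ / _.
      have -> : B * y = 2 * (nm c * nrm u * y) + y by rewrite /B; ring.
      by apply: lerD => //; rewrite ler_pM2l// ler_wpM2l// mulr_ge0.
    have h4 : Re (c * d) = Re (c * dot u h) - Re (c * l u).
      by rewrite /d mulrBr ReD ReN.
    rewrite /e h4 in e0 h3; lra.
  have [->//|dN0] := eqVneq (nm d) 0.
  have d0 : 0 < nm d by rewrite lt_def dN0 nm_ge0.
  (* for c = - s d^* with s small the term of first order in c dominates *)
  pose s : R := (nrm u ^+ 2 + 1)^-1.
  have q0 : 0 < nrm u ^+ 2 + 1 by rewrite ltr_wpDl// sqr_ge0.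
  have := var (- (s%:C * d^*%C)).
  rewrite nmN nmM nmJ nmR ger0_norm; last by rewrite invr_ge0 ltW.
  have -> : - (s%:C * d^*%C) * d = - (s * nm d ^+ 2)%:C.
    by rewrite cM -nm_mulJ; ring.
  rewrite ReN /=.
  have sq : s * (nrm u ^+ 2 + 1) = 1 by rewrite mulVf// lt0r_neq0.
  have s0 : 0 < s by rewrite invr_gt0.
  rewrite exprMn => hv.
  have hv' : 0 <= (s * nm d ^+ 2) * (- 2 + s * nrm u ^+ 2).
    by apply: le_trans hv _; rewrite le_eqVlt; apply/orP; left; apply/eqP; ring.
  have : s * nrm u ^+ 2 <= 1 by rewrite -sq mulrDr mulr1 lerDl ltW.
  have : 0 < s * nm d ^+ 2 by rewrite mulr_gt0// exprn_gt0.
  move=> p1 p2; move: hv'; rewrite pmulr_rge0//; lra.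
exists h; split=> //.
  move=> e e0; have [k [hk _]] := lim h (e / 2) ltac:(by rewrite divr_gt0).
  by exists (f k) => //; rewrite nrmB; lra.
move=> K0; rewrite leNgt; apply/negP => hK.
have hp : 0 < nrm h by exact: le_lt_trans K0 hK.
have [k [hk _]] := lim h (nrm h * (nrm h - K) / (2 * (K + nrm h))) ltac:(by rewrite divr_gt0 ?mulr_gt0 ?subr_gt0// ltr_wpDl).
set e := _ / _ in hk.
have e0 : 2 * (K + nrm h) * e = nrm h * (nrm h - K).
  by rewrite /e; field; rewrite lt0r_neq0// ltr_wpDl.
have h1 := lK _ (fW k); rewrite lh// in h1.
have h2 : nrm h ^+ 2 <= nm (dot (f k) h) + nrm (f k - h) * nrm h.
  have -> : nrm h ^+ 2 = Re (dot (f k) h) - Re (dot (f k - h) h).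
    by rewrite -ReN -ReD dotBl opprB addrCA subrr addr0 nrm2E.
  apply: lerD; first exact: le_trans (ler_norm _) (Re_le _).
  by apply: le_trans (cauchy_schwarz _ _); rewrite -ReN -[leRHS]nmN; exact: le_trans (ler_norm _) (Re_le _).
have h3 : nrm (f k) <= nrm h + e.
  by have := nrmD (f k - h) h; rewrite subrK; lra.
have : nrm (f k - h) * nrm h <= e * nrm h by rewrite ler_wpM2r// ltW.
have : K * nrm (f k) <= K * (nrm h + e) by rewrite ler_wpM2l.
have : 0 < nrm h * (nrm h - K) by rewrite mulr_gt0// subr_gt0.
move=> p1 p2 p3.
have := le_trans h2 (lerD (le_trans h1 p2) p3).
nra.
Qed.

(** The projection of [u] is the vector representing [<., u>] on [W]. *)
Theorem projection W u : subspace W -> closedV nrm W ->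
  exists2 p, W p & forall w, W w -> dot (u - p) w = 0.
Proof.
move=> hW cW; have [||h [h1 h2 _]] := @riesz W (fun v => dot v u) (nrm u) hW.
- by move=> c v w _ _; rewrite dotDl dotZl.
- by move=> v _; rewrite mulrC; exact: cauchy_schwarz.
exists h; first exact: cW.
by move=> w Ww; rewrite -dotC dotBr h2// subrr conj0.
Qed.

(** The functional [B u |-> <A u, g>] is well defined and bounded on the range of
    [B], and [h] represents it.  This is Douglas' range inclusion [A^* g = B^* h],
    stated without adjoints. *)
Theorem douglas W (A B : V -> V) (K : R) g : subspace W -> 0 <= K ->
  (forall c u v, W u -> W v -> A (c *: u + v) = c *: A u + A v) ->
  (forall c u v, W u -> W v -> B (c *: u + v) = c *: B u + B v) ->
  (forall u, W u -> nrm (A u) <= K * nrm (B u)) ->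
  exists h, [/\ forall e : R, 0 < e -> exists2 w, (B @` W) w & nrm (h - w) < e,
     nrm h <= K * nrm g & forall u, W u -> dot (A u) g = dot (B u) h].
Proof.
move=> hW K0 Al Bl AB.
pose pre v := xget 0 [set u | W u /\ B u = v].
have preP v : (B @` W) v -> W (pre v) /\ B (pre v) = v.
  by case=> u Wu uv; have := @xgetPex _ 0 [set u | W u /\ B u = v]; apply; exists u.
have AE u v : W u -> W v -> B u = B v -> A u = A v.
  move=> Wu Wv E; apply/eqP; rewrite -subr_eq0; apply/eqP.
  have lin L : (forall c u v, W u -> W v -> L (c *: u + v) = c *: L u + L v) ->
      L (u - v) = L u - L v :> V.
    by move=> Ll; rewrite addrC -scaleN1r Ll// scaleN1r addrC.
  rewrite -lin//; apply: nrm_eq0; apply/eqP; rewrite eq_le nrm_ge0 andbT.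
  by apply: le_trans (AB _ (subB hW Wu Wv)) _; rewrite lin// E subrr nrm0 mulr0.
have B0 : B 0 = 0.
  have := Bl 1 0 0 hW.1 hW.1; rewrite !scale1r addr0 => /esym/eqP.
  by rewrite -subr_eq0 addrK => /eqP.
have hBW : subspace (B @` W).
  split; first by exists 0 => //; exact: hW.1.
  by move=> c _ _ [u Wu <-] [v Wv <-]; exists (c *: u + v); [exact: hW.2|exact: Bl].
have lE u : W u -> dot (A (pre (B u))) g = dot (A u) g.
  move=> Wu; have [] := preP (B u); first by exists u.
  by move=> W1 E; rewrite (AE _ u).
have [||h [h1 h2 h3]] := @riesz (B @` W) (fun v => dot (A (pre v)) g) (K * nrm g) hBW.
- move=> c _ _ [u Wu <-] [v Wv <-].
  by rewrite -Bl// !lE ?Al ?dotDl ?dotZl//; exact: hW.2.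
- move=> _ [u Wu <-]; rewrite lE//; apply: le_trans (cauchy_schwarz _ _) _.
  by rewrite mulrAC ler_wpM2r ?nrm_ge0// AB.
exists h; split=> //; first by apply: h3; rewrite mulr_ge0 ?nrm_ge0.
by move=> u Wu; rewrite -h2 ?lE//; exists u.
Qed.

End Hilbert.
(** * Square roots of positive operators *)

Section SquareRoot.
Context {R : realType} {V : lmodType R[i]} (dot : V -> V -> R[i]).
Local Notation C := R[i].
Implicit Types (u v w : V) (c : C) (W : set V).
Hypothesis dotDl : forall u v w, dot (u + v) w = dot u w + dot v w.
Hypothesis dotZl : forall c u v, dot (c *: u) v = c * dot u v.
Hypothesis dotC : forall u v, (dot u v)^*%C = dot v u.
Hypothesis dot_ge0 : forall u, 0 <= dot u u.
Hypothesis dot_eq0 : forall u, dot u u = 0 -> u = 0.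
Local Notation nrm := (nrm dot).
Hypothesis complete : forall f : nat -> V,
  (forall k, nrm (f k.+1 - f k) <= 2^-1 ^+ k) ->
  exists h, forall k, nrm (f k - h) <= 2 * 2^-1 ^+ k.

Variable X : V -> V.
Hypothesis Xlin : forall c u v, X (c *: u + v) = c *: X u + X v.
Hypothesis Xsa : forall u v, dot (X u) v = dot u (X v).
Hypothesis Xle : forall u, nrm (X u) <= nrm u.

Let nrm_ge0 := nrm_ge0 dot.
Let nrmD := nrmD dotDl dotZl dotC dot_ge0 dot_eq0.
Let nrmZ := nrmZ dotZl dotC dot_ge0.
Let nrm0 := nrm0 dotZl.
Let nrm_tri := nrm_tri dotDl dotZl dotC dot_ge0 dot_eq0.
Let nrmB := nrmB dotZl dotC dot_ge0.

(** Fixed point iteration for [Z = (X + Z ^ 2) / 2], that is, for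
    [(1 - Z) ^ 2 = 1 - X], and its scalar version with [X] replaced by [1]. *)
Fixpoint sq_iter n : V -> V :=
  if n is n'.+1 then fun u => 2^-1 *: (X u + sq_iter n' (sq_iter n' u))
  else fun=> 0.
Fixpoint sq_scalar n : R := if n is n'.+1 then 2^-1 * (1 + sq_scalar n' ^+ 2) else 0.
Local Notation Y := sq_iter.
Local Notation y := sq_scalar.

Lemma linop_facts (T : V -> V) :
  (forall c u v, T (c *: u + v) = c *: T u + T v) ->
  [/\ T 0 = 0, forall u v, T (u + v) = T u + T v,
      forall c u, T (c *: u) = c *: T u & forall u v, T (u - v) = T u - T v].
Proof.
move=> Tl; have T0 : T 0 = 0.
  have := Tl 1 0 0; rewrite !scale1r addr0 => /esym/eqP.
  by rewrite -subr_eq0 addrK => /eqP.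
split=> // [u v|c u|u v].
- by have := Tl 1 u v; rewrite !scale1r.
- by have := Tl c u 0; rewrite !addr0 T0 addr0.
- by rewrite addrC -scaleN1r Tl scaleN1r addrC.
Qed.

Lemma nm_half : nm (2^-1 : C) = 2^-1.
Proof.
have -> : (2^-1 : C) = (2^-1)%:C by rewrite fmorphV rmorph_nat.
by rewrite nmR ger0_norm.
Qed.

Lemma half_double u : 2^-1 *: (u + u) = u :> V.
Proof. 
have -> : u + u = (2 : C) *: u by rewrite scaler_nat.
by rewrite scalerA mulVf ?scale1r// pnatr_eq0.
Qed.

Lemma sq_scalar_bounds n : 0 <= y n <= 1.
Proof. by elim: n => [|n /andP[h1 h2]] /=; rewrite ?lexx ?ler01//; apply/andP; nra. Qed.

Lemma sq_scalar_le n : y n <= y n.+1.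
Proof. by rewrite /=; have := sqr_ge0 (y n - 1); lra. Qed.

Lemma sq_scalar_homo i j : (i <= j)%N -> y i <= y j.
Proof. 
have h : nondecreasing_seq y by apply/nondecreasing_seqP; exact: sq_scalar_le.
exact: h.
Qed.

Lemma sq_scalar_cauchy (e : R) : 0 < e ->
  exists N, forall i j, (N <= i)%N -> (N <= j)%N -> y j - y i <= e.
Proof.
move=> e0; pose S := [set y n | n in setT].
have hS : has_sup S.
  split; first by exists (y 0%N), 0%N.
  by exists 1 => _ [n _ <-]; case/andP: (sq_scalar_bounds n).
have [_ [N _ <-] hN] := sup_adherent e0 hS.
exists N => i j hi hj.
have h1 : y j <= sup S by apply: ub_le_sup; [exact: hS.2|exists j].
have := sq_scalar_homo hi; lra.
Qed.

Lemma sq_iter_lin n c u v : Y n (c *: u + v) = c *: Y n u + Y n v.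
Proof.
elim: n c u v => [|n IH] c u v /=; first by rewrite scaler0 addr0.
rewrite Xlin !IH !scalerDr !scalerA [c * _]mulrC -!scalerA -!addrA.
by congr (_ + _); rewrite addrCA.
Qed.

Lemma sq_iter_comm (Z : V -> V) n : (forall c u v, Z (c *: u + v) = c *: Z u + Z v) ->
  (forall u, Z (X u) = X (Z u)) -> forall u, Z (Y n u) = Y n (Z u).
Proof.
move=> Zl ZX; have [Z0 ZD ZZ _] := linop_facts Zl.
by elim: n => [|n IH] u //=; rewrite ZZ ZD ZX !IH.
Qed.

Lemma sq_iter_commute m n u : Y m (Y n u) = Y n (Y m u).
Proof.
apply: sq_iter_comm; first exact: sq_iter_lin.
by move=> v; rewrite (@sq_iter_comm X).
Qed.

Lemma sq_iter_le n u : nrm (Y n u) <= y n * nrm u.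
Proof.
elim: n u => [|n IH] u /=; first by rewrite nrm0 mul0r.
rewrite nrmZ nm_half -mulrA ler_pM2l// mulrDl mul1r.
apply: le_trans (nrmD _ _) _; apply: lerD => //.
apply: le_trans (IH _) _; rewrite expr2 -mulrA ler_wpM2l//.
by case/andP: (sq_scalar_bounds n).
Qed.

(** The increments of the operator iteration are dominated by those of the scalar
    one, which increase to a finite limit. *)
Lemma sq_iter_step n u : nrm (Y n.+1 u - Y n u) <= (y n.+1 - y n) * nrm u.
Proof.
elim: n u => [|n IH] u.
  rewrite /= !subr0 expr0n /= !addr0 mulr1 nrmZ nm_half.
  by rewrite ler_pM2l.
have [_ _ _ YB] := linop_facts (sq_iter_lin n).
have [_ _ _ YB'] := linop_facts (sq_iter_lin n.+1).
(* Y' ^ 2 - Y ^ 2 = Y' (Y' - Y) + Y (Y' - Y) since the iterates commute *)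
have -> : Y n.+2 u - Y n.+1 u =
    2^-1 *: (Y n.+1 (Y n.+1 u - Y n u) + Y n (Y n.+1 u - Y n u)).
  rewrite YB YB' (sq_iter_commute n n.+1) -[LHS]/(_ *: _ - _ *: _) -scalerBr.
  congr (_ *: _); rewrite -[Y n.+1 (Y n u)]/(Y n.+1 (Y n u)).
  by rewrite addrA subrK opprD addrACA subrr add0r.
have -> : y n.+2 - y n.+1 = 2^-1 * ((y n.+1 + y n) * (y n.+1 - y n)).
  rewrite -[y n.+2]/(2^-1 * (1 + y n.+1 ^+ 2)).
  have : y n.+1 = 2^-1 * (1 + y n ^+ 2) by [].
  by move: (y n.+1) (y n) => a b; lra.
rewrite nrmZ nm_half -mulrA ler_pM2l//; apply: le_trans (nrmD _ _) _.
have := le_trans (sq_iter_le n.+1 _) (ler_wpM2l (proj1 (andP (sq_scalar_bounds n.+1))) (IH u)).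
have := le_trans (sq_iter_le n _) (ler_wpM2l (proj1 (andP (sq_scalar_bounds n))) (IH u)).
move: (y n.+1) (y n) => a b h1 h2; rewrite !mulrDl -!mulrA.
exact: lerD.
Qed.

Lemma sq_iter_diff i j u : (i <= j)%N -> nrm (Y j u - Y i u) <= (y j - y i) * nrm u.
Proof.
elim: j => [|j IH]; first by rewrite leqn0 => /eqP ->; rewrite !subrr nrm0 mul0r.
rewrite leq_eqVlt => /orP[/eqP ->|]; first by rewrite !subrr nrm0 mul0r.
rewrite ltnS => /IH h; apply: le_trans (nrm_tri _ (Y j u) _) _.
have := sq_iter_step j u; lra.
Qed.

Lemma sq_iter_cvg u : exists h, forall e : R, 0 < e ->
  exists N, forall i, (N <= i)%N -> nrm (Y i u - h) <= e.
Proof.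
apply: (cauchy_complete dotDl dotZl dotC dot_ge0 dot_eq0 complete) => e e0.
have k0 : 0 < nrm u + 1 by rewrite ltr_wpDl.
have [N hN] := @sq_scalar_cauchy (e / (nrm u + 1)) ltac:(by rewrite divr_gt0).
have key i j : (N <= i)%N -> (N <= j)%N -> (i <= j)%N -> nrm (Y j u - Y i u) <= e.
  move=> hi hj ij; apply: le_trans (sq_iter_diff u ij) _.
  have := hN i j hi hj; rewrite ler_pdivlMr//.
  have : y i <= y j by exact: sq_scalar_homo.
  have := nrm_ge0 u; nra.
exists N => i j hi hj; have [ij|/ltnW ij] := leqP i j; last exact: key.
by rewrite nrmB; apply: key.
Qed.

Lemma nrm_le_eps u : (forall e : R, 0 < e -> nrm u <= e) -> u = 0.
Proof.
move=> h; apply: (nrm_eq0 dot_ge0 dot_eq0); apply/eqP; rewrite eq_le nrm_ge0 andbT.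
by rewrite leNgt; apply/negP => p; have := h (nrm u / 2) ltac:(by rewrite divr_gt0); lra.
Qed.

(** The positive square root of [1 - X] is [1 - Z] with [Z] the limit of the
    iteration [Y |-> (X + Y^2) / 2] started at [0].  All iterates are
    polynomials in [X] with nonnegative coefficients, so that their increments
    are dominated by those of the scalar iteration with [X = 1]. *)
Theorem sqrt_exists : exists A : V -> V,
  [/\ forall c u v, A (c *: u + v) = c *: A u + A v,
      forall u, nrm (A u) <= 2 * nrm u,
      forall u, 0 <= dot (A u) u,
      forall u, A (A u) = u - X u &
      forall W, subspace W -> closedV nrm W -> (forall u, W u -> W (X u)) ->
        forall u, W u -> W (A u)].
Proof.
have [Z ZP] := choice sq_iter_cvg.
have ZP2 u v (e : R) : 0 < e -> exists i, nrm (Y i u - Z u) <= e /\ nrm (Y i v - Z v) <= e.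
  move=> e0; have [N1 h1] := ZP u e e0; have [N2 h2] := ZP v e e0.
  by exists (maxn N1 N2); rewrite h1 ?h2 ?leq_maxl ?leq_maxr.
have Zle u : nrm (Z u) <= nrm u.
  rewrite leNgt; apply/negP => h.
  have [N hN] := ZP u ((nrm (Z u) - nrm u) / 2) ltac:(by rewrite divr_gt0// subr_gt0).
  have := hN N (leqnn N); rewrite nrmB => h1.
  have := nrmD (Z u - Y N u) (Y N u); rewrite subrK.
  have := sq_iter_le N u; have /andP[y0 y1] := sq_scalar_bounds N.
  have := nrm_ge0 u; nra.
have Zlin c u v : Z (c *: u + v) = c *: Z u + Z v.
  apply/eqP; rewrite -subr_eq0; apply/eqP; apply: nrm_le_eps => e e0.
  have k0 : 0 < nm c + 2 by rewrite ltr_wpDl ?nm_ge0.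
  set d := e / (nm c + 2).
  have d0 : 0 < d by rewrite divr_gt0.
  have [N1 h1] := ZP u d d0; have [N2 h2] := ZP v d d0.
  have [N3 h3] := ZP (c *: u + v) d d0.
  pose i := maxn N1 (maxn N2 N3).
  have {}h1 := h1 i (leq_maxl _ _).
  have {}h2 := h2 i (leq_trans (leq_maxl _ _) (leq_maxr _ _)).
  have {}h3 := h3 i (leq_trans (leq_maxr _ _) (leq_maxr _ _)).
  have -> : e = d + (nm c * d + d).
    by rewrite /d; field; rewrite lt0r_neq0.
  apply: le_trans (nrm_tri _ (Y i (c *: u + v)) _) _.
  rewrite nrmB; apply: lerD => //.
  rewrite sq_iter_lin opprD addrACA -scalerBr.
  by apply: le_trans (nrmD _ _) _; rewrite nrmZ; apply: lerD => //; rewrite ler_wpM2l ?nm_ge0.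
have [Z0 ZD ZZ ZB] := linop_facts Zlin.
have ZE u : Z u = 2^-1 *: (X u + Z (Z u)).
  apply/eqP; rewrite -subr_eq0; apply/eqP; apply: nrm_le_eps => e e0.
  have [N1 h1] := ZP u (e / 2) ltac:(by rewrite divr_gt0).
  have [N2 h2] := ZP (Z u) (e / 2) ltac:(by rewrite divr_gt0).
  pose i := maxn N1 N2.
  have h3 := h1 i.+1 (leq_trans (leq_maxl _ _) (leqnSn _)).
  have {}h1 := h1 i (leq_maxl _ _); have {}h2 := h2 i (leq_maxr _ _).
  apply: le_trans (nrm_tri _ (Y i.+1 u) _) _.
  rewrite nrmB /= -scalerBr opprD addrACA subrr add0r nrmZ nm_half.
  have [_ _ _ YB] := linop_facts (sq_iter_lin i).
  have h4 : nrm (Y i (Y i u) - Y i (Z u)) <= e / 2.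
    rewrite -YB; apply: le_trans (sq_iter_le _ _) _.
    apply: le_trans h1; have /andP[y0 y1] := sq_scalar_bounds i.
    by rewrite ler_piMl.
  have := nrm_tri (Y i (Y i u)) (Y i (Z u)) (Z (Z u)).
  by rewrite /= in h3; lra.
have Ysa n u v : dot (Y n u) v = dot u (Y n v).
  elim: n u v => [|n IH] u v /=; first by rewrite (dot0l dotZl) (dot0r dotZl dotC).
  rewrite dotZl dotDl Xsa !IH (dotZr dotZl dotC) (dotDr dotDl dotC).
  have -> : (2^-1 : C) = (2^-1)%:C by rewrite cV rmorph_nat.
  by rewrite conjc_real.
have Zsa u v : dot (Z u) v = dot u (Z v).
  apply/eqP; rewrite -subr_eq0; apply/eqP/nm_eq0/eqP; rewrite eq_le nm_ge0 andbT.
  rewrite leNgt; apply/negP; set e := nm _ => e0.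
  have k0 : 0 < nrm u + nrm v + 1 by rewrite ltr_wpDl// addr_ge0.
  have [i [h1 h2]] := ZP2 u v (e / (nrm u + nrm v + 1)) ltac:(by rewrite divr_gt0).
  have cs := cauchy_schwarz dotDl dotZl dotC dot_ge0 dot_eq0.
  have : e <= nrm (Y i u - Z u) * nrm v + nrm u * nrm (Y i v - Z v).
    apply: le_trans (lerD (cs _ _) (cs _ _)).
    rewrite -(nmN (dot (Y i u - Z u) v)); apply: le_trans _ (nmD _ _).
    rewrite (dotBl dotDl dotZl) (dotBr dotDl dotZl dotC) Ysa /e.
    by rewrite opprB addrA subrK.
  rewrite ler_pdivlMr// in h1; rewrite ler_pdivlMr// in h2.
  have n1 := nrm_ge0 u; have n2 := nrm_ge0 v.
  have n3 := nrm_ge0 (Y i u - Z u); have n4 := nrm_ge0 (Y i v - Z v); nra.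
exists (fun u => u - Z u); split.
- move=> c u v; rewrite Zlin scalerBr opprD addrACA; congr (_ + _).
- move=> u; apply: le_trans (nrmD _ _) _; rewrite (nrmN dotZl dotC dot_ge0).
  by have := Zle u; lra.
- move=> u; rewrite (dotBl dotDl dotZl).
  have zr : Im (dot (Z u) u) = 0.
    have := congr1 (@complex.Im _) (dotC (Z u) u); rewrite -Zsa ImJ => h.
    by move: h; move: (complex.Im _) => x h; lra.
  rewrite lecE (dotE dot_ge0) ImD ImN zr ReD ReN /= subr0 eqxx /= subr_ge0.
  apply: le_trans (le_trans (ler_norm _) (Re_le _)) _.
  apply: le_trans (cauchy_schwarz dotDl dotZl dotC dot_ge0 dot_eq0 _ _) _.
  by rewrite expr2 ler_wpM2r.
- move=> u; rewrite ZB.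
  have h : X u = Z u + Z u - Z (Z u).
    by rewrite {1 2}ZE -scalerDr half_double addrK.
  by rewrite h !opprD !opprK !addrA.
- move=> W hW cW XW u Wu; apply: subB => //; apply: cW => e e0.
  have [N hN] := ZP u (e / 2) ltac:(by rewrite divr_gt0).
  exists (Y N u); last by rewrite nrmB; have := hN N (leqnn N); lra.
  elim: N {hN} u Wu => [|N IH] u Wu /=; first exact: hW.1.
  by apply: subZ => //; apply: subD => //; [exact: XW|exact/IH/IH].
Qed.

End SquareRoot.
(** * Measurable and integrable functions on the circle *)

Section Circle.
Context {R : realType}.
Local Notation C := R[i].
Local Notation mu := (@lebesgue_measure R).
Local Notation arc := (@arcT R).
Local Notation circ := (@circ R).
Implicit Types (F G H : C -> C).

Lemma arc_meas : measurable arc. Proof. exact: measurable_itv. Qed.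
Lemma arc_lty : (mu arc < +oo)%E.
Proof.
rewrite /arcT lebesgue_measure_itv; case: ifPn => // _.
by rewrite -EFinB ltry.
Qed.
Lemma two_pi_gt0 : 0 < 2 * pi :> R.
Proof. by rewrite mulr_gt0// pi_gt0. Qed.
Hint Resolve arc_meas arc_lty two_pi_gt0 : core.
Lemma arc_measure : mu arc = (2 * pi)%:E.
Proof. by rewrite /arcT lebesgue_measure_itv /= lte_fin two_pi_gt0 -EFinB subr0. Qed.

Lemma nm_circ t : nm (circ t) = 1.
Proof. by rewrite /Defs.circ /= cos2Dsin2 sqrtr1. Qed.
Lemma circD s t : circ (s + t) = circ s * circ t.
Proof.
by apply: cplxP; rewrite /Defs.circ ?ReM ?ImM /= ?cosD ?sinD// addrC [X in X + _]mulrC.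
Qed.
Lemma circ_mulJ t : circ t * (circ t)^*%C = 1.
Proof. by rewrite nm_mulJ nm_circ expr1n. Qed.

Definition mT F := measurable_fun arc (fun t => Re (F (circ t))) /\
  measurable_fun arc (fun t => Im (F (circ t))).
Definition L1T F := mu.-integrable arc (EFin \o (fun t => Re (F (circ t)))) /\
  mu.-integrable arc (EFin \o (fun t => Im (F (circ t)))).

Lemma mT_cst c : mT (fun=> c).
Proof. by split; exact: measurable_cst. Qed.
Lemma mT_id : mT (fun z => z).
Proof.
split; apply: measurable_funTS; apply: continuous_measurable_fun.
- exact: continuous_cos.
- exact: continuous_sin.
Qed.
Lemma mT_add F G : mT F -> mT G -> mT (fun z => F z + G z).
Proof.
move=> [f1 f2] [g1 g2]; split.
- under eq_fun do rewrite ReD; exact: measurable_funD.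
- under eq_fun do rewrite ImD; exact: measurable_funD.
Qed.
Lemma mT_mul F G : mT F -> mT G -> mT (fun z => F z * G z).
Proof.
move=> [f1 f2] [g1 g2]; split.
- under eq_fun do rewrite ReM; apply: measurable_funB; exact: measurable_funM.
- under eq_fun do rewrite ImM; apply: measurable_funD; exact: measurable_funM.
Qed.
Lemma mT_conj F : mT F -> mT (fun z => (F z)^*%C).
Proof.
move=> [f1 f2]; split; first by under eq_fun do rewrite ReJ.
by under eq_fun do rewrite ImJ; exact: measurable_funN.
Qed.
Lemma mT_exp n : mT (fun z => z ^+ n).
Proof.
elim: n => [|n IH]; first by under eq_fun do rewrite expr0; exact: mT_cst.
under eq_fun do rewrite exprS; apply: mT_mul => //; exact: mT_id.
Qed.
Lemma mT_poly (p : {poly C}) : mT (fun z => p.[z]).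
Proof.
elim/poly_ind: p => [|p c IH].
  by under eq_fun do rewrite horner0; exact: mT_cst.
under eq_fun do rewrite hornerMXaddC.
by apply: mT_add; [apply: mT_mul => //; exact: mT_id|exact: mT_cst].
Qed.

Lemma measurable_inv (D : set R) (f : R -> R) : measurable D ->
  measurable_fun D f -> measurable_fun D (fun t => (f t)^-1).
Proof.
move=> mD mf.
have -> : (fun t => (f t)^-1) = (fun t => f t * ((f t ^+ 2) `^ (-1))).
  apply/funext => t; rewrite powR_inv1 ?sqr_ge0// expr2 invfM mulrA.
  by have [->|h] := eqVneq (f t) 0; rewrite ?invr0 ?mul0r// mulfV// mul1r.
apply: measurable_funM => //.
apply: (measurableT_comp (measurable_powR (-1))).
exact: measurable_funX.
Qed.

Lemma mT_inv F : mT F -> mT (fun z => (F z)^-1).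
Proof.
move=> [f1 f2].
have h : measurable_fun arc (fun t => (Re (F (circ t)) ^+ 2 + Im (F (circ t)) ^+ 2)^-1).
  by apply: measurable_inv => //; apply: measurable_funD; exact: measurable_funX.
split.
- have -> : (fun t => Re (F (circ t))^-1) = (fun t => Re (F (circ t)) *
      (Re (F (circ t)) ^+ 2 + Im (F (circ t)) ^+ 2)^-1).
    by apply/funext => t; case: (F _).
  exact: measurable_funM.
- have -> : (fun t => Im (F (circ t))^-1) = (fun t => - (Im (F (circ t)) *
      (Re (F (circ t)) ^+ 2 + Im (F (circ t)) ^+ 2)^-1)).
    by apply/funext => t; case: (F _).
  by apply: measurable_funN; exact: measurable_funM.
Qed.

Lemma measurable_nm F : mT F -> measurable_fun arc (fun t => nm (F (circ t))).
Proof.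
move=> [f1 f2].
have -> : (fun t => nm (F (circ t))) = (fun t => (Re (F (circ t)) ^+ 2 + Im (F (circ t)) ^+ 2) `^ 2^-1).
  apply/funext => t; rewrite powR12_sqrt ?addr_ge0 ?sqr_ge0//.
  by rewrite -nm_sqr sqrtr_sqr ger0_norm ?nm_ge0.
apply: (measurableT_comp (measurable_powR 2^-1)).
by apply: measurable_funD; exact: measurable_funX.
Qed.

Lemma integrable_dom (f g : R -> R) : measurable_fun arc f ->
  (forall t, arc t -> `|f t| <= g t) -> mu.-integrable arc (EFin \o g) ->
  mu.-integrable arc (EFin \o f).
Proof.
move=> mf fg ig; apply: le_integrable ig => //; first exact/measurable_EFinP.
move=> t /fg h; rewrite /= lee_fin; apply: le_trans h _; exact: ler_norm.
Qed.

Lemma arc_intD (f g : R -> R) : mu.-integrable arc (EFin \o f) ->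
  mu.-integrable arc (EFin \o g) -> mu.-integrable arc (EFin \o (fun t => f t + g t)).
Proof.
by move=> hf hg; exact: (@integrableD _ _ _ mu arc arc_meas _ _ hf hg).
Qed.
Lemma arc_intZ (r : R) (f : R -> R) : mu.-integrable arc (EFin \o f) ->
  mu.-integrable arc (EFin \o (fun t => r * f t)).
Proof.
by move=> hf; exact: (@integrableZl _ _ _ mu arc arc_meas r _ hf).
Qed.

Lemma L1T_dom F (g : R -> R) : mT F -> (forall t, arc t -> nm (F (circ t)) <= g t) ->
  mu.-integrable arc (EFin \o g) -> L1T F.
Proof.
move=> [f1 f2] Fg ig; split; apply: integrable_dom ig => // t /Fg h.
- exact: le_trans (Re_le _) h.
- exact: le_trans (Im_le _) h.
Qed.

Lemma L1T_mT F : L1T F -> mT F.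
Proof. by case=> /measurable_int/measurable_EFinP h1 /measurable_int/measurable_EFinP h2. Qed.

Lemma integrable_nm F : L1T F -> mu.-integrable arc (EFin \o (fun t => nm (F (circ t)))).
Proof.
move=> hF; have [i1 i2] := hF.
apply: (@integrable_dom _ (fun t => `|Re (F (circ t))| + `|Im (F (circ t))|)).
- apply: measurable_nm; exact: L1T_mT.
- by move=> t _; rewrite ger0_norm ?nm_ge0//; exact: nm_le_ReIm.
- by apply: arc_intD; exact: integrable_norm.
Qed.

Lemma L1T_lin c F G : L1T F -> L1T G -> L1T (fun z => c * F z + G z).
Proof.
move=> hF hG; apply: (@L1T_dom _ (fun t => nm c * nm (F (circ t)) + nm (G (circ t)))).
- by apply: mT_add; [apply: mT_mul; [exact: mT_cst|exact: L1T_mT]|exact: L1T_mT].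
- by move=> t _; apply: le_trans (nmD _ _) _; rewrite nmM.
- apply: arc_intD; last exact: integrable_nm.
  apply: arc_intZ; exact: (integrable_nm hF).
Qed.

Lemma integrable_cst_arc (r : R) : mu.-integrable arc (EFin \o (fun=> r)).
Proof.
apply: measurable_bounded_integrable => //.
exact: bounded_cst.
Qed.

Lemma L1T_bdd F K : mT F -> (forall t, nm (F (circ t)) <= K) -> L1T F.
Proof. by move=> mF FK; apply: (@L1T_dom _ (fun=> K)) => //; exact: integrable_cst_arc. Qed.

Lemma L1T_cst c : L1T (fun=> c).
Proof. by apply: (@L1T_bdd _ (nm c)) => //; exact: mT_cst. Qed.
Lemma L1T_add F G : L1T F -> L1T G -> L1T (fun z => F z + G z).
Proof.
by move=> hF hG; have := L1T_lin 1 hF hG; under eq_fun do rewrite mul1r.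
Qed.
Lemma L1T_scale c F : L1T F -> L1T (fun z => c * F z).
Proof.
by move=> hF; have := L1T_lin c hF (L1T_cst 0); under eq_fun do rewrite addr0.
Qed.
Lemma L1T_mul_bdd F G K : mT F -> (forall t, nm (F (circ t)) <= K) -> L1T G ->
  L1T (fun z => F z * G z).
Proof.
move=> mF FK hG; apply: (@L1T_dom _ (fun t => K * nm (G (circ t)))).
- by apply: mT_mul => //; exact: L1T_mT.
- by move=> t _; rewrite nmM ler_wpM2r ?nm_ge0.
- apply: arc_intZ; exact: integrable_nm hG.
Qed.

Local Notation mint f := (Rintegral mu arc f).

Lemma intTE F : intT F =
  ((2 * pi)^-1 * mint (fun t => Re (F (circ t)))) +i*
  ((2 * pi)^-1 * mint (fun t => Im (F (circ t)))).
Proof. by []. Qed.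

Lemma intT_add F G : L1T F -> L1T G -> intT (fun z => F z + G z) = intT F + intT G.
Proof.
move=> [f1 f2] [g1 g2]; apply: cplxP; rewrite ?ReD ?ImD /= -mulrDr.
- by congr (_ * _); under eq_Rintegral do rewrite ReD; exact: RintegralD.
- by congr (_ * _); under eq_Rintegral do rewrite ImD; exact: RintegralD.
Qed.

Lemma intT_scale c F : L1T F -> intT (fun z => c * F z) = c * intT F.
Proof.
move=> [f1 f2].
have Z (r : R) f : mu.-integrable arc (EFin \o f) -> mu.-integrable arc (EFin \o (fun t => r * f t)).
  by move=> hf; exact: arc_intZ.
apply: cplxP; rewrite ?ReM ?ImM /=.
- under eq_Rintegral do rewrite ReM.
  by rewrite RintegralB ?RintegralZl//; [ring|exact: Z|exact: Z].
- under eq_Rintegral do rewrite ImM.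
  by rewrite RintegralD ?RintegralZl//; [ring|exact: Z|exact: Z].
Qed.

Lemma intT_lin c F G : L1T F -> L1T G -> intT (fun z => c * F z + G z) = c * intT F + intT G.
Proof. by move=> hF hG; rewrite intT_add ?intT_scale//; exact: L1T_scale. Qed.

Lemma intT_conj F : L1T F -> intT (fun z => (F z)^*%C) = (intT F)^*%C.
Proof.
move=> [f1 f2]; apply: cplxP; rewrite ?ReJ ?ImJ /=.
- by under eq_Rintegral do rewrite ReJ.
- under eq_Rintegral do rewrite ImJ -mulN1r.
  by rewrite RintegralZl// mulN1r mulrN.
Qed.

Lemma two_pi_neq0 : 2 * pi != 0 :> R. Proof. exact: lt0r_neq0. Qed.
Lemma two_pi_ge0 : 0 <= 2 * pi :> R. Proof. exact: ltW. Qed.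
Lemma mint_cst (r : R) : mint (fun=> r) = r * (2 * pi).
Proof.
rewrite Rintegral_cst// [X in fine X](_ : _ = (2 * pi)%:E)//; exact: arc_measure.
Qed.

Lemma intT_cst (c : C) : intT (fun=> c) = c.
Proof.
have h r : (2 * pi)^-1 * mint (fun=> r) = r by rewrite mint_cst mulrC mulfK// two_pi_neq0.
by apply: cplxP; rewrite /= h.
Qed.

Lemma eq_intT F G : (forall t, F (circ t) = G (circ t)) -> intT F = intT G.
Proof. by move=> h; apply: cplxP => /=; congr (_ * _); apply: eq_Rintegral => t _; rewrite h. Qed.

Lemma arc_aeS (P Q : R -> Prop) : {ae mu, forall t, arc t -> P t} ->
  (forall t, P t -> Q t) -> {ae mu, forall t, arc t -> Q t}.
Proof.
move=> h PQ; apply: (@filterS _ _ (ae_filter_ringOfSetsType mu) _ _ _ h) => t h1 /h1.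
exact: PQ.
Qed.
Lemma arc_aeS2 (P1 P2 Q : R -> Prop) : {ae mu, forall t, arc t -> P1 t} ->
  {ae mu, forall t, arc t -> P2 t} ->
  (forall t, P1 t -> P2 t -> Q t) -> {ae mu, forall t, arc t -> Q t}.
Proof.
move=> k1 k2 PQ.
apply: (@filterS2 _ _ (ae_filter_ringOfSetsType mu) _ _ _ _ k1 k2) => t h1 h2 ht.
exact: PQ (h1 ht) (h2 ht).
Qed.

Lemma ae_intT F G : mT F -> mT G -> ae_eqT F G -> intT F = intT G.
Proof.
move=> [f1 f2] [g1 g2] h; apply: cplxP => /=; congr (_ * _); congr fine;
  apply: ae_eq_integral => //; try exact/measurable_EFinP; apply: (arc_aeS h) => t -> //.
Qed.

Lemma ae_eqT_refl F : ae_eqT F F. Proof. exact: aeW. Qed.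
Lemma ae_eqT_sym F G : ae_eqT F G -> ae_eqT G F.
Proof. by move=> h; apply: (arc_aeS h). Qed.
Lemma ae_eqT_pt F G : (forall t, F (circ t) = G (circ t)) -> ae_eqT F G.
Proof. by move=> h; apply: aeW => t _. Qed.

(** ** Square integrable functions *)

Lemma L2TP F : L2T F <-> mT F /\ L1T (fun z => F z * (F z)^*%C).
Proof.
split.
- move=> [f1 f2 h]; have mF : mT F by [].
  split => //; apply: (@L1T_dom _ (fun t => nm (F (circ t)) ^+ 2)).
  + by apply: mT_mul => //; exact: mT_conj.
  + by move=> t _; rewrite nmM nmJ.
  + apply/integrableP; split.
      by apply/measurable_EFinP/measurable_funX; exact: measurable_nm.
    by under eq_integral => t _ do rewrite /= ger0_norm ?sqr_ge0//.
- move=> [[f1 f2] h]; split => //.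
  have /integrableP[_] := integrable_nm h.
  by under eq_integral => t _ do rewrite /= nmM nmJ ger0_norm ?sqr_ge0//.
Qed.

Lemma L2T_mT F : L2T F -> mT F. Proof. by case/L2TP. Qed.

Lemma L2T_nm2 F : L2T F -> mu.-integrable arc (EFin \o (fun t => nm (F (circ t)) ^+ 2)).
Proof.
case/L2TP => _ /integrable_nm; apply: eq_integrable => // t _.
by rewrite /= nmM nmJ.
Qed.

Lemma L2T_dom F (g : R -> R) : mT F -> (forall t, nm (F (circ t)) ^+ 2 <= g t) ->
  mu.-integrable arc (EFin \o g) -> L2T F.
Proof.
move=> mF Fg ig; apply/L2TP; split=> //; apply: L1T_dom ig.
  by apply: mT_mul => //; exact: mT_conj.
by move=> t _; rewrite nmM nmJ -expr2.
Qed.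

Lemma L2T_mul_L1T F G : L2T F -> L2T G -> L1T (fun z => F z * G z).
Proof.
move=> hF hG; apply: (@L1T_dom _ (fun t => nm (F (circ t)) ^+ 2 + nm (G (circ t)) ^+ 2)).
- by apply: mT_mul; exact: L2T_mT.
- move=> t _; rewrite nmM; have := nm_ge0 (F (circ t)); have := nm_ge0 (G (circ t)).
  by move: (nm _) (nm _) => a b; have := sqr_ge0 (a - b); nra.
- by apply: arc_intD; exact: L2T_nm2.
Qed.

Lemma L2T_conj F : L2T F -> L2T (fun z => (F z)^*%C).
Proof.
move=> hF; apply: L2T_dom (L2T_nm2 hF); first exact/mT_conj/L2T_mT.
by move=> t; rewrite nmJ.
Qed.

Lemma L2T_bdd_mul F G K : mT F -> (forall t, nm (F (circ t)) <= K) -> L2T G ->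
  L2T (fun z => F z * G z).
Proof.
move=> mF FK hG; apply: (@L2T_dom _ (fun t => K ^+ 2 * nm (G (circ t)) ^+ 2)).
- by apply: mT_mul => //; exact: L2T_mT.
- move=> t; rewrite nmM exprMn ler_wpM2r ?sqr_ge0//.
  by rewrite ler_sqr ?nnegrE ?nm_ge0// (le_trans (nm_ge0 _) (FK t)).
- apply: arc_intZ; exact: L2T_nm2 hG.
Qed.

Lemma L2T_bdd F K : mT F -> (forall t, nm (F (circ t)) <= K) -> L2T F.
Proof.
move=> mF FK; apply: (@L2T_dom _ (fun=> K ^+ 2)) => //; last exact: integrable_cst_arc.
move=> t; rewrite ler_sqr ?nnegrE ?nm_ge0//; exact: le_trans (nm_ge0 _) (FK t).
Qed.

Lemma L2T_lin c F G : L2T F -> L2T G -> L2T (fun z => c * F z + G z).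
Proof.
move=> hF hG; apply: (@L2T_dom _ (fun t => (2 * nm c ^+ 2) * nm (F (circ t)) ^+ 2 + 2 * nm (G (circ t)) ^+ 2)).
- by apply: mT_add; [apply: mT_mul; [exact: mT_cst|exact: L2T_mT]|exact: L2T_mT].
- move=> t; have := nmD (c * F (circ t)) (G (circ t)); rewrite nmM.
  have := nm_ge0 (c * F (circ t) + G (circ t)).
  move: (nm (_ + _)) (nm c) (nm (F _)) (nm (G _)) => s a b d s0 h.
  have : s ^+ 2 <= (a * b + d) ^+ 2.
    by rewrite ler_sqr ?nnegrE//; exact: le_trans s0 h.
  by have := sqr_ge0 (a * b - d); nra.
- by apply: arc_intD; apply: arc_intZ; exact: L2T_nm2.
Qed.

Lemma L2T_ae F G : mT G -> ae_eqT F G -> L2T F -> L2T G.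
Proof.
move=> mG h [f1 f2 fi]; have [g1 g2] := mG; split=> //.
have mF : mT F by [].
rewrite -(@ge0_ae_eq_integral _ _ _ mu arc
  (fun t => (nm (F (circ t)) ^+ 2)%:E) (fun t => (nm (G (circ t)) ^+ 2)%:E))//.
- by apply/measurable_EFinP/measurable_funX; exact: measurable_nm.
- by apply/measurable_EFinP/measurable_funX; exact: measurable_nm.
- by move=> t _; rewrite lee_fin sqr_ge0.
- by move=> t _; rewrite lee_fin sqr_ge0.
- by apply: (arc_aeS h) => t ->.
Qed.

Lemma Re_intT_ge0 F : (forall t, 0 <= F (circ t)) -> 0 <= intT F.
Proof.
move=> h; have h' t : 0 <= Re (F (circ t)) /\ Im (F (circ t)) = 0.
  by have := h t; rewrite lecE => /andP[/eqP ? ?].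
rewrite lecE /=; apply/andP; split.
  rewrite (@eq_Rintegral _ _ _ mu arc (cst 0)); last by move=> t _; case: (h' t).
  by rewrite Rintegral_cst// mul0r mulr0.
apply: mulr_ge0; first by rewrite invr_ge0 ltW.
by apply: (@Rintegral_ge0 _ _ _ mu arc) => t _; case: (h' t).
Qed.

Lemma intT_eq0_ae F : mT F -> L1T F -> (forall t, 0 <= F (circ t)) -> intT F = 0 ->
  ae_eqT F (cst 0).
Proof.
move=> mF [f1 f2] h /(congr1 (@complex.Re _)) /= /eqP.
rewrite mulf_eq0 invr_eq0 gt_eqF//= => /eqP i0.
have h' t : 0 <= Re (F (circ t)) /\ Im (F (circ t)) = 0.
  by have := h t; rewrite lecE => /andP[/eqP ? ?].
have : (\int[mu]_(t in arc) `|(Re (F (circ t)))%:E| = 0)%E.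
  transitivity (\int[mu]_(t in arc) (Re (F (circ t)))%:E)%E.
    by apply: eq_integral => t _; rewrite gee0_abs// lee_fin; case: (h' t).
  rewrite -[LHS]fineK; first exact: congr1 i0.
  exact: (@integrable_fin_num _ _ _ mu arc arc_meas _ f1).
move/(ae_eq_integral_abs mu arc_meas (measurable_int _ f1)).
move=> h1; apply: (arc_aeS h1) => t /= -[e]; apply: cplxP => //=.
by case: (h' t).
Qed.

End Circle.
#[global] Hint Resolve arc_meas arc_lty two_pi_gt0 : core.
(** * The space of classes of square integrable functions *)

Section L2Space.
Context {R : realType}.
Local Notation C := R[i].
Local Notation mu := (@lebesgue_measure R).
Local Notation arc := (@arcT R).
Local Notation circ := (@circ R).
Implicit Types (f g h : C -> C).

Lemma dotT_linl c f g h : L2T f -> L2T g -> L2T h ->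
  dotT (fun z => c * f z + g z) h = c * dotT f h + dotT g h.
Proof.
move=> hf hg hh; rewrite /dotT -intT_lin; try by apply: L2T_mul_L1T => //; exact: L2T_conj.
by apply: eq_intT => t /=; rewrite mulrDl mulrA.
Qed.
Lemma dotT_conj f g : L2T f -> L2T g -> (dotT f g)^*%C = dotT g f.
Proof.
move=> hf hg; rewrite /dotT -intT_conj; last by apply: L2T_mul_L1T => //; exact: L2T_conj.
by apply: eq_intT => t /=; rewrite conjM mulrC /conjT conjcK.
Qed.
Lemma dotT_ge0 f : 0 <= dotT f f.
Proof. by apply: Re_intT_ge0 => t /=; rewrite mulcJ_ge0. Qed.
Lemma dotT_eq0 f : L2T f -> dotT f f = 0 -> ae_eqT f (cst 0).
Proof.
move=> hf /intT_eq0_ae h; have := h _ _ _; case.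
- by apply: mT_mul; [exact: L2T_mT|apply: mT_conj; exact: L2T_mT].
- by apply: L2T_mul_L1T => //; exact: L2T_conj.
- by move=> t; rewrite mulcJ_ge0.
move=> N [mN N0 hN]; exists N; split => // t /= ht; apply: hN => /= h1; apply: ht => ta.
have := h1 ta; rewrite /conjT nm_mulJ => -[] /eqP.
by rewrite expf_eq0 /= => /eqP/nm_eq0.
Qed.
Lemma dotT_ae f g h : L2T f -> L2T g -> L2T h -> ae_eqT f g -> dotT f h = dotT g h.
Proof.
move=> hf hg hh fg; apply: ae_intT; try (apply: mT_mul; [exact: L2T_mT|apply: mT_conj; exact: L2T_mT]).
by apply: (arc_aeS fg) => t /= ->.
Qed.

(** The space of classes of square integrable functions: the class of [f] is
    the functional [h |-> <f, h>], so that a.e. equality becomes equality and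
    the linear structure is that of functions. *)
Definition class_fun f : (C -> C) -> C^o := fun h => if `[< L2T h >] then dotT f h else 0.

Definition L2_pred : {pred (C -> C) -> C^o} :=
  fun phi => `[< exists2 f, L2T f & phi = class_fun f >].

Lemma class_fun_lin c f g : L2T f -> L2T g ->
  class_fun (fun z => c * f z + g z) = c *: class_fun f + class_fun g.
Proof.
move=> hf hg; apply/funext => h; rewrite /class_fun.
rewrite -[RHS]/(c *: (if `[< L2T h >] then dotT f h else 0) + (if `[< L2T h >] then dotT g h else 0)).
case: asboolP => hh; last by rewrite scaler0 addr0.
by rewrite dotT_linl.
Qed.

Lemma L2T_cst (c : C) : L2T (fun=> c).
Proof. by apply: (@L2T_bdd _ _ (nm c)) => //; exact: mT_cst. Qed.

Lemma class_fun0 : class_fun (fun=> 0) = 0.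
Proof.
have := class_fun_lin 0 (L2T_cst 0) (L2T_cst 0); rewrite scale0r add0r.
under eq_fun do rewrite mul0r addr0.
move=> _; apply/funext => h; rewrite /class_fun -[RHS]/(0 : C); case: asboolP => // hh.
rewrite /dotT -[RHS](intT_cst 0); apply: eq_intT => t /=; exact: mul0r.
Qed.

Lemma L2_submod_closed : submod_closed L2_pred.
Proof.
split; first by apply/asboolP; exists (fun=> 0); [exact: L2T_cst|rewrite class_fun0].
move=> c _ _ /asboolP[f hf ->] /asboolP[g hg ->]; apply/asboolP.
by exists (fun z => c * f z + g z); [exact: L2T_lin|rewrite class_fun_lin].
Qed.
HB.instance Definition _ := GRing.isSubmodClosed.Build C ((C -> C) -> C^o) L2_pred L2_submod_closed.

Record L2 := MkL2 { L2_val : (C -> C) -> C^o; _ : L2_val \in L2_pred }.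
HB.instance Definition _ := [isSub for L2_val].
HB.instance Definition _ := [Choice of L2 by <:].
HB.instance Definition _ := [SubChoice_isSubLmodule of L2 by <:].

Definition class_of f : L2 := insubd 0 (class_fun f).
Lemma L2_valP (u : L2) : exists f, L2T f /\ L2_val u = class_fun f.
Proof. by case: u => phi /= /asboolP[f hf ->]; exists f. Qed.
Definition representative (u : L2) : C -> C := projT1 (cid (L2_valP u)).

Lemma representative_L2 u : L2T (representative u).
Proof. by rewrite /representative; case: cid => f []. Qed.
Lemma val_class_of f : L2T f -> L2_val (class_of f) = class_fun f.
Proof. by move=> hf; rewrite /class_of val_insubd; case: ifPn => // /asboolP[]; exists f. Qed.
Lemma representativeK u : class_of (representative u) = u.
Proof.
by apply: val_inj; rewrite /= val_class_of ?representative_L2//; rewrite /representative; case: cid => f [].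
Qed.

Lemma dotT_class f g : L2T f -> L2T g -> class_fun f = class_fun g ->
  forall h, L2T h -> dotT f h = dotT g h.
Proof.
by move=> hf hg E h hh; have := congr1 (fun p => p h) E; rewrite /class_fun asboolT.
Qed.

Lemma class_of_eq f g : L2T f -> L2T g -> class_of f = class_of g <-> ae_eqT f g.
Proof.
move=> hf hg; split.
  move=> /(congr1 L2_val); rewrite !val_class_of// => E.
  have hd : L2T (fun z => (-1) * g z + f z) by exact: L2T_lin.
  have : dotT (fun z => (-1) * g z + f z) (fun z => (-1) * g z + f z) = 0.
    by rewrite dotT_linl// mulN1r (dotT_class hf hg E)// addNr.
  move/(dotT_eq0 hd) => h; apply: (arc_aeS h) => t /= /eqP.
  by rewrite mulN1r addrC subr_eq0 => /eqP.
move=> fg; apply: val_inj; rewrite /= !val_class_of//; apply/funext => h; rewrite /class_fun.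
by case: asboolP => // hh; exact: dotT_ae.
Qed.

Lemma class_of_lin c f g : L2T f -> L2T g ->
  class_of (fun z => c * f z + g z) = c *: class_of f + class_of g.
Proof.
move=> hf hg; apply: val_inj; rewrite /= val_class_of; last exact: L2T_lin.
rewrite class_fun_lin// -!val_class_of//.
Qed.

Lemma dotT_representative f g : L2T f -> L2T g ->
  dotT (representative (class_of f)) (representative (class_of g)) = dotT f g.
Proof.
have rc h : L2T h -> ae_eqT (representative (class_of h)) h.
  by move=> hh; apply/class_of_eq => //; [exact: representative_L2|exact: representativeK].
have rL := representative_L2.
move=> hf hg; rewrite (dotT_ae (rL _) hf (rL _) (rc f hf)).
by rewrite -dotT_conj ?(dotT_ae (rL _) hg _ (rc g hg)) ?dotT_conj.
Qed.

End L2Space.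

(** The properties that characterize the space of classes and its representatives;
    an inhabitant is fixed once and for all, and only these properties are used. *)
Record L2_model (R : realType) := L2Model {
  L2m_sort : lmodType R[i];
  cls_ : (R[i] -> R[i]) -> L2m_sort;
  rep_ : L2m_sort -> R[i] -> R[i];
  ip_ : L2m_sort -> L2m_sort -> R[i];
  rep_L2_ : forall u, L2T (rep_ u);
  repK_ : forall u, cls_ (rep_ u) = u;
  cls_eq_ : forall f g, L2T f -> L2T g -> cls_ f = cls_ g <-> ae_eqT f g;
  cls_lin_ : forall c f g, L2T f -> L2T g ->
    cls_ (fun z => c * f z + g z) = c *: cls_ f + cls_ g;
  ip_cls_ : forall f g, L2T f -> L2T g -> ip_ (cls_ f) (cls_ g) = dotT f g }.

Lemma L2_model_inhabited (R : realType) : L2_model R.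
Proof.
exact: (@L2Model R (L2 : lmodType R[i]) class_of representative
  (fun u v => dotT (representative u) (representative v))
  representative_L2 representativeK class_of_eq class_of_lin dotT_representative).
Qed.

Section L2Model.
Context {R : realType}.
Local Notation C := R[i].
Implicit Types (f g h : C -> C).

Definition L2m := L2m_sort (L2_model_inhabited R).
Definition cls f : L2m := cls_ _ f.
Definition rep (u : L2m) : C -> C := rep_ u.
Definition ip (u v : L2m) : C := ip_ u v.
Implicit Types (u v w : L2m) (c : C).

Lemma rep_L2 u : L2T (rep u). Proof. exact: rep_L2_. Qed.
Lemma repK u : cls (rep u) = u. Proof. exact: repK_. Qed.
Lemma cls_eq f g : L2T f -> L2T g -> cls f = cls g <-> ae_eqT f g.
Proof. exact: cls_eq_. Qed.
Lemma cls_lin c f g : L2T f -> L2T g -> cls (fun z => c * f z + g z) = c *: cls f + cls g.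
Proof. exact: cls_lin_. Qed.
Lemma ip_cls f g : L2T f -> L2T g -> ip (cls f) (cls g) = dotT f g.
Proof. exact: ip_cls_. Qed.
Lemma rep_cls f : L2T f -> ae_eqT (rep (cls f)) f.
Proof. by move=> hf; apply/cls_eq => //; [exact: rep_L2|exact: repK]. Qed.

Lemma cls0 : cls (fun=> 0) = 0.
Proof.
have := cls_lin (-1) (L2T_cst 0) (L2T_cst 0).
under eq_fun do rewrite mulr0 addr0.
by rewrite scaleN1r addNr.
Qed.
Lemma ip_repE u v : ip u v = dotT (rep u) (rep v).
Proof. by rewrite -{1}(repK u) -{1}(repK v) ip_cls//; exact: rep_L2. Qed.

Lemma ipDl u v w : ip (u + v) w = ip u w + ip v w.
Proof.
rewrite -(repK u) -(repK v) -(repK w).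
have h : cls (rep u) + cls (rep v) = cls (fun z => 1 * rep u z + rep v z).
  by rewrite cls_lin ?scale1r//; exact: rep_L2.
rewrite h !ip_cls; try exact: rep_L2; last by apply: L2T_lin; exact: rep_L2.
by rewrite dotT_linl ?mul1r//; exact: rep_L2.
Qed.
Lemma ipZl c u v : ip (c *: u) v = c * ip u v.
Proof.
rewrite -(repK u) -(repK v).
have h : c *: cls (rep u) = cls (fun z => c * rep u z + 0).
  by rewrite (@cls_lin c (rep u) (fun=> 0)) ?cls0 ?addr0//; [exact: rep_L2|exact: L2T_cst].
rewrite h !ip_cls; try exact: rep_L2; last by apply: L2T_lin; [exact: rep_L2|exact: L2T_cst].
rewrite (@dotT_linl _ c (rep u) (fun=> 0)); try exact: rep_L2; last exact: L2T_cst.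
rewrite [X in _ + X](_ : _ = 0) ?addr0//.
rewrite /dotT -[RHS](intT_cst 0); apply: eq_intT => t /=; exact: mul0r.
Qed.
Lemma ipC u v : (ip u v)^*%C = ip v u.
Proof. by rewrite !ip_repE; apply: dotT_conj; exact: rep_L2. Qed.
Lemma ip_ge0 u : 0 <= ip u u. Proof. by rewrite ip_repE dotT_ge0. Qed.
Lemma ip_eq0 u : ip u u = 0 -> u = 0.
Proof.
rewrite ip_repE => /(dotT_eq0 (rep_L2 u)) h; rewrite -(repK u) -cls0; apply/cls_eq => //.
- exact: rep_L2.
- exact: L2T_cst.
Qed.

Lemma nrm_cls f : L2T f -> nrm ip (cls f) = norm2 f.
Proof. by move=> hf; rewrite /nrm ip_cls. Qed.

Local Notation nrm := (nrm ip).

Lemma cls_add f g : L2T f -> L2T g -> cls (fun z => f z + g z) = cls f + cls g.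
Proof.
move=> hf hg; have := cls_lin 1 hf hg; rewrite scale1r => <-.
by congr cls; apply/funext => z; rewrite mul1r.
Qed.
Lemma cls_scale c f : L2T f -> cls (fun z => c * f z) = c *: cls f.
Proof.
move=> hf; have := cls_lin c hf (L2T_cst 0); rewrite cls0 addr0 => <-.
by congr cls; apply/funext => z; rewrite addr0.
Qed.
Lemma cls_sub f g : L2T f -> L2T g -> cls (fun z => f z - g z) = cls f - cls g.
Proof.
move=> hf hg; have := cls_lin (-1) hg hf; rewrite scaleN1r addrC => <-.
by congr cls; apply/funext => z; rewrite mulN1r addrC.
Qed.

Definition ipDr := dotDr ipDl ipC.
Definition ipZr := dotZr ipZl ipC.
Definition ipBl := dotBl ipDl ipZl.
Definition ipBr := dotBr ipDl ipZl ipC.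
Definition ip0l := dot0l ipZl.
Definition ipE := dotE ip_ge0.
Definition lnrm_ge0 := nrm_ge0 (@ip).
Definition lnrm_eq0 := nrm_eq0 ip_ge0 ip_eq0.
Definition lnrm0 := nrm0 ipZl.
Definition lnrmB := nrmB ipZl ipC ip_ge0.
Definition lnrm_tri := nrm_tri ipDl ipZl ipC ip_ge0 ip_eq0.
Definition lcauchy_schwarz := cauchy_schwarz ipDl ipZl ipC ip_ge0 ip_eq0.
Definition lpythagoras := pythagoras ipDl ipC ip_ge0.

End L2Model.
(** * Completeness of the space of classes *)

#[global] Hint Extern 0 (@measurable _ _ _) => solve [exact: arc_meas] : core.
Section Completeness.
Context {R : realType}.
Local Notation C := R[i].
Local Notation mu := (@lebesgue_measure R).
Local Notation arc := (@arcT R).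
Local Notation circ := (@circ R).
Local Notation L := (@L2m R).
Local Notation lnrm := (nrm (@ip R)).
Implicit Types (f g h : C -> C).

Lemma norm2E f : L2T f -> norm2 f ^+ 2 = (2 * pi)^-1 * Rintegral mu arc (fun t => nm (f (circ t)) ^+ 2).
Proof.
move=> hf; rewrite -nrm_cls// (nrm2E ip_ge0) ip_cls// /dotT intTE /=; congr (_ * _).
by apply: eq_Rintegral => t _; rewrite /conjT nm_mulJ.
Qed.

Lemma integral_nm2 f : L2T f ->
  (\int[mu]_(t in arc) (nm (f (circ t)) ^+ 2)%:E = (2 * pi * norm2 f ^+ 2)%:E)%E.
Proof.
move=> hf; rewrite norm2E// mulrA mulfV; last exact: two_pi_neq0.
rewrite mul1r /Rintegral fineK//.
exact: (@integrable_fin_num _ _ _ mu arc arc_meas _ (L2T_nm2 hf)).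
Qed.

Lemma L2T_sub f g : L2T f -> L2T g -> L2T (fun z => f z - g z).
Proof.
move=> hf hg; have -> : (fun z => f z - g z) = (fun z => (-1) * g z + f z).
  by apply/funext => z; rewrite mulN1r addrC.
exact: L2T_lin.
Qed.

Section Limit.
Variable U : nat -> L.
Hypothesis Ule : forall k, lnrm (U k.+1 - U k) <= 2^-1 ^+ k.
Let f k := rep (U k).
Let f_L2 k : L2T (f k) := rep_L2 (U k).
Let d k z : R := nm (f k.+1 z - f k z).
(** The upper limits exist everywhere and are measurable; almost everywhere they
    are limits. *)
Definition lim_fun (z : C) : C :=
  fine (limn_esup (fun k => (Re (f k z))%:E)) +i* fine (limn_esup (fun k => (Im (f k z))%:E)).

Lemma lim_fun_mT : mT lim_fun.
Proof.
by split; apply: (measurableT_comp (fine_measurable measurableT));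
  apply: measurable_fun_limn_esup => n; apply/measurable_EFinP; have [] := L2T_mT (f_L2 n).
Qed.

Lemma norm2_f i j : norm2 (fun z => f i z - f j z) = lnrm (U i - U j).
Proof. by rewrite -nrm_cls ?cls_sub ?repK//; exact: L2T_sub. Qed.

Lemma d_meas k : measurable_fun arc (fun t => (d k (circ t))%:E).
Proof.
apply/measurable_EFinP; apply: (@measurable_nm _ (fun z => f k.+1 z - f k z)).
by apply: L2T_mT; exact: L2T_sub.
Qed.

(** Cauchy--Schwarz on the circle, by integrating
    [d <= (2 ^ k * d ^ 2 + 2 ^ (- k)) / 2]. *)
Lemma d_int k : (\int[mu]_(t in arc) (d k (circ t))%:E <= (2 * pi * 2^-1 ^+ k)%:E)%E.
Proof.
have hd : L2T (fun z => f k.+1 z - f k z) by exact: L2T_sub.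
pose g t : R := 2^-1 * (2 ^+ k) * nm (f k.+1 (circ t) - f k (circ t)) ^+ 2 + 2^-1 * 2^-1 ^+ k.
have ig : mu.-integrable arc (EFin \o g).
  by apply: arc_intD; [apply: arc_intZ; exact: L2T_nm2 hd|exact: integrable_cst_arc].
have p0 : 0 < 2 ^+ k :> R by rewrite exprn_gt0.
have pq : 2 ^+ k * 2^-1 ^+ k = 1 :> R by rewrite -exprMn mulfV ?expr1n.
apply: (@le_trans _ _ (\int[mu]_(t in arc) (g t)%:E)%E).
  apply: ge0_le_integral => //.
  - by move=> t _; rewrite lee_fin nm_ge0.
  - exact: d_meas.
  - exact: (measurable_int _ ig).
  - move=> t _; rewrite lee_fin /d /g; move: (nm _) => x.
    have := sqr_ge0 (2 ^+ k * x - 1).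
    have : 0 <= 2^-1 ^+ k :> R by rewrite exprn_ge0.
    move: (2 ^+ k) (2^-1 ^+ k) p0 pq => a b a0 ab b0 h.
    have : 0 <= b * (a * x - 1) ^+ 2 by rewrite mulr_ge0.
    have -> : b * (a * x - 1) ^+ 2 = (a * b) * a * x ^+ 2 - 2 * (a * b) * x + b by ring.
    rewrite ab; lra.
have fi : (\int[mu]_(t in arc) (g t)%:E)%E \is a fin_num.
  exact: (@integrable_fin_num _ _ _ mu arc arc_meas _ ig).
rewrite -(fineK fi) lee_fin -/(Rintegral mu arc g) /g.
rewrite RintegralD//; last 2 first.
- by apply: arc_intZ; exact: L2T_nm2 hd.
- exact: integrable_cst_arc.
rewrite RintegralZl//; last exact: L2T_nm2 hd.
rewrite mint_cst.
have := norm2E hd; rewrite norm2_f /=; set I := Rintegral _ _ _ => e.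
have -> : I = 2 * pi * lnrm (U k.+1 - U k) ^+ 2 by rewrite e mulrA mulfV ?mul1r// two_pi_neq0.
have h : lnrm (U k.+1 - U k) ^+ 2 <= (2^-1 ^+ k) ^+ 2.
  by rewrite ler_sqr ?nnegrE ?lnrm_ge0 ?exprn_ge0.
have h1 : 2^-1 * 2 ^+ k * (2 * pi * lnrm (U k.+1 - U k) ^+ 2) <= 2^-1 * 2 ^+ k * (2 * pi * (2^-1 ^+ k) ^+ 2).
  apply: ler_wpM2l; first by rewrite mulr_ge0// ltW.
  by apply: ler_wpM2l => //; exact: two_pi_ge0.
have -> : 2 * pi * 2^-1 ^+ k = 2^-1 * 2 ^+ k * (2 * pi * (2^-1 ^+ k) ^+ 2) + 2^-1 * 2^-1 ^+ k * (2 * pi) :> R.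
  have -> : 2^-1 * 2 ^+ k * (2 * pi * (2^-1 ^+ k) ^+ 2) = 2^-1 * (2 ^+ k * 2^-1 ^+ k) * (2 * pi) * 2^-1 ^+ k :> R by ring.
  by rewrite pq; field.
by rewrite lerD2r.
Qed.

(** The sum of the increments has a finite integral, hence is finite almost
    everywhere. *)
Lemma lim_fun_ae : {ae mu, forall t, arc t ->
   (fun k => Re (f k (circ t))) @ \oo --> Re (lim_fun (circ t)) /\
   (fun k => Im (f k (circ t))) @ \oo --> Im (lim_fun (circ t))}.
Proof.
have d0 k t : (0 <= (d k (circ t))%:E)%E by rewrite lee_fin nm_ge0.
have Sint : mu.-integrable arc (fun t => \sum_(k <oo) (d k (circ t))%:E)%E.
  apply/integrableP; split.
    apply: (@ge0_emeasurable_sum _ _ _ _ (fun k t => (d k (circ t))%:E) xpredT) => // k _.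
    exact: d_meas.
  rewrite (@eq_integral _ _ _ mu arc (fun t => \sum_(k <oo) (d k (circ t))%:E)%E); last first.
    by move=> t _; rewrite gee0_abs// nneseries_ge0.
  rewrite integral_nneseries//; last by move=> k; exact: d_meas.
  apply: (@le_lt_trans _ _ (2 * pi * 2)%:E); last exact: ltry.
  apply: lime_le.
    by apply: is_cvg_nneseries => n _ _; apply: integral_ge0 => t _.
  apply: nearW => n.
  apply: (@le_trans _ _ (\sum_(0 <= i < n) (2 * pi * 2^-1 ^+ i)%:E)%E).
    by apply: lee_sum => i _; exact: d_int.
  rewrite sumEFin lee_fin -mulr_sumr ler_wpM2l ?two_pi_ge0//.
  have -> : \sum_(0 <= i < n) (2^-1 : R) ^+ i = 2 * (1 - 2^-1 ^+ n).
    elim: n => [|n IH]; first by rewrite big_nil expr0 subrr mulr0.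
    by rewrite big_nat_recr// IH exprS /=; lra.
  have : 0 < (2^-1 : R) ^+ n by rewrite exprn_gt0.
  lra.
have := @integrable_ae _ _ _ mu arc arc_meas _ Sint.
move=> h; apply: (arc_aeS h) => t Sfin.
have dc : cvgn (series (fun k => d k (circ t))).
  apply: nondecreasing_is_cvgn; first by apply: nondecreasing_series => k _ _; exact: nm_ge0.
  exists (fine (\sum_(k <oo) (d k (circ t))%:E)%E) => _ [n _ <-].
  rewrite -lee_fin fineK// /series /= -sumEFin; exact: nneseries_lim_ge.
have key (g : C -> R) : (forall x y, g (x - y) = g x - g y) -> (forall x, `|g x| <= nm x) ->
    (fun k => g (f k (circ t))) @ \oo --> fine (limn_esup (fun k => (g (f k (circ t)))%:E)).
  move=> gB gle; have gc : cvgn (fun k => g (f k (circ t))).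
    have -> : (fun k => g (f k (circ t))) = (fun k => g (f 0%N (circ t)) +
        series (telescope (fun k => g (f k (circ t)))) k).
      by apply/funext => k; rewrite -eq_sum_telescope.
    apply: is_cvgD; first exact: is_cvg_cst.
    apply: normed_cvg; apply: series_le_cvg dc => k; [exact: normr_ge0|exact: nm_ge0|].
    by rewrite /telescope /= -gB; exact: gle.
  move/cvg_ex: (gc) => [l hl].
  have hE : (fun k => (g (f k (circ t)))%:E) @ \oo --> l%:E.
    by apply: cvg_EFin hl; exact: nearW.
  by have [_ ->] := cvg_limn_einf_sup hE.
split; apply: key => [x y|x]; rewrite ?ReD ?ImD ?ReN ?ImN ?Re_le ?Im_le//.
Qed.

Lemma lim_fun_fatou k : (\int[mu]_(t in arc) (nm (f k (circ t) - lim_fun (circ t)) ^+ 2)%:E <=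
  (2 * pi * (2 * 2^-1 ^+ k) ^+ 2)%:E)%E.
Proof.
pose G j t := ((nm (f k (circ t) - f (k + j)%N (circ t))) ^+ 2)%:E.
have mG j : measurable_fun arc (G j).
  apply/measurable_EFinP/measurable_funX; apply: (@measurable_nm _ (fun z => f k z - f (k + j)%N z)).
  by apply: L2T_mT; exact: L2T_sub.
have G0 j t : arc t -> (0 <= G j t)%E by move=> _; rewrite lee_fin sqr_ge0.
have Uj j : lnrm (U k - U (k + j)%N) <= 2 * 2^-1 ^+ k - 2 * 2^-1 ^+ (k + j).
  elim: j => [|j IH]; first by rewrite addn0 !subrr lnrm0.
  rewrite addnS; apply: le_trans (lnrm_tri _ (U (k + j)%N) _) _.
  have := Ule (k + j); rewrite (lnrmB (U (k + j).+1)) exprS.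
  by move: IH; move: (lnrm _) (lnrm _) (2^-1 ^+ (k + j)) (2^-1 ^+ k) => x1 x2 x3 x4; clear; lra.
apply: (@le_trans _ _ (\int[mu]_(t in arc) limn_einf (G ^~ t))%E).
  rewrite le_eqVlt; apply/orP; left; apply/eqP; apply: ge0_ae_eq_integral => //.
  - apply/measurable_EFinP/measurable_funX; apply: (@measurable_nm _ (fun z => f k z - lim_fun z)).
    have := mT_add (L2T_mT (f_L2 k)) (mT_mul (mT_cst (-1)) lim_fun_mT).
    by under eq_fun do rewrite mulN1r.
  - apply: (@measurableT_comp _ _ _ _ _ _ -%E%E _ (fun t => limn_esup (\- (G ^~ t))%E)) => //.
    by apply: measurable_fun_limn_esup => j; exact: measurableT_comp.
  - by move=> t _; rewrite lee_fin sqr_ge0.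
  - move=> t ta; rewrite limn_einf_lim; apply: lime_ge; first exact: is_cvg_einfs.
    by apply: nearW => n; apply: le_ereal_inf_tmp => _ [m /= _ <-]; exact: G0.
  - apply: (arc_aeS lim_fun_ae) => t [hR hI].
    suff h : (fun j => G j t) @ \oo --> (nm (f k (circ t) - lim_fun (circ t)) ^+ 2)%:E.
      by have [-> _] := cvg_limn_einf_sup h.
    apply: cvg_EFin; first exact: nearW.
    have sh (u : R^nat) (l : R) : u @ \oo --> l -> (fun j => u (k + j)%N) @ \oo --> l.
      move=> hu; have := hu; rewrite -(cvg_shiftn k).
      by under [X in _ -> X @ _ --> _]eq_fun do rewrite addnC.
    have -> : fine \o G^~ t = (fun j =>
       (Re (f k (circ t)) - Re (f (k + j)%N (circ t))) ^+ 2 +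
       (Im (f k (circ t)) - Im (f (k + j)%N (circ t))) ^+ 2).
      by apply/funext => j; rewrite /G /= nm_sqr ReD ImD ReN ImN.
    rewrite nm_sqr ReD ImD ReN ImN.
    have hs (u : R^nat) (l c : R) : u @ \oo --> l -> (fun j => (c - u (k + j)%N) ^+ 2) @ \oo --> (c - l) ^+ 2.
      move=> /sh hu.
      have h1 : (fun j => c - u (k + j)%N) @ \oo --> c - l.
        by apply: cvgB => //; exact: cvg_cst.
      by under eq_fun do rewrite expr2; rewrite expr2; exact: cvgM.
    by apply: cvgD; [exact: (hs (fun j => Re (f j (circ t))))|exact: (hs (fun j => Im (f j (circ t))))].
apply: le_trans (fatou mu arc_meas mG G0) _.
rewrite limn_einf_lim; apply: lime_le; first exact: is_cvg_einfs.
apply: nearW => n; apply: (@le_trans _ _ (\int[mu]_(t in arc) G n t)%E).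
  by apply: ereal_inf_lbound; exists n => /=.
rewrite /G (integral_nm2 (L2T_sub (f_L2 k) (f_L2 (k + n)))) lee_fin ler_wpM2l ?two_pi_ge0//.
rewrite norm2_f ler_sqr ?nnegrE ?lnrm_ge0 ?mulr_ge0 ?exprn_ge0//.
apply: le_trans (Uj n) _; have : 0 <= (2^-1 : R) ^+ (k + n) by rewrite exprn_ge0.
lra.
Qed.

Lemma lim_fun_L2_aux k : L2T (fun z => f k z - lim_fun z).
Proof.
have [m1 m2] : mT (fun z => f k z - lim_fun z).
  have := mT_add (L2T_mT (f_L2 k)) (mT_mul (mT_cst (-1)) lim_fun_mT).
  by under eq_fun do rewrite mulN1r.
split => //; apply: le_lt_trans (lim_fun_fatou k) _; exact: ltry.
Qed.

(** Riesz--Fischer: the pointwise limit is a limit in norm by Fatou's lemma. *)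
Lemma L2_limit : exists h : L, forall k, lnrm (U k - h) <= 2 * 2^-1 ^+ k.
Proof.
have hl : L2T lim_fun.
  have -> : lim_fun = (fun z => f 0%N z - (f 0%N z - lim_fun z)).
    by apply/funext => z; rewrite opprB addrCA subrr addr0.
  by apply: L2T_sub => //; exact: lim_fun_L2_aux.
exists (cls lim_fun) => k.
have -> : U k - cls lim_fun = cls (fun z => f k z - lim_fun z).
  by rewrite cls_sub// repK.
rewrite nrm_cls; last exact: lim_fun_L2_aux.
rewrite -ler_sqr ?nnegrE ?mulr_ge0 ?exprn_ge0//; last by rewrite /norm2 sqrtr_ge0.
have := lim_fun_fatou k; rewrite (integral_nm2 (lim_fun_L2_aux k)) lee_fin.
by rewrite ler_pM2l ?two_pi_gt0.
Qed.

End Limit.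

Definition lriesz := riesz (@ipDl R) (@ipZl R) (@ipC R) (@ip_ge0 R) (@ip_eq0 R) L2_limit.
Definition lprojection := projection (@ipDl R) (@ipZl R) (@ipC R) (@ip_ge0 R) (@ip_eq0 R) L2_limit.
Definition ldouglas := douglas (@ipDl R) (@ipZl R) (@ipC R) (@ip_ge0 R) (@ip_eq0 R) L2_limit.
Definition lsqrt_exists := sqrt_exists (@ipDl R) (@ipZl R) (@ipC R) (@ip_ge0 R) (@ip_eq0 R) L2_limit.

End Completeness.
(** * Uniqueness of Fourier coefficients *)

Section FourierUniqueness.
Context {R : realType}.
Local Notation C := R[i].
Local Notation mu := (@lebesgue_measure R).
Local Notation arc := (@arcT R).
Local Notation circ := (@circ R).
Local Notation mint f := (Rintegral mu arc f).
Implicit Types (F G : C -> C) (p q : {poly C}).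

(** ** A polynomial approximation of the step function at [1/2] *)

(** By Bernoulli's inequality these polynomials tend to [1] below [1/2] and to [0]
    above it, boundedly on [[0, 1]]. *)
Definition step_poly k (y : R) : R := (1 - y ^+ k) ^+ (2 ^ k).

Lemma bernoulli (x : R) n : -1 <= x -> 1 + n%:R * x <= (1 + x) ^+ n.
Proof.
move=> x1; elim: n => [|n IH]; first by rewrite mul0r addr0 expr0.
rewrite exprS; have h0 : 0 <= 1 + x by lra.
apply: le_trans (ler_wpM2l h0 IH).
rewrite -natr1; have : 0 <= n%:R * (x * x) :> R by rewrite mulr_ge0// -expr2 sqr_ge0.
lra.
Qed.

Lemma step_poly_bound k y : 0 <= y <= 1 -> 0 <= step_poly k y <= 1.
Proof.
case/andP=> y0 y1; have h : 0 <= y ^+ k <= 1 by rewrite exprn_ge0//= exprn_ile1.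
by rewrite /step_poly; apply/andP; split; [rewrite exprn_ge0|rewrite exprn_ile1]; lra.
Qed.

Lemma step_poly_lo y : 0 <= y -> y < 2^-1 -> (fun k => step_poly k y) @ \oo --> (1 : R).
Proof.
move=> y0 y1; apply: (@squeeze_cvgr _ _ _ _ (fun k => 1 - (2 * y) ^+ k) (cst 1)).
- apply: nearW => k.
  have yk : 0 <= y ^+ k <= 1 by rewrite exprn_ge0//= exprn_ile1//; lra.
  apply/andP; split; last by have /andP[] := @step_poly_bound k y ltac:(by rewrite y0; lra).
  have := @bernoulli (- y ^+ k) (2 ^ k) ltac:(lra).
  by rewrite mulrN natrX -exprMn.
- rewrite -[X in _ --> X]subr0; apply: cvgB; first exact: cvg_cst.
  apply: cvg_expr; rewrite ger0_norm; lra.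
- exact: cvg_cst.
Qed.

Lemma step_poly_hi y : y <= 1 -> 2^-1 < y -> (fun k => step_poly k y) @ \oo --> (0 : R).
Proof.
move=> y1 y0; apply: (@squeeze_cvgr _ _ _ _ (cst 0) (fun k => ((2 * y)^-1) ^+ k)).
- apply: nearW => k; have yp : 0 < y by lra.
  have /andP[s0 s1] := @step_poly_bound k y ltac:(apply/andP; lra).
  rewrite /cst /= s0 /=.
  have yk : 0 < y ^+ k <= 1 by rewrite exprn_gt0//= exprn_ile1// ltW.
  have h1 := @bernoulli (y ^+ k) (2 ^ k) ltac:(lra).
  have h2 : step_poly k y * (1 + y ^+ k) ^+ (2 ^ k) <= 1.
    rewrite /step_poly -exprMn -subr_sqr expr1n exprn_ile1//; nra.
  have p0 : 0 < (2 * y) ^+ k by rewrite exprn_gt0//; lra.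
  rewrite exprVn -[leRHS]mul1r ler_pdivlMr//.
  apply: le_trans h2; rewrite ler_wpM2l//; apply: le_trans h1.
  by rewrite natrX -exprMn; lra.
- exact: cvg_cst.
- apply: cvg_expr; rewrite ger0_norm ?invr_ge0; last lra.
  by rewrite invf_lt1; lra.
Qed.

(** ** Trigonometric polynomials *)

(** Trigonometric polynomials: on the circle a power of [z] makes them
    polynomials. *)
Definition trigpoly G := exists k p, forall t, circ t ^+ k * G (circ t) = p.[circ t].

Lemma trigpoly_cst c : trigpoly (fun=> c).
Proof. by exists 0%N, c%:P => t; rewrite expr0 mul1r hornerC. Qed.
Lemma trigpoly_mul F G : trigpoly F -> trigpoly G -> trigpoly (fun z => F z * G z).
Proof.
move=> [k [p hp]] [j [q hq]]; exists (k + j)%N, (p * q) => t.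
by rewrite hornerM -hp -hq exprD; ring.
Qed.
Lemma trigpoly_sub F G : trigpoly F -> trigpoly G -> trigpoly (fun z => F z - G z).
Proof.
move=> [k [p hp]] [j [q hq]]; exists (k + j)%N, ('X^j * p - 'X^k * q) => t.
by rewrite !hornerE -hp -hq exprD; ring.
Qed.
Lemma trigpoly_exp F n : trigpoly F -> trigpoly (fun z => F z ^+ n).
Proof.
move=> hF; elim: n => [|n IH]; first exact: trigpoly_cst.
by under eq_fun do rewrite exprS; exact: trigpoly_mul.
Qed.
Lemma trigpoly_Re a : trigpoly (fun z => (Re (a * z))%:C).
Proof.
exists 1%N, (2^-1 *: (a *: 'X^2 + (a^*%C)%:P)) => t.
rewrite !hornerE ReJ_add conjM expr1 -[RHS]/(2^-1 * (a * circ t * circ t + a^*%C)).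
by have := circ_mulJ t; move: (circ t) => z hz; ring: hz.
Qed.

Lemma trigpoly_annihilates F G : L1T F -> mT G -> (forall t, nm (G (circ t)) <= 1) ->
  (forall n, intT (fun z => F z * z ^+ n) = 0) ->
  (forall n, intT (fun z => F z * (z^*%C) ^+ n) = 0) ->
  trigpoly G -> intT (fun z => F z * G z) = 0.
Proof.
move=> hF mG bG Fp Fn [k [p hp]].
have mon i j : intT (fun z => F z * ((z^*%C) ^+ i * z ^+ j)) = 0.
  have zz n t : (circ t)^*%C ^+ n * circ t ^+ n = 1.
    by rewrite -exprMn mulrC circ_mulJ expr1n.
  have [ij|/ltnW ij] := leqP i j.
    rewrite -[RHS](Fp (j - i)%N); apply: eq_intT => t.
    by congr (_ * _); rewrite -{1}(subnKC ij) exprD mulrA zz mul1r.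
  rewrite -[RHS](Fn (i - j)%N); apply: eq_intT => t.
  by congr (_ * _); rewrite -{1}(subnK ij) exprD -mulrA zz mulr1.
have bX n t : nm (circ t ^+ n) <= 1 by rewrite nmX nm_circ expr1n.
have bJ n t : nm ((circ t)^*%C ^+ n) <= 1 by rewrite nmX nmJ nm_circ expr1n.
have mJ n : mT (fun z : C => (z^*%C) ^+ n).
  have -> : (fun z : C => (z^*%C) ^+ n) = (fun z => (z ^+ n)^*%C).
    by apply/funext => z; rewrite conjX.
  exact/mT_conj/mT_exp.
have L1 H : mT H -> (exists K, forall t, nm (H (circ t)) <= K) -> L1T (fun z => F z * H z).
  move=> mH [K HK]; have := L1T_mul_bdd mH HK hF.
  by under eq_fun do rewrite mulrC.
have bP (q : {poly C}) : exists K, forall t, nm q.[circ t] <= K.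
  elim/poly_ind: q => [|q c [K hK]]; first by exists 0 => t; rewrite horner0 nm0.
  exists (K + nm c) => t; rewrite hornerMXaddC; apply: le_trans (nmD _ _) _.
  by rewrite lerD2r nmM nm_circ mulr1.
have pol (q : {poly C}) i j : intT (fun z => F z * ((z^*%C) ^+ i * z ^+ j * q.[z])) = 0.
  elim/poly_ind: q i j => [|q c IH] i j.
    rewrite -[RHS](intT_cst 0); apply: eq_intT => t.
    by rewrite horner0 !mulr0.
  have Lq i' j' : L1T (fun z => F z * ((z^*%C) ^+ i' * z ^+ j' * q.[z])).
    apply: L1.
      by apply: mT_mul; [apply: mT_mul; [exact: mJ|exact: mT_exp]|exact: mT_poly].
    have [K hK] := bP q; exists K => t; rewrite !nmM.
    rewrite -[leRHS]mul1r ler_pM// ?mulr_ge0 ?nm_ge0//.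
    by rewrite mulr_ile1 ?nm_ge0.
  have Lm : L1T (fun z => F z * ((z^*%C) ^+ i * z ^+ j)).
    apply: L1; first by apply: mT_mul; [exact: mJ|exact: mT_exp].
    by exists 1 => t; rewrite nmM mulr_ile1 ?nm_ge0.
  have := intT_lin c Lm (Lq i j.+1); rewrite mon IH mulr0 addr0 => <-.
  by apply: eq_intT => t; rewrite hornerMXaddC exprSr; ring.
rewrite -[RHS](pol p k 0%N); apply: eq_intT => t.
rewrite -hp expr0 mulr1 [_ ^+ k * (_ * _)]mulrA -exprMn [_^*%C * _]mulrC circ_mulJ expr1n.
by rewrite mul1r.
Qed.

(** The trigonometric polynomial with values in [0,1] that is below [1/2]
    exactly on the arc from [1] to [circ s]. *)
Definition arc_trig (s : R) (z : C) : R :=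
  2^-1 - 4^-1 * (Re ((circ (s / 2))^*%C * z) - cos (s / 2)).

Lemma arc_trigE s t : arc_trig s (circ t) = 2^-1 - 2^-1 * (sin (t / 2) * sin ((s - t) / 2)).
Proof.
rewrite /arc_trig.
have -> : Re ((circ (s / 2))^*%C * circ t) = cos (t / 2 - (s - t) / 2).
  rewrite ReM /= mulNr opprK -cosB -(cosN (_ - _)); congr cos; lra.
have -> : cos (s / 2) = cos (t / 2 + (s - t) / 2) by congr cos; lra.
by rewrite cosB cosD; lra.
Qed.

Lemma arc_trig_bound s t : 0 <= arc_trig s (circ t) <= 1.
Proof.
rewrite arc_trigE.
have := sin_geN1 (t / 2); have := sin_le1 (t / 2).
have := sin_geN1 ((s - t) / 2); have := sin_le1 ((s - t) / 2).
move: (sin _) (sin _) => a b h1 h2 h3 h4; apply/andP; nra.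
Qed.

Lemma trigpoly_arc s k : trigpoly (fun z => (step_poly k (arc_trig s z))%:C).
Proof.
have h : trigpoly (fun z => (arc_trig s z)%:C).
  rewrite /arc_trig.
  have -> : (fun z : C => (2^-1 - 4^-1 * (Re ((circ (s / 2))^*%C * z) - cos (s / 2)))%:C) =
    (fun z => (2^-1)%:C - (4^-1)%:C * ((Re ((circ (s / 2))^*%C * z))%:C - (cos (s / 2))%:C)).
    by apply/funext => z; rewrite !(cD, cN, cM).
  apply: trigpoly_sub; first exact: trigpoly_cst.
  apply: trigpoly_mul; first exact: trigpoly_cst.
  by apply: trigpoly_sub; [exact: trigpoly_Re|exact: trigpoly_cst].
have -> : (fun z => (step_poly k (arc_trig s z))%:C) =
   (fun z => (1 - (arc_trig s z)%:C ^+ k) ^+ (2 ^ k)).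
  by apply/funext => z; rewrite /step_poly rmorphXn /= rmorphB rmorph1 /= rmorphXn.
by apply: trigpoly_exp; apply: trigpoly_sub; [exact: trigpoly_cst|exact: trigpoly_exp].
Qed.

Lemma arc_trig_lt s t : 0 < t < 2 * pi -> 0 < s < 2 * pi ->
  (t < s -> arc_trig s (circ t) < 2^-1) /\ (s < t -> 2^-1 < arc_trig s (circ t)).
Proof.
case/andP=> t0 t1 /andP[s0 s1]; rewrite arc_trigE.
have a0 : 0 < sin (t / 2) by apply: sin_gt0_pi; apply/andP; lra.
split=> h.
  have : 0 < sin ((s - t) / 2) by apply: sin_gt0_pi; apply/andP; lra.
  by move=> h1; have := mulr_gt0 a0 h1; lra.
have : 0 < sin ((t - s) / 2) by apply: sin_gt0_pi; apply/andP; lra.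
have -> : (t - s) / 2 = - ((s - t) / 2) by lra.
by rewrite sinN => h1; have := mulr_gt0 a0 h1; lra.
Qed.

Lemma ae_neq (a : R) : {ae mu, forall t, t != a}.
Proof.
exists [set a]; split; [exact: measurable_set1|exact: lebesgue_measure_set1|].
by move=> t /= /negP; rewrite negbK => /eqP.
Qed.

(** Dominated convergence of [step_poly k \o arc_trig s] to the indicator of the arc
    from [1] to [circ s]. *)
Lemma step_integrals_eq0 (u : R -> R) s : mu.-integrable arc (EFin \o u) ->
  (forall k, mint (fun t => u t * step_poly k (arc_trig s (circ t))) = 0) ->
  0 < s < 2 * pi -> Rintegral mu `[0, s]%classic u = 0.
Proof.
move=> iu h hs.
have mu_u : measurable_fun arc u by apply/measurable_EFinP; exact: measurable_int iu.
have mst k : measurable_fun arc (fun t => step_poly k (arc_trig s (circ t))).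
  apply: measurable_funX; apply: measurable_funB; first exact: measurable_cst.
  apply: measurable_funX; apply: measurable_funB; first exact: measurable_cst.
  apply: measurable_funM; first exact: measurable_cst.
  apply: measurable_funB; last exact: measurable_cst.
  by have [] := mT_mul (mT_cst ((circ (s / 2))^*%C)) mT_id.
have ms : measurable (`[0, s]%classic : set R) by exact: measurable_itv.
pose v := u \_ (`[0, s]%classic).
have mv : measurable_fun arc v.
  apply: measurable_funS (measurableT) _ _ => //.
  apply/(measurable_restrictT _ ms); apply: measurable_funS mu_u => //.
  by move=> t /=; rewrite /arcT /= !in_itv /= => /andP[-> h1] /=; case/andP: hs => _ /ltW; exact: le_trans.
have cv : {ae mu, forall t, arc t -> (fun k => (u t * step_poly k (arc_trig s (circ t)))%:E) @ \oo --> (v t)%:E}.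
  apply: (@filterS3 _ _ (ae_filter_ringOfSetsType mu) _ _ _ _ _ (ae_neq 0) (ae_neq s) (ae_neq (2 * pi))).
  move=> t t0 ts t1; rewrite /arcT /= in_itv /= => /andP[t0' t1'].
  have ht : 0 < t < 2 * pi by rewrite !lt_neqAle eq_sym t0 t0' t1.
  have [lo hi] := arc_trig_lt ht hs; have /andP[b0 b1] := arc_trig_bound s t.
  apply: cvg_EFin; first exact: nearW.
  have [tls|stt] := ltP t s.
    have -> : v t = u t * 1.
      by rewrite mulr1 /v patchE mem_set//= in_itv /= t0' ltW.
    by apply: cvgM; [exact: cvg_cst|exact: step_poly_lo (lo tls)].
  have {}stt : s < t by rewrite lt_neqAle eq_sym ts.
  have -> : v t = u t * 0.
    rewrite mulr0 /v patchE memNset//= in_itv /= t0' /= => hts.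
    by have := lt_le_trans stt hts; rewrite ltxx.
  by apply: cvgM; [exact: cvg_cst|exact: step_poly_hi (hi stt)].
have [|||||_ _ h3] := @dominated_convergence _ _ _ mu arc arc_meas
   (fun k t => (u t * step_poly k (arc_trig s (circ t)))%:E) (EFin \o v) (EFin \o (fun t => `|u t|)).
- by move=> k; apply/measurable_EFinP; exact: measurable_funM mu_u (mst k).
- exact/measurable_EFinP.
- exact: cv.
- exact: integrable_norm.
- apply: aeW => t k _; rewrite /= lee_fin normrM ler_piMr//.
  by have /andP[h0 h1] := step_poly_bound k (arc_trig_bound s t); rewrite ger0_norm.
have z : (\int[mu]_(t in arc) (v t)%:E = 0)%E.
  have h4 : (fun k => \int[mu]_(t in arc) (u t * step_poly k (arc_trig s (circ t)))%:E)%E @ \oo --> (0 : \bar R)%E.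
    apply: cvg_near_cst; apply: nearW => k.
    rewrite -[LHS]fineK; first by congr (_%:E); exact: h.
    apply: (@integrable_fin_num _ _ _ mu arc arc_meas).
    apply: (@integrable_dom _ _ (fun t => `|u t|)); last exact: integrable_norm.
      exact: measurable_funM.
    move=> t _; rewrite normrM ler_piMr//.
    by have /andP[g0 g1] := step_poly_bound k (arc_trig_bound s t); rewrite ger0_norm.
  exact: (cvg_unique _ h3 h4).
have sub : arc `&` `[0, s]%classic = `[0, s]%classic.
  apply/setIidPr => t /=; rewrite /arcT /= !in_itv /= => /andP[-> h1] /=.
  by case/andP: hs => _ /ltW; exact: le_trans.
by rewrite -sub Rintegral_mkcondr /Rintegral z.
Qed.

(** Lebesgue's differentiation theorem: [u] is almost everywhere the derivative of
    its vanishing primitive. *)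
Lemma ae0_of_primitive (u : R -> R) : mu.-integrable arc (EFin \o u) ->
  (forall s, 0 < s < 2 * pi -> Rintegral mu `[0, s]%classic u = 0) ->
  {ae mu, forall t, arc t -> u t = 0}.
Proof.
move=> iu h; pose v := u \_ arc.
have iv : mu.-integrable setT (EFin \o v).
  have -> : EFin \o v = (EFin \o u) \_ arc.
    by apply/funext => t; rewrite /v /= !patchE; case: ifP.
  exact: (proj1 (@integrable_mkcond _ _ _ mu arc (EFin \o u) arc_meas)).
have lv : locally_integrable [set: R] v by exact: integrable_locally.
have := @FTC1 R v (BLeft 0) _ lv.
have iy y : mu.-integrable [set` Interval (BLeft 0) (BRight y)] (EFin \o v).
  by apply: integrableS iv => //; exact: measurable_itv.
move=> /(_ iy) /= D.
apply: (@filterS3 _ _ (ae_filter_ringOfSetsType mu) _ _ _ _ _ (ae_neq 0) (ae_neq (2 * pi)) D).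
move=> t t0 t1 Dt; rewrite /arcT /= in_itv /= => /andP[t0' t1'].
have ht : 0 < t < 2 * pi by rewrite !lt_neqAle eq_sym t0 t0' t1.
have /andP[tp tl] := ht.
have [|_] := Dt; first by rewrite lte_fin.
have -> : v t = u t by rewrite /v patchE mem_set// /arcT /= in_itv /= t0' t1'.
move=> <-; rewrite derive1E.
rewrite (@near_eq_derive _ _ _ _ (cst 0)) ?derive_cst//.
near=> y.
have hy : 0 < y < 2 * pi.
  by apply/andP; split; near: y; [exact: lt_nbhsr|exact: lt_nbhsl].
transitivity (Rintegral mu `[0, y]%classic u); last exact: h.
apply: eq_Rintegral => x; rewrite inE /= in_itv /= => /andP[x0 x1].
rewrite /v patchE mem_set// /arcT /= in_itv /= x0 /=; apply: le_trans x1 _.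
by case/andP: hy => _ /ltW.
Unshelve. all: by end_near.
Qed.

(** An integrable function on the circle all of whose Fourier coefficients
    vanish is zero almost everywhere: its integrals over arcs vanish, since
    indicators of arcs are bounded limits of trigonometric polynomials. *)
Theorem fourier_unique F : L1T F ->
  (forall n, intT (fun z => F z * z ^+ n) = 0) ->
  (forall n, intT (fun z => F z * (z^*%C) ^+ n) = 0) ->
  ae_eqT F (cst 0).
Proof.
move=> hF Fp Fn; have [iR iI] := hF.
have key s k : intT (fun z => F z * (step_poly k (arc_trig s z))%:C) = 0.
  apply: trigpoly_annihilates => //; last exact: trigpoly_arc.
  - split; last exact: measurable_cst.
    apply: measurable_funX; apply: measurable_funB; first exact: measurable_cst.
    apply: measurable_funX; apply: measurable_funB; first exact: measurable_cst.
    apply: measurable_funM; first exact: measurable_cst.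
    apply: measurable_funB; last exact: measurable_cst.
    by have [] := mT_mul (mT_cst ((circ (s / 2))^*%C)) mT_id.
  - move=> t; have /andP[h0 h1] := step_poly_bound k (arc_trig_bound s t).
    by rewrite nmR ger0_norm.
have inj (x : R) : (2 * pi)^-1 * x = 0 -> x = 0.
  by move/eqP; rewrite mulf_eq0 invr_eq0 (negbTE (two_pi_neq0)) => /eqP.
have hR : {ae mu, forall t, arc t -> Re (F (circ t)) = 0}.
  apply: ae0_of_primitive => // s hs; apply: step_integrals_eq0 => // k.
  have := congr1 (@complex.Re R) (key s k); rewrite intTE /= => /inj <-.
  by apply: eq_Rintegral => t _; rewrite ReM /= mulr0 subr0.
have hI : {ae mu, forall t, arc t -> Im (F (circ t)) = 0}.
  apply: ae0_of_primitive => // s hs; apply: step_integrals_eq0 => // k.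
  have := congr1 (@complex.Im R) (key s k); rewrite intTE /= => /inj <-.
  by apply: eq_Rintegral => t _; rewrite ImM /= mulr0 add0r.
by apply: (arc_aeS2 hR hI) => t h1 h2; exact: cplxP.
Qed.

End FourierUniqueness.
(** * Multiplication operators, the Hardy space and Beurling's theorem *)

Section Hardy.
Context {R : realType}.
Local Notation C := R[i].
Local Notation circ := (@circ R).
Local Notation L := (@L2m R).
Local Notation ip := (@ip R).
Local Notation lnrm := (nrm ip).
Implicit Types (phi psi : C -> C) (u v w : L) (p q : {poly C}).

(** ** Bounded multipliers *)

Definition bmult phi := mT phi /\ exists K, forall t, nm (phi (circ t)) <= K.

Lemma bmult_cst c : bmult (fun=> c).
Proof. by split; [exact: mT_cst|exists (nm c)]. Qed.
Lemma bmult_id : bmult (fun z => z).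
Proof. by split; [exact: mT_id|exists 1 => t; rewrite nm_circ]. Qed.
Lemma bmult_conj phi : bmult phi -> bmult (fun z => (phi z)^*%C).
Proof. by move=> [h [K hK]]; split; [exact: mT_conj|exists K => t; rewrite nmJ]. Qed.
Lemma bmult_add phi psi : bmult phi -> bmult psi -> bmult (fun z => phi z + psi z).
Proof.
move=> [h [K hK]] [h' [K' hK']]; split; first exact: mT_add.
by exists (K + K') => t; apply: le_trans (nmD _ _) _; exact: lerD.
Qed.
Lemma bmult_mul phi psi : bmult phi -> bmult psi -> bmult (fun z => phi z * psi z).
Proof.
move=> [h [K hK]] [h' [K' hK']]; split; first exact: mT_mul.
by exists (K * K') => t; rewrite nmM; apply: ler_pM; rewrite ?nm_ge0.
Qed.
Lemma bmult_exp phi n : bmult phi -> bmult (fun z => phi z ^+ n).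
Proof.
move=> h; elim: n => [|n IH]; first exact: bmult_cst.
by under eq_fun do rewrite exprS; exact: bmult_mul.
Qed.
Lemma bmult_poly p : bmult (fun z => p.[z]).
Proof.
elim/poly_ind: p => [|p c IH]; first by under eq_fun do rewrite horner0; exact: bmult_cst.
under eq_fun do rewrite hornerMXaddC; apply: bmult_add; last exact: bmult_cst.
by apply: bmult_mul => //; exact: bmult_id.
Qed.

Lemma bmult_L2 phi f : bmult phi -> L2T f -> L2T (fun z => phi z * f z).
Proof. by move=> [h [K hK]] hf; exact: L2T_bdd_mul hf. Qed.
Lemma bmult_L2T phi : bmult phi -> L2T phi.
Proof. by move=> [h [K hK]]; exact: L2T_bdd hK. Qed.

Lemma Mul_sig : {M : (C -> C) -> L -> L | forall phi u, M phi u = cls (fun z => phi z * rep u z)}.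
Proof. by exists (fun phi u => cls (fun z => phi z * rep u z)). Qed.
Definition Mul := projT1 Mul_sig.
Lemma MulE phi u : Mul phi u = cls (fun z => phi z * rep u z).
Proof. exact: (projT2 Mul_sig). Qed.

Lemma Mul_cls phi f : bmult phi -> L2T f -> Mul phi (cls f) = cls (fun z => phi z * f z).
Proof.
rewrite MulE => hp hf; apply/cls_eq; try by apply: bmult_L2 => //; exact: rep_L2.
by apply: (arc_aeS (rep_cls hf)) => t ->.
Qed.
Lemma Mul_lin phi c u v : bmult phi -> Mul phi (c *: u + v) = c *: Mul phi u + Mul phi v.
Proof.
move=> hp; rewrite -{1}(repK u) -{1}(repK v) -cls_lin; try exact: rep_L2.
rewrite Mul_cls//; last by apply: L2T_lin; exact: rep_L2.
rewrite !MulE -cls_lin; try by apply: bmult_L2 => //; exact: rep_L2.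
by congr cls; apply/funext => z; rewrite mulrDr mulrCA.
Qed.
Lemma MulD phi u v : bmult phi -> Mul phi (u + v) = Mul phi u + Mul phi v.
Proof. by move=> hp; have := Mul_lin 1 u v hp; rewrite !scale1r. Qed.
Lemma Mul0 phi : bmult phi -> Mul phi 0 = 0.
Proof. by move=> hp; have := MulD 0 0 hp; rewrite addr0 => /esym/eqP; rewrite -subr_eq0 addrK => /eqP. Qed.
Lemma MulZ phi c u : bmult phi -> Mul phi (c *: u) = c *: Mul phi u.
Proof. by move=> hp; have := Mul_lin c u 0 hp; rewrite Mul0// !addr0. Qed.
Lemma MulB phi u v : bmult phi -> Mul phi (u - v) = Mul phi u - Mul phi v.
Proof. by move=> hp; rewrite -scaleN1r MulD// MulZ// scaleN1r. Qed.

Lemma ip_Mul phi u v : bmult phi -> ip (Mul phi u) v = ip u (Mul (fun z => (phi z)^*%C) v).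
Proof.
move=> hp; have hc := bmult_conj hp.
rewrite -{1}(repK v) -{1}(repK u) Mul_cls ?MulE ?ip_cls//; try exact: rep_L2; try by apply: bmult_L2 => //; exact: rep_L2.
rewrite -[in RHS](repK u) ip_cls; try exact: rep_L2; last by apply: bmult_L2 => //; exact: rep_L2.
by apply: eq_intT => t /=; rewrite /conjT conjM conjcK mulrCA !mulrA.
Qed.
Lemma Mul_Mul phi psi u : bmult phi -> bmult psi ->
  Mul phi (Mul psi u) = Mul (fun z => phi z * psi z) u.
Proof.
move=> hp hq; rewrite (MulE psi) Mul_cls// ?MulE; last by apply: bmult_L2 => //; exact: rep_L2.
by congr cls; apply/funext => z; rewrite mulrA.
Qed.
Lemma Mul_ae phi psi u : bmult phi -> bmult psi -> ae_eqT phi psi -> Mul phi u = Mul psi u.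
Proof.
move=> hp hq h; rewrite !MulE; apply/cls_eq; try by apply: bmult_L2 => //; exact: rep_L2.
by apply: (arc_aeS h) => t ->.
Qed.
Lemma eq_Mul phi psi u : bmult phi -> bmult psi ->
  (forall t, phi (circ t) = psi (circ t)) -> Mul phi u = Mul psi u.
Proof. by move=> hp hq h; apply: Mul_ae => //; exact: ae_eqT_pt. Qed.
Lemma Mul_cst c u : Mul (fun=> c) u = c *: u.
Proof. by rewrite MulE cls_scale ?repK//; exact: rep_L2. Qed.
Lemma Mul1 u : Mul (fun=> 1) u = u. Proof. by rewrite Mul_cst scale1r. Qed.
Lemma Mul_add phi psi u : bmult phi -> bmult psi ->
  Mul (fun z => phi z + psi z) u = Mul phi u + Mul psi u.
Proof.
move=> hp hq; rewrite !MulE -cls_add; try by apply: bmult_L2 => //; exact: rep_L2.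
by congr cls; apply/funext => z; rewrite mulrDl.
Qed.
Lemma Mul_comm phi psi u : bmult phi -> bmult psi -> Mul phi (Mul psi u) = Mul psi (Mul phi u).
Proof.
move=> hp hq; rewrite !Mul_Mul//; apply: eq_Mul; try exact: bmult_mul.
by move=> t; rewrite mulrC.
Qed.

Lemma nrm_rep u : lnrm u = norm2 (rep u).
Proof. by rewrite -nrm_cls ?repK//; exact: rep_L2. Qed.

Lemma nrm_Mul phi u K : bmult phi -> (forall t, nm (phi (circ t)) <= K) ->
  lnrm (Mul phi u) <= K * lnrm u.
Proof.
move=> hp hK; have K0 : 0 <= K := le_trans (nm_ge0 _) (hK 0).
have hu := rep_L2 u; have hm := bmult_L2 hp hu.
rewrite -ler_sqr ?nnegrE ?mulr_ge0 ?lnrm_ge0// exprMn.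
rewrite (nrm_rep u) MulE nrm_cls// !norm2E//.
rewrite mulrCA ler_wpM2l ?invr_ge0 ?two_pi_ge0// -RintegralZl//; last exact: L2T_nm2.
apply: le_Rintegral => //; first exact: L2T_nm2 hm.
  by apply: arc_intZ; exact: L2T_nm2.
move=> t _; rewrite nmM exprMn ler_wpM2r ?sqr_ge0//.
by rewrite ler_sqr ?nnegrE ?nm_ge0.
Qed.

(** ** The Hardy space as a closed subspace of [L2] *)

(** The classes of the elements of [H2]. *)
Definition HH : set L := [set u | forall n, ip u (cls (fun z => (z^*%C) ^+ n.+1)) = 0].

Let bX n : bmult (fun z => z ^+ n). Proof. by apply: bmult_exp; exact: bmult_id. Qed.
Let bJ n : bmult (fun z : C => (z^*%C) ^+ n).
Proof. by apply: (@bmult_exp (fun z => z^*%C)); apply: bmult_conj; exact: bmult_id. Qed.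

Lemma H2P (f : C -> C) : H2 f <-> L2T f /\ HH (cls f).
Proof.
have E (n : nat) : L2T f -> ip (cls f) (cls (fun z => (z^*%C) ^+ n.+1)) = intT (fun z => f z * z ^+ n.+1).
  move=> hf; rewrite ip_cls//; last exact: bmult_L2T.
  by apply: eq_intT => t /=; rewrite /conjT conjX conjcK.
by split=> -[hf h]; split => // n; [rewrite E|rewrite -E].
Qed.
Lemma H2_rep u : HH u -> H2 (rep u).
Proof. by move=> hu; apply/H2P; rewrite repK; split => //; exact: rep_L2. Qed.
Lemma H2_L2 (f : C -> C) : H2 f -> L2T f. Proof. by case. Qed.

Lemma HH_subspace : subspace HH.
Proof.
split=> [n|c u v hu hv n]; first by rewrite ip0l.
by rewrite ipDl ipZl hu hv mulr0 addr0.
Qed.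

Lemma ip_closed (w : L) : closedV lnrm [set u | ip u w = 0].
Proof.
move=> h hh /=; apply: nm_eq0; apply/eqP; rewrite eq_le nm_ge0 andbT leNgt; apply/negP => p.
have k0 : 0 < lnrm w + 1 by rewrite ltr_wpDl// lnrm_ge0.
have [u /= hu hd] := hh _ (divr_gt0 p k0).
have cs := lcauchy_schwarz (h - u) w; rewrite ipBl hu subr0 in cs.
move: hd; rewrite ltr_pdivlMr// mulrDr mulr1 => hd.
have := lnrm_ge0 (h - u); have := lt_le_trans hd cs; lra.
Qed.

Lemma HH_closed : closedV lnrm HH.
Proof.
move=> h hh n; apply: (ip_closed (w := cls (fun z => (z^*%C) ^+ n.+1))) => e e0.
by have [u hu hd] := hh e e0; exists u => //; exact: hu.
Qed.

Lemma HH_add u v : HH u -> HH v -> HH (u + v). Proof. exact: subD HH_subspace. Qed.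
Lemma HH_scale c u : HH u -> HH (c *: u). Proof. exact: subZ HH_subspace. Qed.
Lemma HH_sub u v : HH u -> HH v -> HH (u - v). Proof. exact: subB HH_subspace. Qed.

Lemma Mul_z_HH u : HH u -> HH (Mul (fun z => z) u).
Proof.
move=> hu n; rewrite ip_Mul; last exact: bmult_id.
rewrite Mul_cls; [|exact/bmult_conj/bmult_id|exact: bmult_L2T].
by have := hu n.+1; under eq_fun do rewrite exprS.
Qed.

Lemma Mul_poly_closed (N : set L) : subspace N -> (forall u, N u -> N (Mul (fun z => z) u)) ->
  forall p u, N u -> N (Mul (fun z => p.[z]) u).
Proof.
move=> hN zN p u hu; elim/poly_ind: p => [|p c IH].
  under eq_fun do rewrite horner0; rewrite Mul_cst scale0r; exact: hN.1.
under eq_fun do rewrite hornerMXaddC.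
rewrite Mul_add; [|by apply: bmult_mul; [exact: bmult_poly|exact: bmult_id]|exact: bmult_cst].
apply: subD => //; last by rewrite Mul_cst; exact: subZ.
rewrite -Mul_Mul; [|exact: bmult_poly|exact: bmult_id].
rewrite Mul_comm; [exact: zN|exact: bmult_poly|exact: bmult_id].
Qed.

Lemma Mul_poly_HH p u : HH u -> HH (Mul (fun z => p.[z]) u).
Proof. by apply: Mul_poly_closed; [exact: HH_subspace|exact: Mul_z_HH]. Qed.

Definition polyL p : L := cls (fun z => p.[z]).
Lemma polyL_lin c p q : polyL (c *: p + q) = c *: polyL p + polyL q.
Proof.
rewrite /polyL -cls_lin; try by apply: bmult_L2T; exact: bmult_poly.
by congr cls; apply/funext => z; rewrite !hornerE.
Qed.
Lemma Mul_polyL p q : Mul (fun z => p.[z]) (polyL q) = polyL (p * q).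
Proof.
rewrite Mul_cls; [|exact: bmult_poly|by apply: bmult_L2T; exact: bmult_poly].
by congr cls; apply/funext => z; rewrite hornerM.
Qed.

Lemma int_pow n : intT (fun z : C => z ^+ n.+1) = 0.
Proof.
have cX m t : circ t ^+ m = circ (m%:R * t).
  elim: m => [|m IH]; first by rewrite mul0r /Defs.circ cos0 sin0.
  by rewrite exprS IH -circD -[m.+1]add1n natrD mulrDl mul1r.
pose c : R := n.+1%:R; have c0 : c != 0 by rewrite pnatr_eq0.
have dsin (x : R) : is_derive x 1 (fun t => c^-1 * sin (c * t)) (cos (c * x)).
  apply: is_derive_eq; rewrite /GRing.scale /=; by field.
have dcos (x : R) : is_derive x 1 (fun t => - c^-1 * cos (c * t)) (sin (c * x)).
  apply: is_derive_eq; rewrite /GRing.scale /=; by field.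
have contc : continuous (fun t : R => c * t) by move=> x; apply: cvgM; [exact: cvg_cst|exact: cvg_id].
have per : cos (c * (2 * pi)) = 1 /\ sin (c * (2 * pi)) = 0 :> R.
  have := cX n.+1 (2 * pi); rewrite -/c.
  have -> : circ (2 * pi) = 1 by rewrite /Defs.circ mulr_natl cos2pi sin2pi.
  by rewrite expr1n => -[].
have FTC (F f : R -> R) : (forall x : R, is_derive x 1 F (f x)) -> continuous f ->
    F (2 * pi) = F 0 -> Rintegral (@lebesgue_measure R) (@arcT R) f = 0.
  move=> dF cf F0; have dv (x : R) : derivable F x 1 by case: (dF x).
  have cF : continuous F by move=> x; apply: differentiable_continuous; exact/derivable1_diffP.
  rewrite /Rintegral /arcT (@continuous_FTC2 _ _ F)//.
  - by rewrite F0 -EFinB subrr.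
  - exact: continuous_subspaceT.
  - split; first by move=> x _; exact: dv.
    + exact/cvg_at_right_filter/cF.
    + exact/cvg_at_left_filter/cF.
  - by move=> x _; rewrite derive1E; case: (dF x).
apply: cplxP; rewrite intTE /=.
- under eq_Rintegral do rewrite cX /=.
  rewrite (FTC _ _ dsin) ?mulr0//; last by rewrite per.2 mulr0 sin0 mulr0.
  by move=> x; apply: continuous_comp; [exact: contc|exact: continuous_cos].
- under eq_Rintegral do rewrite cX /=.
  rewrite -/c (FTC _ _ dcos); first by rewrite mulr0.
  - by move=> x; apply: continuous_comp; [exact: contc|exact: continuous_sin].
  - by rewrite per.1 mulr0 cos0.
Qed.

Lemma HH_polyL p : HH (polyL p).
Proof.
have h1 : HH (polyL 1).
  move=> n; rewrite /polyL ip_cls; [|by apply: bmult_L2T; exact: bmult_poly|exact: bmult_L2T].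
  rewrite -[RHS](int_pow n); apply: eq_intT => t /=.
  by rewrite hornerC mul1r /conjT conjX conjcK.
by rewrite -[p]mulr1 -Mul_polyL; exact: Mul_poly_HH.
Qed.
(** Membership in [HH] kills the Fourier coefficients of negative index. *)
Lemma ip_polyX_eq0 u : HH u -> (forall n, ip u (polyL 'X^n) = 0) -> u = 0.
Proof.
move=> hu h; have hr := rep_L2 u.
have L1 : L1T (rep u).
  have := L2T_mul_L1T hr (L2T_cst 1); by under eq_fun do rewrite mulr1.
have := @fourier_unique R (rep u) L1.
have h1 (f : C -> C) : L2T f -> ip u (cls f) = intT (fun z => rep u z * (f z)^*%C).
  by move=> hf; rewrite -{1}(repK u) ip_cls.
case=> [n|n|].
- case: n => [|n].
    have := h 0%N; rewrite /polyL h1; last by apply: bmult_L2T; exact: bmult_poly.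
    by move=> <-; apply: eq_intT => t; rewrite expr0 hornerC conj1.
  have := hu n; rewrite h1; last exact: bmult_L2T.
  by move=> <-; apply: eq_intT => t; rewrite conjX conjcK.
- have := h n; rewrite /polyL h1; last by apply: bmult_L2T; exact: bmult_poly.
  by move=> <-; apply: eq_intT => t; rewrite hornerXn conjX.
move=> N [mN N0 hN]; rewrite -(repK u) -cls0; apply/cls_eq => //; first exact: L2T_cst.
by exists N.
Qed.

(** The functional [<., u>] on polynomials is represented by an element [h] of
    their closure, and [u - h] is orthogonal to all powers of [z]. *)
Theorem polyL_dense u : HH u -> forall e : R, 0 < e -> exists p, lnrm (u - polyL p) < e.
Proof.
move=> hu; pose W : set L := [set polyL p | p in setT].
have hW : subspace W.
  split; first by exists 0 => //; rewrite /polyL; under eq_fun do rewrite horner0; exact: cls0.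
  by move=> c _ _ [p _ <-] [q _ <-]; exists (c *: p + q) => //; rewrite polyL_lin.
have [|| h [h1 h2 _]] := lriesz (W := W) (l := fun v => ip v u) (K := lnrm u) hW.
- by move=> c v w _ _; rewrite ipDl ipZl.
- by move=> v _; rewrite mulrC; exact: lcauchy_schwarz.
have hh : HH h.
  apply: HH_closed => e e0; have [_ [p _ <-] hp] := h1 e e0.
  by exists (polyL p) => //; exact: HH_polyL.
have uh : u = h.
  apply/eqP; rewrite -subr_eq0; apply/eqP; apply: ip_polyX_eq0; first exact: HH_sub.
  by move=> n; rewrite -ipC ipBr h2 ?subrr ?conj0//; exists 'X^n.
move=> e e0; have [_ [p _ <-] hp] := h1 e e0; exists p; by rewrite uh.
Qed.

(** ** The orthogonal projection onto [HH] *)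

Lemma PH_sig : {P : L -> L | forall u, HH (P u) /\ forall w, HH w -> ip (u - P u) w = 0}.
Proof.
have h u : exists v : L, HH v /\ forall w, HH w -> ip (u - v) w = 0.
  by have [v hv h] := lprojection u HH_subspace HH_closed; exists v.
by apply: cid; have [P hP] := choice h; exists P.
Qed.
Definition PH := projT1 PH_sig.
Lemma PH_HH u : HH (PH u). Proof. exact: (projT2 PH_sig u).1. Qed.
Lemma PH_orth u w : HH w -> ip (u - PH u) w = 0.
Proof. exact: (projT2 PH_sig u).2. Qed.
Lemma PH_ip u w : HH w -> ip (PH u) w = ip u w.
Proof. by move=> /(PH_orth u); rewrite ipBl => /eqP; rewrite subr_eq0 => /eqP. Qed.
Lemma PH_unique u v : HH v -> (forall w, HH w -> ip v w = ip u w) -> PH u = v.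
Proof.
move=> hp h; apply/eqP; rewrite -subr_eq0; apply/eqP; apply: ip_eq0.
have hd : HH (PH u - v) by apply: HH_sub => //; exact: PH_HH.
by rewrite ipBl PH_ip// h// subrr.
Qed.
Lemma PH_id u : HH u -> PH u = u. Proof. by move=> hu; exact: PH_unique. Qed.
Lemma PH_lin c u v : PH (c *: u + v) = c *: PH u + PH v.
Proof.
apply: PH_unique; first by apply: HH_add; [apply: HH_scale; exact: PH_HH|exact: PH_HH].
by move=> w hw; rewrite !ipDl !ipZl (PH_ip u hw) (PH_ip v hw).
Qed.
Lemma PH_nrm2 u : lnrm u ^+ 2 = lnrm (PH u) ^+ 2 + lnrm (u - PH u) ^+ 2.
Proof.
rewrite -lpythagoras; first by rewrite addrC subrK.
by rewrite -ipC PH_orth ?conj0//; exact: PH_HH.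
Qed.
Lemma PH_le u : lnrm (PH u) <= lnrm u.
Proof.
by rewrite -ler_sqr ?nnegrE ?lnrm_ge0// (PH_nrm2 u) lerDl sqr_ge0.
Qed.

(** ** Inner functions and Beurling's theorem *)

(** Inner functions; the bound is asked for at every point of the circle, so that
    they are bounded multipliers. *)
Definition inner_mult (theta : C -> C) : Prop :=
  [/\ mT theta, forall t, nm (theta (circ t)) <= 1,
     ae_eqT (fun z => (nm (theta z))%:C) (fun=> 1) & HH (cls theta)].

Section Inner.
Variables (theta : C -> C) (hth : inner_mult theta).
Lemma inner_bmult : bmult theta.
Proof. by case: hth => mt bt _ _; split=> //; exists 1. Qed.
Let bt := inner_bmult.

Lemma Mul_innerK u : Mul (fun z => (theta z)^*%C) (Mul theta u) = u.
Proof.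
have bc := bmult_conj bt.
rewrite Mul_Mul// -[RHS]Mul1; apply: Mul_ae; [exact: bmult_mul|exact: bmult_cst|].
case: hth => _ _ h _; apply: (arc_aeS h) => t [e].
by rewrite mulrC nm_mulJ e expr1n.
Qed.
Lemma ip_Mul_inner u v : ip (Mul theta u) (Mul theta v) = ip u v.
Proof. by rewrite ip_Mul// Mul_innerK. Qed.
Lemma nrm_Mul_inner u : lnrm (Mul theta u) = lnrm u.
Proof. by rewrite /nrm ip_Mul_inner. Qed.
Lemma Mul_inner_poly p : Mul theta (polyL p) = Mul (fun z => p.[z]) (cls theta).
Proof.
rewrite /polyL Mul_cls ?Mul_cls//; try exact: bmult_poly; try by apply: bmult_L2T => //; exact: bmult_poly.
by congr cls; apply/funext => z; rewrite mulrC.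
Qed.
Lemma Mul_inner_approx u (e : R) : HH u -> 0 < e ->
  exists p, lnrm (Mul theta u - Mul (fun z => p.[z]) (cls theta)) < e.
Proof.
move=> hu e0; have [p hp] := polyL_dense hu e0; exists p.
by rewrite -Mul_inner_poly -MulB// nrm_Mul_inner.
Qed.
Lemma Mul_inner_HH u : HH u -> HH (Mul theta u).
Proof.
move=> hu; apply: HH_closed => e e0; have [p hp] := Mul_inner_approx hu e0.
by exists (Mul (fun z => p.[z]) (cls theta)) => //; apply: Mul_poly_HH; case: hth.
Qed.
End Inner.

Lemma nrm_Mul_z u : lnrm (Mul (fun z => z) u) = lnrm u.
Proof.
rewrite /nrm ip_Mul; last exact: bmult_id.
rewrite Mul_Mul; [|exact/bmult_conj/bmult_id|exact: bmult_id].
rewrite (@eq_Mul _ (fun=> 1)) ?Mul1//.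
- by apply: bmult_mul; [exact/bmult_conj/bmult_id|exact: bmult_id].
- exact: bmult_cst.
- by move=> t; rewrite mulrC circ_mulJ.
Qed.

Lemma ip_L1 u v : L1T (fun z => rep u z * (rep v z)^*%C).
Proof. by apply: L2T_mul_L1T; [|apply: L2T_conj]; exact: rep_L2. Qed.

Lemma ip_MulE phi u v : bmult phi -> ip (Mul phi u) v = intT (fun z => rep u z * (rep v z)^*%C * phi z).
Proof.
move=> hp; rewrite MulE -{1}(repK v) ip_cls; try exact: rep_L2; last by apply: bmult_L2 => //; exact: rep_L2.
by apply: eq_intT => t /=; rewrite /conjT -mulrA mulrC.
Qed.

(** The hypotheses give all Fourier coefficients of the integrable function
    [u v^*]. *)
Lemma ip_product_unique u v (c : C) : ip u v = c ->
  (forall n, ip (Mul (fun z => z ^+ n.+1) u) v = 0) ->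
  (forall n, ip (Mul (fun z => (z^*%C) ^+ n.+1) u) v = 0) ->
  ae_eqT (fun z => rep u z * (rep v z)^*%C) (fun=> c).
Proof.
move=> h0 hp hn.
have L1 : L1T (fun z => rep u z * (rep v z)^*%C + (- c)) by apply: L1T_add; [exact: ip_L1|exact: L1T_cst].
have h (phi : C -> C) : bmult phi -> intT (fun z => (rep u z * (rep v z)^*%C + (- c)) * phi z) =
   ip (Mul phi u) v - c * intT phi.
  move=> hb; rewrite ip_MulE// -mulNr -intT_scale; last first.
    by case: hb => hm [K hK]; exact: L1T_bdd hK.
  rewrite -intT_add.
  - by apply: eq_intT => t; rewrite mulrDl.
  - case: hb => hm [K hK]; have := L1T_mul_bdd hm hK (ip_L1 u v).
    by under eq_fun do rewrite mulrC.
  - by apply: L1T_scale; case: hb => hm [K hK]; exact: L1T_bdd hK.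
have z0 : intT (fun z => (rep u z * (rep v z)^*%C + (- c)) * 1) = 0.
  by rewrite h ?Mul1 ?h0 ?intT_cst ?mulr1 ?subrr//; exact: bmult_cst.
have := fourier_unique L1.
case=> [n|n|].
- case: n => [|n]; first by under eq_fun do rewrite expr0.
  by rewrite h// hp int_pow mulr0 subr0.
- case: n => [|n]; first by under eq_fun do rewrite expr0.
  rewrite h// hn.
  have -> : intT (fun z : C => z^*%C ^+ n.+1) = 0.
    under [X in intT X]eq_fun do rewrite -conjX.
    rewrite intT_conj ?int_pow ?conj0//; have [hm [K hK]] := bX n.+1; exact: L1T_bdd hK.
  by rewrite mulr0 subr0.
move=> N [mN N0 hN]; exists N; split => // t /= ht; apply: hN => /= h1; apply: ht => ta.
by have /eqP := h1 ta; rewrite /cst subr_eq0 => /eqP.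
Qed.

(** Every [u] in [N] is divisible in [HH] by all powers of [z], which annihilates
    its Fourier coefficients. *)
Lemma shift_trivial (N : set L) : N `<=` HH ->
  (forall u, N u -> exists2 v, N v & u = Mul (fun z => z) v) -> forall u, N u -> u = 0.
Proof.
move=> NH hN u hu; apply: ip_polyX_eq0; first exact: NH.
move=> n; have [v hv ->] : exists2 v, N v & u = Mul (fun z => z ^+ n.+1) v.
  elim: n => [|n [v hv ->]]; first by have [v hv ->] := hN u hu; exists v.
  have [w hw ->] := hN v hv; exists w => //.
  rewrite Mul_Mul//; last exact: bmult_id.
  by congr (Mul _ w); apply/funext => z; rewrite [RHS]exprSr.
rewrite ip_Mul; last exact: bX.
rewrite /polyL Mul_cls; [|exact: bmult_conj|by apply: bmult_L2T; exact: bmult_poly].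
rewrite -[RHS](NH v hv 0%N); congr (ip _ _); apply/cls_eq.
- by apply: bmult_L2; [exact: bmult_conj|by apply: bmult_L2T; exact: bmult_poly].
- exact: bmult_L2T.
apply: ae_eqT_pt => t; rewrite hornerXn expr1 conjX exprS -mulrA -exprMn.
by rewrite [_^*%C * circ t]mulrC circ_mulJ expr1n mulr1.
Qed.

(** A unit vector [e] of [N] orthogonal to [z N] exists, as otherwise [N = z N]
    would be trivial.  The Fourier coefficients [<z ^ n e, e>] of [|e| ^ 2] vanish
    for [n <> 0], so [|e| = 1] almost everywhere and [e] is the inner function.
    For [u] in [N] the remainder [r = u - theta P (theta^* u)] is orthogonal to
    [theta HH], and [e] to [z N]; hence all Fourier coefficients of [r e^*]
    vanish, and [r = 0]. *)
Theorem beurling (N : set L) : subspace N -> closedV lnrm N -> N `<=` HH ->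
  (forall u, N u -> N (Mul (fun z => z) u)) -> (exists2 u, N u & u <> 0) ->
  exists2 theta, inner_mult theta & forall u, N u <-> exists2 h, HH h & u = Mul theta h.
Proof.
move=> sN cN NH zN [u0 Nu0 u0N].
pose W : set L := [set Mul (fun z => z) u | u in N].
have bi := @bmult_id; have bc : bmult (fun z : C => z^*%C) by exact: bmult_conj.
have zK u : Mul (fun z => z) (Mul (fun z => z^*%C) u) = u.
  rewrite Mul_Mul// -[RHS]Mul1; apply: eq_Mul; [exact: bmult_mul|exact: bmult_cst|].
  by move=> t; rewrite circ_mulJ.
have zJ u : Mul (fun z => z^*%C) (Mul (fun z => z) u) = u.
  by rewrite Mul_comm// zK.
have sW : subspace W.
  split; first by exists 0; [exact: sN.1|rewrite Mul0].
  by move=> c _ _ [u hu <-] [v hv <-]; exists (c *: u + v); [exact: sN.2|rewrite Mul_lin].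
have cW : closedV lnrm W.
  move=> h hh; exists (Mul (fun z => z^*%C) h) => //; apply: cN => e e0.
  have [_ [w Nw <-] hw] := hh e e0; exists w => //.
  by rewrite -nrm_Mul_z MulB// zK.
have [e [Ne eW e1]] : exists e, [/\ N e, forall u, N u -> ip e (Mul (fun z => z) u) = 0 & ip e e = 1].
  apply: contrapT => hno; apply: u0N; apply: (@shift_trivial N) => // f Nf.
  have [p [g Ng gp] hp] := lprojection f sW cW; exists g => //; rewrite gp.
  apply/eqP; rewrite -subr_eq0; apply: contrapT => /negP d0; apply: hno.
  have Nd : N (f - p) by apply: subB => //; rewrite -gp; exact: zN.
  have n0 : lnrm (f - p) != 0 by apply: contra_neq d0 => /lnrm_eq0.
  exists (((lnrm (f - p))^-1)%:C *: (f - p)); split; first exact: subZ.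
  - by move=> u Nu; rewrite ipZl hp ?mulr0//; exists u.
  - rewrite ipZl ipZr ipE conjc_real -!cM -[RHS]/(1%:C); congr (_%:C).
    by field.
pose E := rep e; have hE : L2T E := rep_L2 e.
have zn n : N (Mul (fun z => z ^+ n) e).
  have -> : Mul (fun z => z ^+ n) e = Mul (fun z => ('X^n).[z]) e.
    by congr (Mul _ e); apply/funext => z; rewrite hornerXn.
  exact: Mul_poly_closed.
have Sz (u : L) n : Mul (fun z => z ^+ n.+1) u = Mul (fun z => z) (Mul (fun z => z ^+ n) u).
  by rewrite Mul_Mul//; congr (Mul _ u); apply/funext => z; rewrite exprS.
have Eae : ae_eqT (fun z => E z * (E z)^*%C) (fun=> 1).
  apply: ip_product_unique => // n.
  - by rewrite -ipC Sz eW ?conj0//.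
  - rewrite ip_Mul; last exact: bJ.
    have -> : Mul (fun z => (z^*%C ^+ n.+1)^*%C) e = Mul (fun z => z ^+ n.+1) e.
      by congr (Mul _ e); apply/funext => z; rewrite conjX conjcK.
    by rewrite Sz eW.
(* the normalization makes the bound by 1 hold at every point *)
pose theta z := E z * ((nm (E z))^-1)%:C.
have nmth z : nm (theta z) = nm (E z) * (nm (E z))^-1.
  by rewrite nmM nmR ger0_norm// invr_ge0 nm_ge0.
have thE : ae_eqT theta E.
  apply: (arc_aeS Eae) => t; rewrite nm_mulJ => -[/eqP].
  rewrite sqrf_eq1 => /orP[/eqP h|/eqP h]; first by rewrite /theta h invr1 mulr1.
  by exfalso; have := nm_ge0 (E (circ t)); rewrite h; lra.
have mth : mT theta.
  apply: mT_mul; first exact: L2T_mT.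
  have hn : measurable_fun (@arcT R) (fun t => nm (E (circ t))).
    by apply: measurable_nm; exact: L2T_mT.
  by split; [exact: measurable_inv arc_meas hn|exact: measurable_cst].
have thL : L2T theta by apply: L2T_ae (ae_eqT_sym thE) hE.
have the : cls theta = e by rewrite -[RHS]repK; exact/cls_eq.
have hth : inner_mult theta.
  split=> //.
  - move=> t; rewrite nmth; have [->|h] := eqVneq (nm (E (circ t))) 0; first by rewrite mul0r.
    by rewrite mulfV.
  - apply: (arc_aeS Eae) => t; rewrite nm_mulJ => -[/eqP].
    rewrite sqrf_eq1 nmth => /orP[/eqP ->|/eqP h]; first by rewrite invr1 mulr1.
    by exfalso; have := nm_ge0 (E (circ t)); rewrite h; lra.
  - by rewrite the; exact: NH.
have bth := inner_bmult hth.
have thN h : HH h -> N (Mul theta h).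
  move=> hh; apply: cN => d d0; have [p hp] := Mul_inner_approx hth hh d0.
  by exists (Mul (fun z => p.[z]) (cls theta)) => //; rewrite the; exact: Mul_poly_closed.
exists theta => // u; split=> [Nu|[h hh ->]]; last exact: thN.
pose g := PH (Mul (fun z => (theta z)^*%C) u).
have hg : HH g := PH_HH _.
exists g => //; apply/eqP; rewrite -subr_eq0; apply/eqP.
set r := u - _; have Nr : N r by apply: subB => //; exact: thN.
have rth h : HH h -> ip r (Mul theta h) = 0.
  move=> hh; rewrite /r ipBl ip_Mul_inner// /g PH_ip//.
  rewrite [X in _ - X]ip_Mul; last exact: bmult_conj.
  by under [X in _ - ip _ (Mul X h)]eq_fun do rewrite conjcK; rewrite subrr.
have eth n : Mul (fun z => z ^+ n) e = Mul theta (polyL 'X^n).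
  by rewrite Mul_inner_poly// the; congr (Mul _ e); apply/funext => z; rewrite hornerXn.
have rE : ae_eqT (fun z => rep r z * (E z)^*%C) (fun=> 0).
  apply: ip_product_unique.
  - have := eth 0%N; have -> : Mul (fun z => z ^+ 0) e = e.
      by rewrite -[RHS]Mul1; congr (Mul _ e).
    by move=> ->; rewrite rth//; exact: HH_polyL.
  - move=> n; rewrite -ipC Sz eW ?conj0//.
    have -> : Mul (fun z => z ^+ n) r = Mul (fun z => ('X^n).[z]) r.
      by congr (Mul _ r); apply/funext => z; rewrite hornerXn.
    exact: Mul_poly_closed.
  - move=> n; rewrite ip_Mul; last exact: bJ.
    have -> : Mul (fun z => (z^*%C ^+ n.+1)^*%C) e = Mul (fun z => z ^+ n.+1) e.
      by congr (Mul _ e); apply/funext => z; rewrite conjX conjcK.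
    by rewrite eth rth//; exact: HH_polyL.
rewrite -(repK r) -cls0; apply/cls_eq; [exact: rep_L2|exact: L2T_cst|].
apply: (arc_aeS2 rE Eae) => t h1 h2; rewrite -[LHS]mulr1 -h2 mulrCA h1 mulr0//.
Qed.

End Hardy.
(** * Operators on functions and on classes *)

Section Operators.
Context {R : realType}.
Local Notation C := R[i].
Local Notation circ := (@circ R).
Local Notation L := (@L2m R).
Local Notation ip := (@ip R).
Local Notation lnrm := (nrm ip).
Local Notation HH := (@HH R).
Implicit Types (f g : C -> C) (u v w : L) (A : (C -> C) -> C -> C) (B : L -> L).

(** Operators on functions act on representatives and respect almost everywhere
    equality only up to it; their range spaces and range norms are computed from
    the operators [B] that they induce on classes. *)
Definition lifts A B := forall f, H2 f -> H2 (A f) /\ cls (A f) = B (cls f).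

Lemma H2_cls f : H2 f -> HH (cls f). Proof. by case/H2P. Qed.

Lemma lifts_HH A B u : lifts A B -> HH u -> HH (B u).
Proof. by move=> AB /H2_rep /AB [/H2_cls]; move=> h e; rewrite -(repK u) -e. Qed.

Lemma cls_H2_eq f g : H2 f -> H2 g -> ae_eqT f g -> cls f = cls g.
Proof. by move=> hf hg h; apply/cls_eq => //; exact: H2_L2. Qed.

Lemma lifts_ae A B f u : lifts A B -> H2 f -> HH u ->
  ae_eqT (A (rep u)) f <-> B u = cls f.
Proof.
move=> AB hf hu; have [h1 h2] := AB _ (H2_rep hu); rewrite repK in h2.
by rewrite -h2; symmetry; apply: cls_eq; exact: H2_L2.
Qed.

Lemma range_spaceP A B f : lifts A B ->
  range_space A f <-> H2 f /\ exists2 u, HH u & B u = cls f.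
Proof.
move=> AB; split=> -[hf].
  move=> [g hg gf]; split=> //; exists (cls g); first exact: H2_cls.
  by have [h1 <-] := AB _ hg; exact: cls_H2_eq.
move=> [u hu uf]; split=> //; exists (rep u); first exact: H2_rep.
exact/(lifts_ae AB).
Qed.

Definition rnorm B (v : L) : R := inf [set lnrm u | u in [set u | HH u /\ B u = v]].

Lemma range_normE A B f : lifts A B -> H2 f -> range_norm A f = rnorm B (cls f).
Proof.
move=> AB hf; congr inf; apply/seteqP; split=> x /=.
  move=> [g [hg gf] ->]; exists (cls g); last by rewrite nrm_cls//; exact: H2_L2.
  split; first exact: H2_cls.
  by have [h1 <-] := AB _ hg; exact: cls_H2_eq.
move=> [u [hu uf] <-]; exists (rep u); last by rewrite nrm_rep.
by split; [exact: H2_rep|exact/(lifts_ae AB)].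
Qed.

Lemma rnorm_le B u v : HH u -> B u = v -> rnorm B v <= lnrm u.
Proof.
move=> hu uv; apply: ge_inf; last by exists u.
by exists 0 => _ [w _ <-]; exact: lnrm_ge0.
Qed.

(** A preimage under [B] yields a preimage under [B'] of controlled norm, and range
    norms are infima over preimages. *)
Lemma rnorm_compare B B' (K : R) v : 0 < K ->
  (forall u, HH u -> exists u', [/\ HH u', B' u' = B u & lnrm u' <= K * lnrm u]) ->
  (exists2 u, HH u & B u = v) -> rnorm B' v <= K * rnorm B v.
Proof.
move=> K0 h [u0 hu0 u0v]; rewrite mulrC -ler_pdivrMr//.
apply: lb_le_inf; first by exists (lnrm u0), u0.
move=> _ [u [hu uv] <-]; rewrite ler_pdivrMr//.
have [u' [hu' e le]] := h u hu; rewrite mulrC; apply: le_trans le.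
by apply: rnorm_le => //; rewrite e.
Qed.

Lemma same_space_lifts A A' B B' (K K' : R) : lifts A B -> lifts A' B' -> 0 < K -> 0 < K' ->
  (forall u, HH u -> exists u', [/\ HH u', B' u' = B u & lnrm u' <= K * lnrm u]) ->
  (forall u, HH u -> exists u', [/\ HH u', B u' = B' u & lnrm u' <= K' * lnrm u]) ->
  same_space (range_space A) (range_norm A) (range_space A') (range_norm A').
Proof.
move=> AB AB' K0 K0' h h'; split.
  apply/seteqP; split=> f /=.
    move/(range_spaceP f AB) => [hf [u hu uf]]; apply/(range_spaceP f AB'); split => //.
    by have [u' [hu' e _]] := h u hu; exists u' => //; rewrite e.
  move/(range_spaceP f AB') => [hf [u hu uf]]; apply/(range_spaceP f AB); split => //.
  by have [u' [hu' e _]] := h' u hu; exists u' => //; rewrite e.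
exists K^-1, K'; split; rewrite ?invr_gt0// => f /(range_spaceP f AB) [hf [u hu uf]].
rewrite (range_normE AB)// (range_normE AB')//; apply/andP; split.
  rewrite mulrC ler_pdivrMr// mulrC; apply: rnorm_compare => //; by exists u.
apply: rnorm_compare => //; have [u' [hu' e _]] := h u hu.
by exists u' => //; rewrite e.
Qed.

(** ** Toeplitz operators *)

Definition Top (phi : C -> C) u : L := PH (Mul phi u).

Lemma projH2P f : L2T f -> H2 (projH2 f) /\ cls (projH2 f) = PH (cls f).
Proof.
move=> hf; rewrite /projH2; set S := (X in xget _ X).
have SP (g : C -> C) : S g <-> H2 g /\ cls g = PH (cls f).
  have key (h : C -> C) : H2 g -> H2 h -> dotT (f \- g) h = ip (cls f - cls g) (cls h).
    move=> hg hh; rewrite -cls_sub ?ip_cls//; try exact: H2_L2.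
    by apply: L2T_sub => //; exact: H2_L2.
  split=> -[hg h]; split=> //.
    apply/esym/PH_unique; first exact: H2_cls.
    move=> w hw; apply/esym/eqP; rewrite -subr_eq0 -ipBl -(repK w) -key//; last exact: H2_rep.
    by rewrite h//; exact: H2_rep.
  by move=> k hk; rewrite key// h PH_orth//; exact: H2_cls.
apply/SP; apply: xgetPex; exists (rep (PH (cls f))); apply/SP.
by split; [apply/H2_rep/PH_HH|exact: repK].
Qed.

Lemma toeplitzP phi f : bmult phi -> L2T f ->
  H2 (toeplitz phi f) /\ cls (toeplitz phi f) = Top phi (cls f).
Proof.
move=> hp hf; have h : L2T (phi \* f) by exact: bmult_L2.
by have [h1 h2] := projH2P h; split => //; rewrite h2 /Top Mul_cls.
Qed.

Lemma toeplitz_lifts phi : bmult phi -> lifts (toeplitz phi) (Top phi).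
Proof. by move=> hp f /H2_L2 hf; exact: toeplitzP. Qed.

Lemma Top_lin phi c u v : bmult phi -> Top phi (c *: u + v) = c *: Top phi u + Top phi v.
Proof. by move=> hp; rewrite /Top Mul_lin// PH_lin. Qed.

Lemma ip_Top phi u v : bmult phi -> HH v ->
  ip (Top phi u) v = ip u (Mul (fun z => (phi z)^*%C) v).
Proof. by move=> hp hv; rewrite /Top PH_ip// ip_Mul. Qed.

Lemma bmult_conjT (phi : C -> C) : bmult phi -> bmult (conjT phi).
Proof. exact: bmult_conj. Qed.

Lemma Mul_conjTK (phi : C -> C) u : Mul (fun z => (conjT phi z)^*%C) u = Mul phi u.
Proof. by congr (Mul _ u); apply/funext => z; rewrite /conjT conjcK. Qed.

Lemma ip_Mul_ge0 psi u : bmult psi -> (forall t, 0 <= psi (circ t)) -> 0 <= ip (Mul psi u) u.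
Proof.
move=> hb h; rewrite ip_MulE//; apply: Re_intT_ge0 => t.
by rewrite mulr_ge0// mulcJ_ge0.
Qed.

Lemma ip_Mul_r psi u v : bmult psi -> ip u (Mul psi v) = ip (Mul (fun z => (psi z)^*%C) u) v.
Proof. by move=> hb; rewrite -ipC ip_Mul// ipC. Qed.

Lemma ip_MulMul phi u : bmult phi ->
  ip (Mul (fun z => phi z * (phi z)^*%C) u) u = (lnrm (Mul phi u) ^+ 2)%:C.
Proof.
move=> hb; have hc := bmult_conj hb.
rewrite -ipE ip_Mul_r// Mul_Mul//; congr (ip _ u); apply: eq_Mul; try exact: bmult_mul.
by move=> t; rewrite mulrC.
Qed.

(** Pointwise inequalities between moduli of multipliers integrate; the multipliers
    of interest are [1], [conjT b] and [a]. *)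
Lemma nrm_Mul_quad (phi : 'I_3 -> C -> C) (k : 'I_3 -> R) u : (forall i, bmult (phi i)) ->
  (forall t, 0 <= \sum_(i < 3) k i * nm (phi i (circ t)) ^+ 2) ->
  0 <= \sum_(i < 3) k i * lnrm (Mul (phi i) u) ^+ 2.
Proof.
move=> hb h.
have hq i : bmult (fun z => (k i)%:C * (phi i z * (phi i z)^*%C)).
  by apply: bmult_mul; [exact: bmult_cst|apply: bmult_mul => //; exact: bmult_conj].
pose psi z := (k ord0)%:C * (phi ord0 z * (phi ord0 z)^*%C) +
   ((k (lift ord0 ord0))%:C * (phi (lift ord0 ord0) z * (phi (lift ord0 ord0) z)^*%C) +
   (k (lift ord0 (lift ord0 ord0)))%:C * (phi (lift ord0 (lift ord0 ord0)) z * (phi (lift ord0 (lift ord0 ord0)) z)^*%C)).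
have e i : ip (Mul (fun z => (k i)%:C * (phi i z * (phi i z)^*%C)) u) u = (k i * lnrm (Mul (phi i) u) ^+ 2)%:C.
  rewrite -Mul_Mul; [|exact: bmult_cst|by apply: bmult_mul => //; exact: bmult_conj].
  by rewrite Mul_cst ipZl ip_MulMul// cM.
have : 0 <= ip (Mul psi u) u.
  apply: ip_Mul_ge0; first by do 2?[apply: bmult_add => //].
  move=> t; have := h t; rewrite !big_ord_recl big_ord0 addr0 -ler0c.
  by rewrite /psi !nm_mulJ -!cM -!cD.
rewrite /psi Mul_add ?Mul_add//; last by apply: bmult_add.
by rewrite !ipDl !e -!cD ler0c !big_ord_recl big_ord0 addr0.
Qed.

(** ** Square roots: operators satisfying the specification of [sqrt_op] *)

Section SquareRootOperator.
Variables (S : (C -> C) -> C -> C) (X : L -> L).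
Hypothesis Xlin : forall c u v, X (c *: u + v) = c *: X u + X v.
Hypothesis Xsa : forall u v, ip (X u) v = ip u (X v).
Hypothesis Xle : forall u, lnrm (X u) <= lnrm u.
Hypothesis XHH : forall u, HH u -> HH (X u).
Hypothesis SX : lifts S (fun u => u - X u).

(** [sqrt_op] selects some operator that satisfies its specification; one exists by
    [lsqrt_exists].  Everything here is derived from the specification:
    independence of representatives from boundedness and linearity,
    self-adjointness from positivity by polarization. *)
Lemma sqrt_opP : exists A0 : L -> L,
  [/\ lifts (sqrt_op S) A0,
      forall c u v, HH u -> HH v -> A0 (c *: u + v) = c *: A0 u + A0 v,
      forall u v, HH u -> HH v -> ip (A0 u) v = ip u (A0 v) &
      forall u, HH u -> (lnrm (A0 u) ^+ 2)%:C = ip (u - X u) u].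
Proof.
have [A1 [A1lin A1le A1ge0 A1sq A1W]] := lsqrt_exists Xlin Xsa Xle.
have A1H u : HH u -> HH (A1 u) by apply: A1W => //; [exact: HH_subspace|exact: HH_closed].
rewrite /sqrt_op; set Q := (Z in xget _ Z).
have : Q (xget (fun f => f) Q).
  apply: xgetPex; exists (fun f => rep (A1 (cls f))).
  have r2 u : HH u -> H2 (rep (A1 u)) by move=> hu; exact/H2_rep/A1H.
  split; first split.
  - split.
    + by move=> f /H2_cls /r2.
    + move=> c f g hf hg; have hf' := H2_L2 hf; have hg' := H2_L2 hg.
      apply/cls_eq; [exact: rep_L2|by apply: L2T_lin; exact: rep_L2|].
      by rewrite repK (cls_lin c)//; [rewrite A1lin cls_lin ?repK//; exact: rep_L2].
    + exists 2 => f hf; rewrite -!nrm_cls ?repK; [exact: A1le|exact: H2_L2|exact: rep_L2].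
  - move=> f hf; have hf' := H2_L2 hf; rewrite -ip_cls ?repK//; exact: rep_L2.
  - move=> f hf; have [h1 h2] := SX hf; apply/cls_eq; [exact: rep_L2|exact: H2_L2|].
    by rewrite !repK A1sq h2.
move: (xget _ Q) => A [[[AH Alin [K AK]] Apos] Asq].
pose A0 u := cls (A (rep u)).
have n0 f : H2 f -> cls f = 0 -> cls (A f) = 0.
  move=> hf f0; apply: lnrm_eq0; apply/eqP; rewrite eq_le lnrm_ge0 andbT.
  have := AK f hf; rewrite -nrm_cls; last exact: H2_L2 (AH _ hf).
  by rewrite -nrm_cls ?f0 ?lnrm0 ?mulr0//; exact: H2_L2.
have H2lin c f g : H2 f -> H2 g -> H2 (c \*o f \+ g).
  move=> hf hg; apply/H2P; have hf' := H2_L2 hf; have hg' := H2_L2 hg.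
  split; first exact: L2T_lin.
  rewrite (_ : cls _ = c *: cls f + cls g); last exact: cls_lin.
  by apply: HH_add; [apply: HH_scale|]; exact: H2_cls.
have Acls c f g : H2 f -> H2 g -> cls (A (c \*o f \+ g)) = c *: cls (A f) + cls (A g).
  move=> hf hg; rewrite -cls_lin; try exact/H2_L2/AH.
  apply/cls_eq; [by apply/H2_L2/AH; exact: H2lin|by apply: L2T_lin; exact/H2_L2/AH|exact: Alin].
have Aext f g : H2 f -> H2 g -> cls f = cls g -> cls (A f) = cls (A g).
  move=> hf hg E; apply/eqP; rewrite -subr_eq0; apply/eqP.
  rewrite addrC -scaleN1r -Acls// n0//; first exact: H2lin.
  rewrite (_ : cls _ = (-1) *: cls g + cls f); last by apply: cls_lin; exact: H2_L2.
  by rewrite E scaleN1r addNr.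
have AA0 : lifts A A0.
  move=> f hf; split; first exact: AH.
  by rewrite /A0; apply: Aext => //; [exact/H2_rep/H2_cls|rewrite repK].
have A0H u : HH u -> HH (A0 u) by move=> /H2_rep/AH/H2_cls.
have A0lin c u v : HH u -> HH v -> A0 (c *: u + v) = c *: A0 u + A0 v.
  move=> hu hv; rewrite /A0 -Acls; try exact: H2_rep.
  apply: Aext; [by apply: H2_rep; apply: HH_add => //; exact: HH_scale|by apply: H2lin; exact: H2_rep|].
  rewrite repK; transitivity (cls (fun z => c * rep u z + rep v z)) => //.
  by rewrite cls_lin ?repK//; exact: rep_L2.
have A0pos u : HH u -> 0 <= ip (A0 u) u.
  move=> hu; have := Apos _ (H2_rep hu); rewrite -ip_cls ?repK//; [|exact: rep_L2].
  exact/H2_L2/AH/H2_rep.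
have A0D u v : HH u -> HH v -> A0 (u + v) = A0 u + A0 v.
  by move=> hu hv; have := A0lin 1 u v hu hv; rewrite !scale1r.
have A0Z c u : HH u -> A0 (c *: u) = c *: A0 u.
  move=> hu; have h0 : A0 0 = 0.
    have := A0lin (-1) u u hu hu; rewrite !scaleN1r addNr => ->; exact: addNr.
  by have := A0lin c u 0 hu HH_subspace.1; rewrite h0 !addr0.
(* polarization: the form is real on u + v and on u + i v *)
have A0sa u v : HH u -> HH v -> ip (A0 u) v = ip u (A0 v).
  move=> hu hv.
  have im w : HH w -> Im (ip (A0 w) w) = 0 by move=> /A0pos/ger0_Im.
  have e1 := im _ (HH_add hu hv); have hiv : HH ('i%C *: v) by exact: HH_scale.
  have e2 := im _ (HH_add hu hiv).
  rewrite A0D// ipDl !ipDr !ImD !im// in e1.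
  rewrite A0D// A0Z// ipDl !ipDr !ipZl !ipZr !ImD !im// in e2.
  rewrite -[in RHS]ipC; apply: cplxP; rewrite ?ReJ ?ImJ; last by move: e1; lra.
  move: e2; rewrite !ImM ?ImM /= !ReM /= (im v)//; lra.
exists A0; split=> // u hu; rewrite -ipE -A0sa//; last exact: A0H.
congr (ip _ u); have hr := H2_rep hu.
have [h1 h2] := SX hr; rewrite repK in h2; rewrite -h2.
rewrite /A0; transitivity (cls (A (A (rep u)))).
  by apply: Aext; [by apply/H2_rep/A0H|exact: AH|rewrite repK].
by apply: cls_H2_eq => //; [exact/AH/AH|exact: Asq].
Qed.

End SquareRootOperator.

(** ** The range of the square root, by Douglas' lemma *)

(** Douglas' lemma both ways for the pair [A0], [T_phi] on [HH], the adjoints being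
    [A0] and the Toeplitz operator with the conjugate symbol. *)
Lemma douglas_selfadjoint (A0 : L -> L) phi (K : R) : bmult phi -> 0 <= K ->
  (forall u, HH u -> HH (Mul phi u)) -> (forall u, HH u -> HH (A0 u)) ->
  (forall c u v, HH u -> HH v -> A0 (c *: u + v) = c *: A0 u + A0 v) ->
  (forall u v, HH u -> HH v -> ip (A0 u) v = ip u (A0 v)) ->
  ((forall u, HH u -> lnrm (A0 u) <= K * lnrm (Mul phi u)) ->
    forall g : L, HH g -> exists h, [/\ HH h, Top (conjT phi) h = A0 g & lnrm h <= K * lnrm g]) /\
  ((forall u, HH u -> lnrm (Mul phi u) <= K * lnrm (A0 u)) ->
    forall g : L, HH g -> exists h, [/\ HH h, A0 h = Top (conjT phi) g & lnrm h <= K * lnrm g]).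
Proof.
move=> hb K0 pH AH Alin Asa; have hc := bmult_conjT hb.
have pT u v : HH u -> ip (Top (conjT phi) v) u = ip v (Mul phi u).
  by move=> hu; rewrite ip_Top// Mul_conjTK.
have uniq v w : HH v -> HH w -> (forall u, HH u -> ip u v = ip u w) -> v = w.
  move=> hv hw h; apply/eqP; rewrite -subr_eq0; apply/eqP; apply: ip_eq0.
  by rewrite ipBr h ?subrr//; exact: HH_sub.
have clos (B : L -> L) h : (forall u, HH u -> HH (B u)) ->
    (forall e : R, 0 < e -> exists2 w, (B @` HH) w & lnrm (h - w) < e) -> HH h.
  move=> BH hh; apply: HH_closed => e e0; have [_ [w hw <-] hd] := hh e e0.
  by exists (B w) => //; exact: BH.
split=> le g hg.
- have [||h [h1 h2 h3]] := ldouglas (A := A0) (B := Mul phi) g HH_subspace K0 _ _ le.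
  + exact: Alin.
  + by move=> c u v _ _; exact: Mul_lin.
  have hh := clos _ _ pH h1; exists h; split => //.
  apply: uniq; [exact: PH_HH|exact: AH|move=> u hu].
  by rewrite -Asa// h3// -[RHS]ipC -pT// ipC.
- have [||h [h1 h2 h3]] := ldouglas (A := Mul phi) (B := A0) g HH_subspace K0 _ _ le.
  + by move=> c u v _ _; exact: Mul_lin.
  + exact: Alin.
  have hh := clos _ _ AH h1; exists h; split => //.
  apply: uniq; [exact: AH|exact: PH_HH|move=> u hu].
  by rewrite -Asa// -h3// -[LHS]ipC -pT// ipC.
Qed.

End Operators.
(** * The space H(b) as the range of a co-analytic Toeplitz operator *)

Section RationalModel.
Context {R : realType}.
Local Notation C := R[i].
Local Notation circ := (@circ R).
Local Notation L := (@L2m R).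
Local Notation ip := (@ip R).
Local Notation lnrm := (nrm ip).
Local Notation HH := (@HH R).
Implicit Types (f g : C -> C) (u v w : L) (p q : {poly C}).

Lemma PH_sa u v : ip (PH u) v = ip u (PH v).
Proof.
rewrite -[RHS]PH_ip; last exact: PH_HH.
by rewrite -ipC -PH_ip ?ipC; last exact: PH_HH.
Qed.

Section Operator.
Variables (b a : C -> C) (c1 c2 : R) (h : {poly C}) (g0 : C -> C).
Hypotheses (hb : bmult b) (ha : bmult a) (hg0 : bmult g0).
Hypothesis b1 : forall t, nm (b (circ t)) <= 1.
Hypotheses (c10 : 0 < c1) (c20 : 0 <= c2).
Hypothesis ab_le : forall t, c1 * nm (a (circ t)) ^+ 2 <= 1 - nm (b (circ t)) ^+ 2.
Hypothesis ab_ge : forall t, 1 - nm (b (circ t)) ^+ 2 <= c2 * nm (a (circ t)) ^+ 2.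
Hypothesis b_split : forall t, (b (circ t))^*%C = h.[circ t] + g0 (circ t) * a (circ t).
Hypothesis aHH : forall u, HH u -> HH (Mul a u).

Definition TbTb u : L := Top b (Top (conjT b) (PH u)).

Lemma Hb_lifts : lifts (fun f => f \- toeplitz b (toeplitz (conjT b) f)) (fun u => u - TbTb u).
Proof.
move=> f hf; have hf' := H2_L2 hf.
have [h1 h2] := toeplitz_lifts (bmult_conjT hb) hf.
have [h3 h4] := toeplitz_lifts hb h1.
have e : cls (f \- toeplitz b (toeplitz (conjT b) f)) = cls f - TbTb (cls f).
  rewrite (_ : cls _ = cls f - cls (toeplitz b (toeplitz (conjT b) f))); last first.
    by apply: cls_sub => //; exact: H2_L2.
  by rewrite h4 h2 /TbTb PH_id//; exact: H2_cls.
split=> //; apply/H2P; split.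
  by apply: L2T_sub => //; exact: H2_L2.
by rewrite e; apply: HH_sub; [exact: H2_cls|exact: PH_HH].
Qed.

Lemma nrm_conj_b u : lnrm (Mul (conjT b) u) <= lnrm u.
Proof.
by rewrite -[leRHS]mul1r; apply: nrm_Mul; [exact: bmult_conjT|move=> t; rewrite /conjT nmJ].
Qed.
Lemma nrm_b u : lnrm (Mul b u) <= lnrm u.
Proof. by rewrite -[leRHS]mul1r; exact: nrm_Mul. Qed.

(** The Hankel part only sees [Mul a u], as the polynomial part of the conjugate
    of [b] maps [HH] into itself. *)
Lemma hankel_bound : exists2 G : R, 0 <= G & forall u, HH u ->
  lnrm (Mul (conjT b) u - PH (Mul (conjT b) u)) <= G * lnrm (Mul a u).
Proof.
have [mg [G hG]] := hg0; have G0 : 0 <= G := le_trans (nm_ge0 _) (hG 0).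
exists G => // u hu.
have hbp : bmult (fun z => h.[z]) := bmult_poly h.
have e : Mul (conjT b) u = Mul (fun z => h.[z]) u + Mul g0 (Mul a u).
  rewrite (Mul_Mul u hg0 ha) -Mul_add//; last exact: bmult_mul.
  by apply: eq_Mul; [exact: bmult_conjT|by apply: bmult_add => //; exact: bmult_mul|].
have hh : HH (Mul (fun z => h.[z]) u) by exact: Mul_poly_HH.
set x := Mul g0 (Mul a u) in e.
have -> : Mul (conjT b) u - PH (Mul (conjT b) u) = x - PH x.
  have := PH_lin 1 (Mul (fun z => h.[z]) u) x; rewrite !scale1r -e => ->.
  by rewrite PH_id// e opprD addrACA subrr add0r.
apply: (@le_trans _ _ (lnrm x)); last exact: nrm_Mul.
rewrite -(@ler_pXn2r _ 2) ?nnegrE ?lnrm_ge0// [leRHS]PH_nrm2.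
by rewrite lerDr sqr_ge0.
Qed.

(** The quadratic form of [I - T_b T_(conj b)]: [T_(conj b) u] is the part of
    [b^* u] in [HH]. *)
Lemma defect_form u : HH u -> Re (ip (u - TbTb u) u) =
  lnrm u ^+ 2 - lnrm (Mul (conjT b) u) ^+ 2 + lnrm (Mul (conjT b) u - PH (Mul (conjT b) u)) ^+ 2.
Proof.
move=> hu; rewrite ipBl ReD ReN.
have -> : ip (TbTb u) u = (lnrm (PH (Mul (conjT b) u)) ^+ 2)%:C.
  rewrite /TbTb PH_id// ip_Top// -ipE -[RHS]PH_sa (PH_id (PH_HH _)) //.
by rewrite ipE /= [in RHS](PH_nrm2 (Mul (conjT b) u)); ring.
Qed.

(** With [A0 = (I - T_b T_(conj b))^(1/2)], the form [|A0 u| ^ 2] lies between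
    multiples of [|a u| ^ 2]; Douglas' lemma compares the ranges of [A0] and of
    [T_(conj a)]. *)
Theorem Hb_operator : exists A0 : L -> L, exists K K' : R,
  [/\ lifts (Hb_op b) A0, 0 < K, 0 < K',
     forall v, HH v -> exists w, [/\ HH w, Top (conjT a) w = A0 v & lnrm w <= K * lnrm v] &
     forall v, HH v -> exists w, [/\ HH w, A0 w = Top (conjT a) v & lnrm w <= K' * lnrm v]].
Proof.
have TH u : HH (TbTb u) by exact: PH_HH.
have Tlin c u v : TbTb (c *: u + v) = c *: TbTb u + TbTb v.
  by rewrite /TbTb PH_lin !Top_lin//; exact: bmult_conjT.
have Tsa u v : ip (TbTb u) v = ip u (TbTb v).
  have e w x : ip (TbTb w) x = ip (Top (conjT b) (PH w)) (Top (conjT b) (PH x)).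
    rewrite -[LHS]/(ip (PH (Mul b (Top (conjT b) (PH w)))) x) PH_sa ip_Mul//.
    rewrite -[RHS]/(ip (Top (conjT b) (PH w)) (PH (Mul (conjT b) (PH x)))).
    by rewrite -[RHS]PH_sa (PH_id (PH_HH _)).
  by rewrite e -[RHS]ipC e ipC.
have Tle u : lnrm (TbTb u) <= lnrm u.
  apply: le_trans (PH_le _) _; apply: le_trans (nrm_b _) _.
  by apply: le_trans (PH_le _) _; apply: le_trans (nrm_conj_b _) _; exact: PH_le.
have [A0 [A0l A0lin A0sa A0sq]] := sqrt_opP Tlin Tsa Tle (fun u _ => TH u) Hb_lifts.
have [G G0 hG] := hankel_bound.
have sq u : HH u -> lnrm (A0 u) ^+ 2 = lnrm u ^+ 2 - lnrm (Mul (conjT b) u) ^+ 2 +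
    lnrm (Mul (conjT b) u - PH (Mul (conjT b) u)) ^+ 2.
  by move=> hu; rewrite -defect_form// -A0sq.
(* the three pointwise inequalities are integrated at once *)
pose phi (i : 'I_3) := nth (fun=> 0) [:: (fun=> 1); conjT b; a] i.
have hphi i : bmult (phi i).
  case: i => [[|[|[|//]]]] ? /=; rewrite /phi /=; [exact: bmult_cst|exact: bmult_conjT|exact: ha].
have quad (k : 'I_3 -> R) u : (forall t, 0 <= k ord0 + (k (lift ord0 ord0) * nm (b (circ t)) ^+ 2 +
      k (lift ord0 (lift ord0 ord0)) * nm (a (circ t)) ^+ 2)) ->
    0 <= k ord0 * lnrm u ^+ 2 + (k (lift ord0 ord0) * lnrm (Mul (conjT b) u) ^+ 2 +
      k (lift ord0 (lift ord0 ord0)) * lnrm (Mul a u) ^+ 2).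
  move=> hk; have := @nrm_Mul_quad R phi k u hphi.
  rewrite !big_ord_recl big_ord0 addr0 /phi /= Mul1; apply=> t.
  rewrite !big_ord_recl big_ord0 addr0; apply: le_trans (hk t) _.
  rewrite le_eqVlt; apply/orP; left; apply/eqP; congr (_ + (_ + _)).
  - by transitivity (k ord0 * nm (1 : C) ^+ 2); [rewrite nm1 expr1n mulr1|].
  - by transitivity (k (lift ord0 ord0) * nm ((b (circ t))^*%C) ^+ 2); [rewrite nmJ|].
have lo u : HH u -> lnrm (Mul a u) <= (c1^-1 + 1) * lnrm (A0 u).
  move=> hu; rewrite -(@ler_pXn2r _ 2) ?nnegrE ?mulr_ge0 ?addr_ge0 ?invr_ge0 ?lnrm_ge0 ?(ltW c10)//.
  rewrite exprMn sq//.
  have q1 := quad (fun i => nth 0 [:: 1; -1; - c1] i) u _; rewrite /= in q1.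
  have {}q1 := q1 (fun t => ltac:(have := ab_le t; lra)).
  have ci : 0 < c1^-1 by rewrite invr_gt0.
  have cc : c1^-1 * c1 = 1 by rewrite mulVf// lt0r_neq0.
  set X := lnrm u ^+ 2 - _ in q1 *; set Y := lnrm (_ - PH _) ^+ 2.
  have Y0 : 0 <= Y by rewrite sqr_ge0.
  have q2 : c1 * lnrm (Mul a u) ^+ 2 <= X by rewrite /X; lra.
  have q3 : lnrm (Mul a u) ^+ 2 <= c1^-1 * X by rewrite mulrC ler_pdivlMr// mulrC.
  have X0 : 0 <= X by apply: le_trans q2; rewrite mulr_ge0 ?sqr_ge0// ltW.
  apply: le_trans q3 _; have -> : (c1^-1 + 1) ^+ 2 = c1^-1 + (c1^-1 * c1^-1 + c1^-1 + 1) by ring.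
  clearbody X Y; move: c1^-1 ci X0 Y0 => d d0 X0 Y0.
  have h1 : 0 <= (d * d + d + 1) * (X + Y).
    by apply: mulr_ge0; [have := mulr_ge0 (ltW d0) (ltW d0); lra|exact: addr_ge0].
  have h2 : 0 <= d * Y by rewrite mulr_ge0// ltW.
  lra.
have hi u : HH u -> lnrm (A0 u) <= (c2 + G + 1) * lnrm (Mul a u).
  move=> hu; rewrite -(@ler_pXn2r _ 2) ?nnegrE ?mulr_ge0 ?addr_ge0 ?lnrm_ge0//.
  rewrite exprMn sq//.
  have q1 := quad (fun i => nth 0 [:: -1; 1; c2] i) u _; rewrite /= in q1.
  have {}q1 := q1 (fun t => ltac:(have := ab_ge t; lra)).
  have q2 : lnrm (Mul (conjT b) u - PH (Mul (conjT b) u)) ^+ 2 <= G ^+ 2 * lnrm (Mul a u) ^+ 2.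
    by rewrite -exprMn ler_pXn2r ?nnegrE ?mulr_ge0 ?lnrm_ge0// hG.
  have : (c2 + G ^+ 2) * lnrm (Mul a u) ^+ 2 <= (c2 + G + 1) ^+ 2 * lnrm (Mul a u) ^+ 2.
    rewrite ler_wpM2r ?sqr_ge0//; have := mulr_ge0 c20 G0; have := sqr_ge0 c2; nra.
  by rewrite mulrDl; lra.
have Ap : 0 < c2 + G + 1 by rewrite ltr_wpDl// addr_ge0.
have Bp : 0 < c1^-1 + 1 by rewrite ltr_wpDl// invr_ge0 ltW.
exists A0, (c2 + G + 1), (c1^-1 + 1); split=> //.
- have [hd _] := douglas_selfadjoint ha (ltW Ap) aHH (fun u hu => lifts_HH A0l hu) A0lin A0sa.
  exact: hd hi.
- have [_ hd] := douglas_selfadjoint ha (ltW Bp) aHH (fun u hu => lifts_HH A0l hu) A0lin A0sa.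
  exact: hd lo.
Qed.

End Operator.

(** ** Multiplication by polynomials *)

Local Notation MP p := (Mul (fun z => p.[z])).
Let hp := @bmult_poly R.

Lemma MP_mul p q u : MP p (MP q u) = MP (p * q) u.
Proof.
rewrite Mul_Mul//; apply: eq_Mul => //; first exact: bmult_mul.
by move=> t; rewrite hornerM.
Qed.
Lemma MP_add p q u : MP (p + q) u = MP p u + MP q u.
Proof. by rewrite -Mul_add//; congr (Mul _ u); apply/funext => z; rewrite hornerD. Qed.
Lemma MP_C c u : MP c%:P u = c *: u.
Proof. by rewrite -Mul_cst; congr (Mul _ u); apply/funext => z; rewrite hornerC. Qed.
Lemma MP_X u : MP 'X u = Mul (fun z => z) u.
Proof. by congr (Mul _ u); apply/funext => z; rewrite hornerX. Qed.
Lemma polyL0 : polyL 0 = 0 :> L.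
Proof. by rewrite /polyL; under eq_fun do rewrite horner0; exact: cls0. Qed.
Lemma polyLD p q : polyL (p + q) = polyL p + polyL q :> L.
Proof. by have := polyL_lin 1 p q; rewrite !scale1r. Qed.
Lemma polyLZ c p : polyL (c *: p) = c *: polyL p :> L.
Proof. by have := polyL_lin c p 0; rewrite polyL0 !addr0. Qed.
Lemma polyLN p : polyL (- p) = - polyL p :> L.
Proof. by have := polyLZ (-1) p; rewrite !scaleN1r. Qed.
Lemma MP_scale c p u : MP (c *: p) u = c *: MP p u.
Proof. by rewrite -mul_polyC -MP_mul MP_C. Qed.

(** ** The range of a co-analytic Toeplitz operator *)

(** Dually: an analytic multiplier maps [HH] into itself, so its adjoint maps the
    orthogonal complement of [HH] into itself. *)
Lemma Top_conj_PH phi u : bmult phi -> (forall v, HH v -> HH (Mul phi v)) ->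
  Top (conjT phi) (PH u) = Top (conjT phi) u.
Proof.
move=> hf fH; apply/esym/PH_unique; first exact: PH_HH.
move=> w hw; have hc := bmult_conjT hf.
by rewrite ip_Top// Mul_conjTK PH_ip ?ip_Mul ?Mul_conjTK//; exact: fH.
Qed.

Lemma ip_zbar u n : HH u -> ip u (cls (fun z => (z^*%C) ^+ n.+1)) = 0.
Proof. exact. Qed.

(** [z T_(conj z) u] is [u] minus its mean. *)
Lemma backward_shift u : HH u -> exists c, Mul (fun z => z) (Top (fun z => z^*%C) u) = u - polyL c%:P.
Proof.
move=> hu; have bi := @bmult_id R; have bc : bmult (fun z : C => z^*%C) := bmult_conj bi.
have bJ n : bmult (fun z : C => (z^*%C) ^+ n) by apply: bmult_exp.
pose c := ip u (polyL 1); exists c.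
have p1 (d : C) : polyL d%:P = d *: polyL 1 by rewrite -[d%:P]mulr1 -Mul_polyL MP_C.
have one : ip (polyL 1) (polyL (1 : {poly C})) = 1.
  rewrite ip_cls; try by apply: bmult_L2T.
  by rewrite -[RHS]intT_cst; apply: eq_intT => t /=; rewrite /conjT hornerC conj1 mulr1.
have zJ w : Mul (fun z => z) (Mul (fun z => z^*%C) w) = w.
  rewrite Mul_Mul// -[RHS]Mul1; apply: eq_Mul; [exact: bmult_mul|exact: bmult_cst|].
  by move=> t; rewrite circ_mulJ.
rewrite -[RHS]zJ; congr (Mul _ _); apply: PH_unique.
  move=> n; rewrite ip_Mul// Mul_cls; [|exact: bmult_conj|exact: bmult_L2T].
  have -> : cls (fun z : C => (z^*%C)^*%C * z^*%C ^+ n.+1) = cls (fun z : C => z^*%C ^+ n).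
    apply/cls_eq; [by apply: bmult_L2; [exact: bmult_conj|exact: bmult_L2T]|exact: bmult_L2T|].
    by apply: ae_eqT_pt => t; rewrite conjcK exprS mulrA circ_mulJ mul1r.
  case: n => [|n]; last by rewrite ip_zbar//; apply: HH_sub => //; exact: HH_polyL.
  have -> : cls (fun z : C => z^*%C ^+ 0) = polyL 1.
    by congr cls; apply/funext => z; rewrite expr0 hornerC.
  by rewrite ipBl (p1 c) ipZl one mulr1 subrr.
move=> w hw; rewrite MulB// ipBl [X in _ - X](_ : _ = 0) ?subr0//.
rewrite (p1 c) MulZ// ipZl -ipC [X in X^*%C](_ : _ = 0) ?conj0 ?mulr0//.
rewrite Mul_cls//; last exact: bmult_L2T.
rewrite -[RHS](ip_zbar 0 hw); congr (ip _ (cls _)); apply/funext => z.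
by rewrite hornerC mulr1 expr1.
Qed.

Lemma backward_shifts m u : HH u -> exists r,
  MP 'X^m (Top (fun z => (z^*%C) ^+ m) u) = u - polyL r.
Proof.
have bi := @bmult_id R; have bc : bmult (fun z : C => z^*%C) := bmult_conj bi.
have bJ n : bmult (fun z : C => (z^*%C) ^+ n) by apply: bmult_exp.
elim: m u => [|m IH] u hu.
  exists 0; rewrite polyL0.
  rewrite (_ : ('X^0 : {poly C}) = 1%:P); last by rewrite expr0.
  rewrite MP_C scale1r subr0 /Top.
  have -> : Mul (fun z => z^*%C ^+ 0) u = u by rewrite -[RHS]Mul1; congr (Mul _ u).
  exact: PH_id.
have [c hc] := backward_shift hu.
have [r hr] := IH _ (PH_HH (Mul (fun z => z^*%C) u)).
exists (c%:P + 'X * r).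
have e : Top (fun z => z^*%C ^+ m) (PH (Mul (fun z => z^*%C) u)) = Top (fun z => z^*%C ^+ m.+1) u.
  have := @Top_conj_PH (fun z => ('X^m).[z]) (Mul (fun z => z^*%C) u) (hp _).
  have -> : conjT (fun z : C => ('X^m).[z]) = (fun z : C => z^*%C ^+ m).
    by apply/funext => z; rewrite /conjT hornerXn conjX.
  move=> ->; last by move=> v; exact: Mul_poly_HH.
  rewrite /Top Mul_Mul//; congr (PH (Mul _ u)); apply/funext => z.
  by rewrite exprSr.
rewrite -e exprS -MP_mul hr MulB// MP_X -/(Top (fun z => z^*%C) u) hc Mul_polyL.
by rewrite polyLD -addrA -opprD.
Qed.

Section CircleZeros.
Variable lams : seq C.
Hypothesis lam1 : forall x, x \in lams -> nm x = 1.
Let m := size lams.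

Definition apoly : {poly C} := (2 ^+ m)^-1 *: \prod_(x <- lams) ('X - x%:P).
Local Notation a := (fun z => apoly.[z]).

(** For unimodular [x] and [z], [z - x = - x (z - x)^* z]. *)
Lemma prod_reflect (s : seq C) : (forall x, x \in s -> nm x = 1) ->
  exists2 k, nm k = 1 & forall t, (\prod_(x <- s) ('X - x%:P)).[circ t] =
    k * ((\prod_(x <- s) ('X - x%:P)).[circ t])^*%C * circ t ^+ size s.
Proof.
elim: s => [|x s IH] hs.
  by exists 1; [exact: nm1|move=> t; rewrite big_nil hornerC conj1 expr0 !mulr1].
have [|k k1 hk] := IH; first by move=> y ys; apply: hs; rewrite inE ys orbT.
have x1 : nm x = 1 by apply: hs; rewrite inE eqxx.
exists (- x * k) => [|t]; first by rewrite nmM nmN x1 k1 mulr1.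
rewrite big_cons hornerM [in LHS]hk hornerXsubC conjM exprS conjD conjN.
have xx : x * x^*%C = 1 by rewrite nm_mulJ x1 expr1n.
have := circ_mulJ t; move: (circ t) => z zz.
have -> : z - x = - x * (z^*%C - x^*%C) * z.
  have -> : - x * (z^*%C - x^*%C) * z = x * x^*%C * z - x * (z * z^*%C) by ring.
  by rewrite xx zz mul1r mulr1.
ring.
Qed.

Lemma apoly_reflect : exists2 k, nm k = 1 & forall t,
  a (circ t) = k * (a (circ t))^*%C * circ t ^+ m.
Proof.
have [k k1 hk] := prod_reflect lam1; exists k => // t.
rewrite /apoly !hornerZ {1}hk conjM.
have -> : ((2 ^+ m)^-1 : C)^*%C = (2 ^+ m)^-1 by rewrite conjV conjX conjc_nat.
by ring.
Qed.

Lemma apoly_neq0 : apoly != 0.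
Proof.
rewrite scaler_eq0 negb_or invr_eq0 expf_neq0 ?pnatr_eq0//=.
by rewrite monic_neq0// monic_prod_XsubC.
Qed.

Lemma apoly_coprimeX : exists U V : {poly C}, U * 'X^m + V * apoly = 1.
Proof.
suff : coprimep 'X^m apoly by move=> /Bezout_eq1_coprimepP [[U V]] /= e; exists U, V.
rewrite coprimep_expl// -['X]subr0 -polyC0 coprimep_sym coprimep_XsubC.
rewrite /root /apoly hornerZ; apply: mulf_neq0.
  by rewrite invr_neq0// expf_neq0// pnatr_eq0.
rewrite horner_prod prodf_seq_neq0; apply/allP => x xs /=.
rewrite hornerXsubC sub0r oppr_eq0; apply/eqP => x0.
by have := lam1 xs; rewrite x0 nm0 => /eqP; rewrite eq_sym oner_eq0.
Qed.

Lemma bmult_apoly : bmult a. Proof. exact: hp. Qed.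
Lemma Mul_a_HH u : HH u -> HH (Mul a u). Proof. exact: Mul_poly_HH. Qed.

(** [a = k conj(a) z ^ m] on the circle, so [a u = T_(conj a) (k z ^ m u)]. *)
Lemma Mul_a_range u : HH u -> exists v, [/\ HH v, Top (conjT a) v = Mul a u & lnrm v <= lnrm u].
Proof.
move=> hu; have [k k1 hk] := apoly_reflect.
exists (MP (k *: 'X^m) u); split; first exact: Mul_poly_HH.
- rewrite /Top Mul_Mul//; last exact: (bmult_conjT bmult_apoly).
  rewrite -[RHS]PH_id; last exact: Mul_a_HH.
  congr PH; apply: eq_Mul; [by apply: bmult_mul; [exact: (bmult_conjT bmult_apoly)|exact: hp]|exact: bmult_apoly|].
  by move=> t; rewrite [RHS]hk hornerZ hornerXn /conjT; ring.
- rewrite -[leRHS]mul1r; apply: nrm_Mul => // t.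
  by rewrite hornerZ hornerXn nmM nmX nm_circ expr1n k1 mulr1.
Qed.

(** On the circle [conj a] is a constant times [z ^ (- m) a].  Applying
    [T_(conj z) ^ m] to [a u] and multiplying back by [z ^ m] only removes a
    polynomial from [a u]; so [z ^ m w] has the required form for
    [w = T_(conj a) u], trivially [a w] has it too, and [z ^ m] and [a] are
    coprime. *)
Lemma range_decomp u : HH u -> exists p, exists2 v, HH v & Top (conjT a) u = polyL p + Mul a v.
Proof.
move=> hu; have [k k1 hk] := apoly_reflect; have [U [V UV]] := apoly_coprimeX.
have k0 : k != 0 by apply/eqP => k0; move: k1; rewrite k0 nm0 => /eqP; rewrite eq_sym oner_eq0.
have bJ : bmult (fun z : C => (z^*%C) ^+ m) by apply: bmult_exp; exact: (bmult_conj (@bmult_id R)).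
set w := Top (conjT a) u; have hw : HH w by exact: PH_HH.
have e : w = k^-1 *: Top (fun z => z^*%C ^+ m) (Mul a u).
  rewrite /Top Mul_Mul//.
  have := PH_lin k^-1 (Mul (fun z => z^*%C ^+ m * a z) u) 0.
  rewrite (PH_id HH_subspace.1) !addr0.
  move=> <-; congr PH; rewrite -Mul_cst Mul_Mul; [|exact: bmult_cst|exact: bmult_mul].
  apply: eq_Mul; [exact: (bmult_conjT bmult_apoly)|by apply: bmult_mul; [exact: bmult_cst|exact: bmult_mul]|].
  move=> t; rewrite [in RHS]hk /conjT.
  have zz : (circ t)^*%C ^+ m * circ t ^+ m = 1 by rewrite -exprMn mulrC circ_mulJ expr1n.
  transitivity (k^-1 * k * ((circ t)^*%C ^+ m * circ t ^+ m) * (apoly.[circ t])^*%C); last by ring.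
  by rewrite zz mulVf// !mul1r.
have [r hr] := @backward_shifts m _ (Mul_a_HH hu).
have zw : MP 'X^m w = k^-1 *: (Mul a u - polyL r) by rewrite e MulZ// hr.
exists (- (k^-1 *: (U * r))), (MP U (k^-1 *: u) + MP V w).
  by apply: HH_add; apply: Mul_poly_HH => //; exact: HH_scale.
transitivity (MP U (MP 'X^m w) + MP V (MP apoly w)).
  by rewrite !MP_mul -MP_add UV MP_C scale1r.
have e1 : MP U (k^-1 *: Mul a u) = Mul a (MP U (k^-1 *: u)) by rewrite -MulZ// Mul_comm.
have e2 : MP V (Mul a w) = Mul a (MP V w) by rewrite Mul_comm.
have e3 : MP U (k^-1 *: polyL r) = - polyL (- (k^-1 *: (U * r))).
  by rewrite polyLN polyLZ opprK MulZ// Mul_polyL.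
by rewrite zw scalerBr MulB// MulD// e1 e2 e3 opprK [X in X + _]addrC addrA.
Qed.

End CircleZeros.
End RationalModel.
(** * Invariant subspaces *)

Lemma poly_ideal_gen (F : fieldType) (I : {poly F} -> Prop) (a : {poly F}) :
  (forall p q, I p -> I q -> I (p + q)) -> (forall p q, I q -> I (p * q)) -> I a -> a != 0 ->
  exists2 c, I c & forall p, I p -> c %| p.
Proof.
move=> ID IM Ia a0.
have ex : exists n, `[< exists2 c, I c /\ c != 0 & size c = n >] by exists (size a); apply/asboolP; exists a.
have [n /asboolP [c [Ic c0] sc] minn] := ex_minnP ex; exists c => // p Ip.
rewrite /dvdp; apply/negPn/negP => r0.
have Ir : I (p %% c).
  have -> : p %% c = p + (- (p %/ c)) * c.
    by rewrite [X in X + _](divp_eq p c) mulNr addrC addKr.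
  exact/ID/IM.
have := minn (size (p %% c)); rewrite -sc leqNgt ltn_modp c0 => h.
by have : false by apply: h; apply/asboolP; exists (p %% c).
Qed.

Lemma mask_indices (T : Type) (s : seq T) (m : bitseq) (x0 : T) :
  exists k, exists2 i : 'I_k -> 'I_(size s), (k <= size s)%N /\ injective i &
    mask m s = [seq nth x0 s (i j) | j <- enum 'I_k].
Proof.
pose js := mask m (enum 'I_(size s)).
have us : uniq js by rewrite mask_uniq// enum_uniq.
exists (size js), (fun j => tnth (in_tuple js) j).
  split; last by apply/injectiveP; rewrite /injectiveb /dinjectiveb map_tnth_enum.
  by rewrite (leq_trans (size_subseq (mask_subseq m (enum 'I_(size s)))))// size_enum_ord.
transitivity [seq nth x0 s (val l) | l <- [seq tnth (in_tuple js) j | j <- enum 'I_(size js)]].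
  rewrite map_tnth_enum /= /js map_mask; congr mask.
  apply: (@eq_from_nth _ x0); first by rewrite size_map size_enum_ord.
  by move=> j js'; rewrite (nth_map (Ordinal js')) ?size_enum_ord// nth_enum_ord.
by rewrite -map_comp.
Qed.

Section InvariantSubspaces.
Context {R : realType}.
Local Notation C := R[i].
Local Notation circ := (@circ R).
Local Notation L := (@L2m R).
Local Notation ip := (@ip R).
Local Notation lnrm := (nrm ip).
Local Notation HH := (@HH R).
Local Notation MP p := (Mul (fun z => p.[z])).
Implicit Types (f g u v w : L) (p q : {poly C}).

Variables (lams : seq C) (A0 : L -> L) (K : R).
Hypothesis lam1 : forall x, x \in lams -> nm x = 1.
Local Notation apoly := (apoly lams).
Local Notation a := (fun z => apoly.[z]).
Hypothesis K0 : 0 < K.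
Hypothesis range1 : forall v, HH v -> exists2 w, HH w & Top (conjT a) w = A0 v.
Hypothesis range2 : forall v, HH v -> exists w,
  [/\ HH w, A0 w = Top (conjT a) v & lnrm w <= K * lnrm v].

(** The classes of the elements of [H(b)]. *)
Definition in_image v := exists2 u, HH u & A0 u = v.
Local Notation rn := (rnorm A0).

Lemma in_image_HH v : in_image v -> HH v.
Proof. by move=> [u hu <-]; have [w _ <-] := range1 hu; exact: PH_HH. Qed.

Lemma in_image_Mul_a v : HH v -> in_image (Mul a v).
Proof.
move=> hv; have [w [hw <- _]] := Mul_a_range lam1 hv.
by have [x [hx <- _]] := range2 hw; exists x.
Qed.

Lemma rnorm_Mul_a v : HH v -> rn (Mul a v) <= K * lnrm v.
Proof.
move=> hv; have [w [hw <- le]] := Mul_a_range lam1 hv.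
have [x [hx <- le']] := range2 hw.
apply: le_trans (rnorm_le hx erefl) _; apply: le_trans le' _.
by rewrite ler_pM2l.
Qed.

(** Analytic Toeplitz operators with inner symbol can be divided out of the range
    of a co-analytic one. *)
Lemma inner_division (theta : C -> C) f : inner_mult theta -> HH f -> in_image (Mul theta f) ->
  exists2 k, HH k & Top (conjT a) k = f.
Proof.
move=> ht hf [u hu e]; have [h' hh' e'] := range1 hu.
have bt := inner_bmult ht; have btc := bmult_conj bt.
have ba : bmult a := bmult_poly _; have bac := bmult_conjT ba.
exists (PH (Mul (fun z => (theta z)^*%C) h')); first exact: PH_HH.
apply: PH_unique => // g hg.
rewrite [RHS]ip_Mul// Mul_conjTK PH_ip; last exact: Mul_poly_HH.
rewrite ip_Mul//.
have -> : Mul (fun z => (theta z)^*%C^*%C) (MP apoly g) = Mul a (Mul theta g).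
  by rewrite [RHS]Mul_comm//; congr (Mul _ _); apply/funext => z; rewrite conjcK.
rewrite -[LHS](ip_Mul_inner ht) -e -e' ip_Top//; last exact: Mul_inner_HH.
by rewrite Mul_conjTK.
Qed.

Variable N0 : set L.
Hypotheses (Nsub : subspace N0) (NX : N0 `<=` in_image).
Hypothesis Nz : forall u, N0 u -> N0 (Mul (fun z => z) u).
Hypothesis Ncl : forall v, in_image v ->
  (forall e : R, 0 < e -> exists2 w, N0 w & rn (v - w) < e) -> N0 v.
Hypothesis Nnz : exists2 u, N0 u & u <> 0.

(** [N = {h | a h in N0}] is a closed shift-invariant subspace of [HH] containing
    [N0], hence is [theta HH].  By [inner_division] and [range_decomp] the elements
    of [N0] are the [theta (p + a v)] with [theta p] in [N0]; such [p] form an ideal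
    that contains [a], and [c] is its generator.  Since the range norm of [a h] is at
    most [K |h|], approximating [v] by polynomials approximates [theta a v] in [N0]
    by polynomial multiples of [theta c]. *)
Theorem invariant_subspace : exists theta c,
  [/\ inner_mult theta, c %| apoly, N0 (Mul theta (polyL c)) &
    forall v, N0 v -> forall e : R, 0 < e -> exists p, rn (v - MP p (Mul theta (polyL c))) < e].
Proof.
have ba : bmult a := bmult_poly _.
pose N := [set h | HH h /\ N0 (Mul a h)].
have NN u : N0 u -> N u.
  by move=> hu; split; [exact/in_image_HH/NX|exact: Mul_poly_closed].
have sN : subspace N.
  split; first by split; [exact: HH_subspace.1|rewrite Mul0//; exact: Nsub.1].
  move=> c u v [hu1 hu2] [hv1 hv2]; split; first exact: HH_subspace.2.
  by rewrite Mul_lin//; exact: Nsub.2.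
have cN : closedV lnrm N.
  move=> h hh; have Hh : HH h.
    by apply: HH_closed => e /hh [w [hw _] le]; exists w.
  split=> //; apply: Ncl; first exact: in_image_Mul_a.
  move=> e e0; have [|w [hw1 hw2] le] := hh (e / K); first exact: divr_gt0.
  exists (Mul a w) => //; rewrite -MulB//.
  apply: le_lt_trans (rnorm_Mul_a _) _; first exact: HH_sub.
  by rewrite mulrC -ltr_pdivlMr.
have [theta ht hN] : exists2 theta, inner_mult theta &
    forall u, N u <-> exists2 h, HH h & u = Mul theta h.
  apply: beurling => //; first by move=> u [].
    move=> u [hu1 hu2]; split; first exact: Mul_z_HH.
    by rewrite Mul_comm//; [exact: Nz|exact: bmult_id].
  by have [u hu u0] := Nnz; exists u => //; exact: NN.
have bt := inner_bmult ht.
have Nta v : HH v -> N0 (Mul theta (Mul a v)).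
  move=> hv; have [_] : N (Mul theta v) by apply/hN; exists v.
  by rewrite Mul_comm.
have tp p q : Mul theta (polyL (p * q)) = MP p (Mul theta (polyL q)).
  by rewrite -Mul_polyL Mul_comm//; exact: bmult_poly.
have pa v p : Mul theta (polyL p + Mul a v) = Mul theta (polyL p) + Mul theta (Mul a v).
  by rewrite MulD.
have decomp w : N0 w -> exists p, exists2 v, HH v & w = Mul theta (polyL p + Mul a v).
  move=> hw; have /hN [f hf e] := NN _ hw.
  have [k hk kf] : exists2 k, HH k & Top (conjT a) k = f.
    by apply: (inner_division ht hf); rewrite -e; exact: NX.
  have [p [v hv e']] := range_decomp lam1 hk.
  by exists p, v => //; rewrite e -kf e'.
pose I p := N0 (Mul theta (polyL p)).
have [c Ic hc] : exists2 c, I c & forall p, I p -> c %| p.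
  apply: (@poly_ideal_gen _ I apoly).
  - move=> p q hp hq; rewrite /I polyLD MulD//.
    by have := Nsub.2 1 _ _ hp hq; rewrite scale1r.
  - by move=> p q hq; rewrite /I tp; exact: Mul_poly_closed.
  - by have := Nta _ (HH_polyL 1); rewrite Mul_polyL mulr1.
  - exact: apoly_neq0.
have ca : c %| apoly.
  by apply: hc; have := Nta _ (HH_polyL 1); rewrite Mul_polyL mulr1.
exists theta, c; split=> // w hw e e0.
have [p [v hv ew]] := decomp _ hw.
have /hc /dvdpP [r pr] : I p.
  rewrite /I; have -> : Mul theta (polyL p) = (-1) *: Mul theta (Mul a v) + w.
    by rewrite ew pa scaleN1r addrC addrK.
  by apply: Nsub.2 => //; exact: Nta.
have /dvdpP [d ad] := ca.
have [s hs] := polyL_dense hv (divr_gt0 e0 K0).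
exists (r + d * s).
have -> : w - MP (r + d * s) (Mul theta (polyL c)) = Mul a (Mul theta (v - polyL s)).
  rewrite -tp mulrDl -pr mulrAC -ad polyLD ew pa MulD// -Mul_polyL.
  by rewrite [RHS]Mul_comm// !MulB// opprD addrACA subrr add0r.
apply: le_lt_trans (rnorm_Mul_a _) _; first by apply: Mul_inner_HH => //; apply: HH_sub => //; exact: HH_polyL.
by rewrite nrm_Mul_inner// mulrC -ltr_pdivlMr.
Qed.

End InvariantSubspaces.

Lemma dvdp_apoly (R : realType) (lams : seq R[i]) (c : {poly R[i]}) :
  (c %| apoly lams) = (c %| \prod_(x <- lams) ('X - x%:P)).
Proof. by rewrite /apoly dvdpZr// invr_neq0// expf_neq0// pnatr_eq0. Qed.

Section FunctionSpaces.
Context {R : realType}.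
Local Notation C := R[i].
Local Notation circ := (@circ R).
Local Notation L := (@L2m R).
Local Notation ip := (@ip R).
Local Notation lnrm := (nrm ip).
Local Notation HH := (@HH R).
Local Notation MP p := (Mul (fun z => p.[z])).
Implicit Types (f g : C -> C) (u v w : L) (p q : {poly C}) (M : set (C -> C)).

Lemma H2_lin (c : C) f g : H2 f -> H2 g -> H2 (fun z => c * f z + g z).
Proof.
move=> hf hg; have [lf lg] := (H2_L2 hf, H2_L2 hg).
apply/H2P; split; last by rewrite cls_lin//; apply: HH_subspace.2; exact: H2_cls.
apply: L2T_lin => //.
Qed.

Lemma inner_fun_of_mult (theta : C -> C) : inner_mult theta -> inner_fun theta.
Proof.
move=> ht; have [_ _ h hh] := ht; split.
  by apply/H2P; split => //; apply: bmult_L2T; exact: inner_bmult.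
exact: h.
Qed.

Variables (b : C -> C) (lams : seq C) (A0 : L -> L) (K : R).
Hypothesis bA : lifts (Hb_op b) A0.
Hypothesis lam1 : forall x, x \in lams -> nm x = 1.
Local Notation apoly := (apoly lams).
Local Notation a := (fun z => apoly.[z]).
Hypothesis K0 : 0 < K.
Hypothesis range1 : forall v, HH v -> exists2 w, HH w & Top (conjT a) w = A0 v.
Hypothesis range2 : forall v, HH v -> exists w,
  [/\ HH w, A0 w = Top (conjT a) v & lnrm w <= K * lnrm v].
Local Notation rn := (rnorm A0).

Lemma HbP f : Hb b f <-> H2 f /\ in_image A0 (cls f).
Proof. exact: range_spaceP. Qed.

Lemma Hb_norm_sub f g : H2 f -> H2 g -> Hb_norm b (f \- g) = rn (cls f - cls g).
Proof.
move=> hf hg; rewrite -cls_sub; try exact: H2_L2.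
apply: range_normE => //.
have := H2_lin (-1) hg hf; congr H2; apply/funext => z /=.
by rewrite mulN1r addrC.
Qed.

Lemma rnorm0 : rn 0 <= 0.
Proof.
have := rnorm_Mul_a lam1 K0 range2 (@HH_subspace R).1.
by rewrite Mul0 ?lnrm0 ?mulr0//; exact: bmult_poly.
Qed.

Section Subspace.
Variable M : set (C -> C).
Hypothesis hM : closed_subspace b M.
Local Notation N := (fun u : L => M (rep u)).

Lemma M_H2 f : M f -> H2 f.
Proof. by have [h _ _ _] := hM; move=> /h /HbP []. Qed.

(** A closed subspace of functions contains with [f] every [g] at distance [0]
    from it. *)
Lemma M_ae f g : H2 g -> ae_eqT f g -> M f -> M g.
Proof.
move=> hg fg Mf; have hf := M_H2 Mf; have [MX M0 Ml Mc] := hM.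
have e : cls f = cls g by exact: cls_H2_eq.
have [_ Xf] := (HbP _).1 (MX _ Mf).
apply: Mc; split; first by apply/HbP; split => //; rewrite -e.
move=> d d0; exists f => //; rewrite Hb_norm_sub// e subrr.
exact: le_lt_trans rnorm0 d0.
Qed.

Lemma M_cls f : M f <-> H2 f /\ N (cls f).
Proof.
split=> [Mf|[hf Nf]]; last by apply: M_ae Nf => //; exact/rep_cls/H2_L2.
have hf := M_H2 Mf; split=> //; apply: M_ae Mf; first exact/H2_rep/H2_cls.
exact/ae_eqT_sym/rep_cls/H2_L2.
Qed.

Lemma N_in_image u : N u -> in_image A0 u.
Proof. by have [MX _ _ _] := hM; move=> /MX /HbP [_]; rewrite repK. Qed.

Lemma N_subspace : subspace N.
Proof.
have [MX M0 Ml Mc] := hM; split.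
  by rewrite -(@cls0 R); exact: ((M_cls _).1 M0).2.
move=> c u v hu hv; have := Ml c _ _ hu hv => /M_cls [_].
rewrite (_ : cls _ = c *: u + v)//.
by rewrite -[in RHS](repK u) -[in RHS](repK v) -cls_lin//; exact: rep_L2.
Qed.

Lemma N_closed v : in_image A0 v ->
  (forall e : R, 0 < e -> exists2 w, N w & rn (v - w) < e) -> N v.
Proof.
move=> Xv hv; have [MX M0 Ml Mc] := hM; have Hv : H2 (rep v) by apply/H2_rep/(in_image_HH range1).
apply: Mc; split; first by apply/HbP; rewrite repK.
move=> e /hv [w hw le]; exists (rep w) => //.
by rewrite Hb_norm_sub ?repK//; exact: M_H2.
Qed.

Lemma N_shift : shift_invariant M -> forall u, N u -> N (Mul (fun z => z) u).
Proof.
move=> sM u /sM /M_cls [_]; rewrite -Mul_cls ?repK//; first exact: bmult_id.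
exact: rep_L2.
Qed.

Lemma N_nonzero : nonzero_sub M -> exists2 u, N u & u <> 0.
Proof.
move=> [f Mf nf]; have hf := M_H2 Mf; exists (cls f); first exact: ((M_cls _).1 Mf).2.
rewrite -(@cls0 R) => /cls_eq e; apply: nf; apply: e; first exact: H2_L2.
exact: L2T_cst.
Qed.

Lemma N_cyclic w (F : C -> C) : shift_invariant M -> H2 F -> cls F = w -> N w ->
  (forall v, N v -> forall e : R, 0 < e -> exists p, rn (v - MP p w) < e) ->
  Hb b F /\ M = cyclic_sub b F.
Proof.
move=> sM hF Fw Nw hw; have [MX M0 Ml Mc] := hM.
have MF : M F by apply/M_cls; rewrite Fw.
have e p : cls (fun z => p.[z] * F z) = MP p w.
  by rewrite -Fw Mul_cls//; [exact: bmult_poly|exact: H2_L2].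
have HF p : H2 (fun z => p.[z] * F z).
  apply/H2P; rewrite e; split; last exact/Mul_poly_HH/(in_image_HH range1)/N_in_image.
  by apply: bmult_L2; [exact: bmult_poly|exact: H2_L2].
split; first exact: MX.
apply/seteqP; split=> f.
  move=> Mf; split; first exact: MX.
  move=> d /(hw _ ((M_cls _).1 Mf).2) [p le]; exists (fun z => p.[z] * F z); first by exists p.
  by rewrite Hb_norm_sub// ?e//; exact: M_H2.
move=> [Xf hf]; apply: Mc; split=> // d /hf [_ [p ->] le]; exists (fun z => p.[z] * F z) => //.
apply/M_cls; rewrite e; split => //.
exact: (Mul_poly_closed N_subspace (N_shift sM) p Nw).
Qed.

(** The generator [c] of the ideal divides [a], which is up to a constant the
    product of the [X - lambda i]; so [c] is up to a constant a partial product. *)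
Theorem invariant_cyclic : shift_invariant M -> nonzero_sub M ->
  exists k (i : 'I_k -> 'I_(size lams)) (theta : C -> C),
    let F := fun z => \prod_(j < k) (z - lams`_(i j)) * theta z in
    [/\ (k <= size lams)%N, injective i, inner_fun theta, Hb b F & M = cyclic_sub b F].
Proof.
move=> sM nM.
have [theta [c [ht ca Nc hc]]] := invariant_subspace lam1 K0 range1 range2 N_subspace
  N_in_image (N_shift sM) N_closed (N_nonzero nM).
have := ca; rewrite dvdp_apoly => /(@dvdp_prod_XsubC _ _ lams id) [mk /eqpP [[d1 d2]]] /=.
move=> /andP [d10 d20] cd.
have [k [i [km inji] ei]] := mask_indices lams mk 0.
pose F := fun z : C => \prod_(j < k) (z - lams`_(i j)) * theta z.
suff : [/\ (k <= size lams)%N, injective i, inner_fun theta, Hb b F & M = cyclic_sub b F].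
  by exists k, i, theta.
pose P := \prod_(j < k) ('X - (lams`_(i j))%:P).
have eP : \prod_(x <- mask mk lams) ('X - x%:P) = P.
  by rewrite ei big_map big_enum.
rewrite eP in cd.
have e1 : P = (d2^-1 * d1) *: c by rewrite -scalerA cd scalerA mulVf// scale1r.
have e2 : c = (d1^-1 * d2) *: P by rewrite -scalerA -cd scalerA mulVf// scale1r.
have bt := inner_bmult ht.
have FE : F = (fun z => theta z * P.[z]).
  apply/funext => z; rewrite /F /P horner_prod mulrC; congr (_ * _).
  by apply: eq_bigr => j _; rewrite hornerXsubC.
have cF : cls F = Mul theta (polyL P).
  by rewrite FE -Mul_cls//; exact/bmult_L2T/bmult_poly.
have hF : H2 F.
  apply/H2P; rewrite cF; split; last exact/Mul_inner_HH/HH_polyL.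
  by rewrite FE; apply: bmult_L2 => //; exact/bmult_L2T/bmult_poly.
have NP : N (Mul theta (polyL P)).
  have := N_subspace.2 (d2^-1 * d1) _ _ Nc N_subspace.1.
  by rewrite addr0 e1 polyLZ MulZ.
have hP v : N v -> forall e : R, 0 < e -> exists p, rn (v - MP p (Mul theta (polyL P))) < e.
  move=> hv e e0; have [p hp] := hc v hv e e0; exists ((d1^-1 * d2) *: p).
  by move: hp; rewrite MP_scale e2 polyLZ !MulZ//; exact: bmult_poly.
have [X1 X2] := N_cyclic sM hF cF NP hP.
split=> //; exact: inner_fun_of_mult.
Qed.
End Subspace.
End FunctionSpaces.
(** * Polynomials on the closed disc and on the circle *)

Lemma halve_seq (T : eqType) (s : seq T) : (forall x, x \in s -> ~~ odd (count_mem x s)) ->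
  exists t, perm_eq s (t ++ t).
Proof.
have [n] := ubnP (size s); elim: n s => // n IH [|x s] ss h; first by exists [::].
have xs : x \in s.
  have := h x (mem_head _ _); rewrite /= eqxx add1n oddS negbK.
  by case: (boolP (x \in s)) => // /count_memPn ->.
have ps := perm_to_rem xs.
have [|y|t pt] := IH (rem x s).
- by rewrite size_rem//; move: ss; case: (s) xs => //= a s' _; rewrite !ltnS => /ltnW.
- move=> yr; have ys : y \in s := mem_rem yr.
  have := h y; rewrite inE ys orbT => /(_ isT); rewrite /= (permP ps) /=.
  by rewrite addnA oddD addnn odd_double.
exists (x :: t); rewrite /= perm_cons; apply: perm_trans ps _.
by rewrite perm_sym -cat1s perm_catCA /= perm_cons perm_sym.
Qed.

Section PolynomialBounds.
Context {R : realType}.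
Local Notation C := R[i].
Implicit Types (z w x : C) (p q : {poly C}).

Lemma poly_bound p (r : R) : exists2 B, 0 <= B & forall z, nm z <= r -> nm p.[z] <= B.
Proof.
elim/poly_ind: p => [|p c [B B0 hB]]; first by exists 0 => // z _; rewrite horner0 nm0.
exists (B * `|r| + nm c); first by rewrite addr_ge0 ?mulr_ge0 ?nm_ge0.
move=> z zr; rewrite hornerMXaddC; apply: le_trans (nmD _ _) _.
rewrite lerD2r nmM ler_pM ?nm_ge0 ?hB//; exact: le_trans zr (ler_norm _).
Qed.

Lemma poly_lip p : exists2 B, 0 <= B &
  forall z w, nm z <= 1 -> nm w <= 1 -> nm (p.[z] - p.[w]) <= B * nm (z - w).
Proof.
elim/poly_ind: p => [|p c [B B0 hB]].
  by exists 0 => // z w _ _; rewrite !horner0 subrr nm0 mul0r.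
have [D D0 hD] := poly_bound p 1.
exists (B + D); first exact: addr_ge0.
move=> z w z1 w1; rewrite !hornerMXaddC.
have -> : p.[z] * z + c - (p.[w] * w + c) = (p.[z] - p.[w]) * z + p.[w] * (z - w) by ring.
apply: le_trans (nmD _ _) _; rewrite [leRHS]mulrDl !nmM; apply: lerD; last first.
  by rewrite ler_wpM2r ?nm_ge0 ?hD.
by rewrite -[leRHS]mulr1 ler_pM ?nm_ge0 ?hB.
Qed.

Lemma poly_nonroot q (d : R) : q != 0 -> 0 < d -> exists2 s : R, 0 < s < d & q.[s%:C] != 0.
Proof.
move=> q0 d0; apply: contrapT => h.
pose rs := [seq (d / k.+2%:R)%:C | k <- iota 0 (size q)].
suff : (size rs < size q)%N by rewrite size_map size_iota ltnn.
apply: max_poly_roots => //.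
  apply/allP => _ /mapP [k _ ->]; rewrite /root; apply/negPn/negP => hk; apply: h.
  exists (d / k.+2%:R) => //; rewrite divr_gt0//= ltr_pdivrMr// ltr_pMr// ltr1n//.
rewrite map_inj_uniq ?iota_uniq// => k l [] /(mulfI (lt0r_neq0 d0)) /invr_inj /eqP.
by rewrite eqr_nat => /eqP [].
Qed.

(** On a segment from [z] into the disc the zeros of [q] are finitely many, so the
    inequality holds at points arbitrarily close to [z]. *)
Lemma disc_le p q : q != 0 ->
  (forall z, nm z < 1 -> q.[z] != 0 -> nm p.[z] <= nm q.[z]) ->
  forall z, nm z <= 1 -> nm p.[z] <= nm q.[z].
Proof.
move=> q0 h z z1; rewrite leNgt; apply/negP => lt.
have [w0 /andP [w00 w01] qw] := poly_nonroot q0 ltr01; set w := w0%:C in qw.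
have w1 : nm w < 1 by rewrite nmR gtr0_norm.
pose Q := q \Po (z%:P + (w - z)%:P * 'X).
have QE s : Q.[s] = q.[z + (w - z) * s] by rewrite horner_comp !hornerE.
have Q0 : Q != 0.
  by apply/eqP => e; move/eqP: qw; apply; rewrite -[w](addrNK z) addrC -[w - z]mulr1 -QE e horner0.
have [Bp Bp0 hp] := poly_lip p; have [Bq Bq0 hq] := poly_lip q.
pose e := nm p.[z] - nm q.[z]; have e0 : 0 < e by rewrite subr_gt0.
pose B := 2 * (Bp + Bq) + 1; have B0 : 0 < B by rewrite ltr_wpDl// mulr_ge0// addr_ge0.
have [|s /andP [s0 sd] hs] := @poly_nonroot Q (Num.min 1 (e / B)) Q0.
  by rewrite lt_min ltr01 divr_gt0.
move: sd; rewrite lt_min => /andP [s1 se].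
set z' := z + (w - z) * s%:C; rewrite QE -/z' in hs.
have ds : nm (z' - z) <= 2 * s.
  rewrite /z' addrAC subrr add0r nmM nmR (gtr0_norm s0) ler_wpM2r ?(ltW s0)//.
  by apply: le_trans (nmD _ _) _; rewrite nmN; lra.
have z'1 : nm z' < 1.
  have -> : z' = z * (1 - s)%:C + w * s%:C by rewrite /z' cD cN -[1%:C]/(1 : C); ring.
  apply: le_lt_trans (nmD _ _) _; rewrite !nmM !nmR (gtr0_norm s0) gtr0_norm ?subr_gt0//.
  have : nm z * (1 - s) <= 1 - s by rewrite ler_piMl// subr_ge0 ltW.
  have : `|w0| * s < s by rewrite gtr_pMl// gtr0_norm.
  lra.
have i1 := h _ z'1 hs.
have i2 := hp z z' z1 (ltW z'1); have i3 := hq z' z (ltW z'1) z1; rewrite nmB in ds i3 *.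
have i4 : nm p.[z] <= nm p.[z'] + nm (p.[z] - p.[z']).
  by apply: le_trans (nmD _ _); rewrite addrC subrK.
have i5 : nm q.[z'] <= nm q.[z] + nm (q.[z'] - q.[z]).
  by apply: le_trans (nmD _ _); rewrite addrC subrK.
have i6 : Bp * nm (z - z') <= Bp * (2 * s) by rewrite ler_wpM2l.
have i7 : Bq * nm (z - z') <= Bq * (2 * s) by rewrite ler_wpM2l.
have i8 : s * B < e by rewrite -ltr_pdivlMr.
rewrite /B /e in i8; lra.
Qed.

(** [|z - r| >= |1 - |r||] for each root [r] of [q]. *)
Lemma poly_lower q : (forall z, nm z = 1 -> q.[z] != 0) ->
  exists2 c, 0 < c & forall z, nm z = 1 -> c <= nm q.[z].
Proof.
move=> h; have [rs e] := closed_field_poly_normal q.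
have l0 : lead_coef q != 0.
  by apply/eqP => l0; have := h 1 (@nm1 R); rewrite e l0 scale0r horner0 eqxx.
have l1 : 0 < nm (lead_coef q).
  by rewrite lt_def nm_ge0 andbT; apply/eqP => /nm_eq0 /eqP; apply/negP.
have hr r : r \in rs -> nm r <> 1.
  move=> rr r1; have := h r r1; rewrite e hornerZ horner_prod mulf_eq0 negb_or => /andP [_].
  by rewrite prodf_seq_neq0 => /allP /(_ r rr); rewrite hornerXsubC subrr eqxx.
exists (nm (lead_coef q) * \prod_(r <- rs) `|1 - nm r|).
  rewrite mulr_gt0// big_seq; apply: prodr_gt0 => r /hr r1.
  by rewrite normr_gt0 subr_eq0; apply/eqP => /esym.
move=> z z1; rewrite [in leRHS]e hornerZ nmM ler_wpM2l ?nm_ge0// horner_prod.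
have -> : nm (\prod_(r <- rs) ('X - r%:P).[z]) = \prod_(r <- rs) nm (z - r).
  elim: (rs) => [|r s IH]; first by rewrite !big_nil nm1.
  by rewrite !big_cons nmM IH hornerXsubC.
apply: ler_prod => r _; rewrite normr_ge0/= ler_norml.
have := nmD (z - r) r; have := nmD (r - z) z; rewrite !subrK (nmB r z) z1.
by move=> *; apply/andP; split; lra.
Qed.

Lemma circle_near1 (d : R) : 0 < d -> exists2 u, nm u = 1 & 0 < nm (u - 1) < d.
Proof.
move=> d0; pose s := d / 3; have s0 : 0 < s by rewrite divr_gt0.
(* the Cayley transform of the real number s *)
pose x : C := 1 +i* s; have nx : nm x ^+ 2 = 1 + s ^+ 2 by rewrite nm_sqr /= expr1n.
have nx1 : 1 <= nm x by rewrite -(@ler_pXn2r _ 2) ?nnegrE ?nm_ge0// nx expr1n lerDl sqr_ge0.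
have x0 : x != 0 by apply/eqP => x0; move: nx1; rewrite x0 nm0 ler10.
have xJ0 : x^*%C != 0 by apply/eqP => e; move: nx1; rewrite -nmJ e nm0 ler10.
exists (x / x^*%C).
  by rewrite nmM ComplexField.Normc.normcV nmJ mulfV// lt0r_neq0// (lt_le_trans ltr01).
have -> : x / x^*%C - 1 = (x - x^*%C) / x^*%C by rewrite mulrBl mulfV.
rewrite nmM ComplexField.Normc.normcV nmJ.
have -> : x - x^*%C = 0 +i* (2 * s).
  by apply/eqP; rewrite eq_complex /=; apply/andP; split; apply/eqP; ring.
have -> : nm (0 +i* (2 * s) : C) = 2 * s.
  by rewrite /= expr0n add0r sqrtr_sqr ger0_norm// mulr_ge0// ltW.
have xp : 0 < nm x := lt_le_trans ltr01 nx1.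
rewrite divr_gt0 ?mulr_gt0//= ltr_pdivrMr//; apply: (@lt_le_trans _ _ d).
  by rewrite /s; lra.
by rewrite ler_peMr// ltW.
Qed.

(** Near a zero of odd order on the circle, [w.[z] / z ^+ n] would take values
    of opposite signs at [la * u] and at its mirror image [la * u^-1]. *)
Lemma even_multiplicity (w v : {poly C}) n k la : nm la = 1 ->
  (forall z, nm z = 1 -> w.[z] = (nm w.[z])%:C * z ^+ n) ->
  w = ('X - la%:P) ^+ k * v -> v.[la] != 0 -> ~~ odd k.
Proof.
move=> la1 hw wv v0; apply/negP => ok.
have vp : 0 < nm v.[la] by rewrite lt_def nm_ge0 andbT; apply/eqP => /nm_eq0 /eqP; apply/negP.
pose r := v \Po (la *: 'X).
have rE u : r.[u] = v.[la * u] by rewrite horner_comp !hornerE.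
have [B B0 hB] := poly_lip r; have [D D0 hD] := poly_lip ('X^(n.*2) : {poly C}).
have [E E0 hE] := poly_lip ('X^k : {poly C}).
have [M M0 hM] := poly_bound r 1.
pose T := 4 * B + M * (D + E) + 1.
have T0 : 0 < T by rewrite ltr_wpDl// addr_ge0 ?mulr_ge0 ?addr_ge0.
have [|u u1 /andP [up ud]] := @circle_near1 (nm v.[la] / T); first exact: divr_gt0.
have uJ : u * u^*%C = 1 by rewrite nm_mulJ u1 expr1n.
have uJ1 : nm u^*%C = 1 by rewrite nmJ.
pose X1 := nm w.[la * u]; pose X2 := nm w.[la * u^*%C].
have e1 : X1%:C * (la * u) ^+ n = la ^+ k * (u - 1) ^+ k * r.[u].
  rewrite -hw; last by rewrite nmM la1 u1 mulr1.
  by rewrite wv hornerM horner_exp hornerXsubC rE -exprMn; congr (_ ^+ k * _); ring.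
have e2 : X2%:C * (la * u^*%C) ^+ n = la ^+ k * (u^*%C - 1) ^+ k * r.[u^*%C].
  rewrite -hw; last by rewrite nmM la1 uJ1 mulr1.
  by rewrite wv hornerM horner_exp hornerXsubC rE -exprMn; congr (_ ^+ k * _); ring.
have e3 : (u^*%C - 1) ^+ k = - (u^*%C ^+ k * (u - 1) ^+ k).
  have -> : u^*%C - 1 = - (u^*%C * (u - 1)) by rewrite mulrBr [_ * u]mulrC uJ; ring.
  by rewrite exprNn -signr_odd ok expr1 mulN1r exprMn.
have n1 : X1 = nm (u - 1) ^+ k * nm r.[u].
  have := congr1 (@nm R) e1; rewrite !nmM !nmX nmM la1 u1 mulr1 !expr1n mulr1 mul1r.
  by rewrite nmR ger0_norm// nm_ge0.
have n2 : X2 = nm (u - 1) ^+ k * nm r.[u^*%C].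
  have := congr1 (@nm R) e2; rewrite e3 !nmM nmN !nmM !nmX nmM la1 uJ1 mulr1 !expr1n mulr1 !mul1r.
  by rewrite nmR ger0_norm// nm_ge0.
have un : u ^+ n * u^*%C ^+ n = 1 by rewrite -exprMn uJ expr1n.
(* (u^-1 - 1) ^ k = - u^(- k) (u - 1) ^ k as k is odd: the two nonnegative numbers
   X1 and X2 nearly cancel *)
have key : (X1 + X2)%:C * (la ^+ n * u ^+ n) =
    la ^+ k * (u - 1) ^+ k * (r.[u] - u ^+ n.*2 * u^*%C ^+ k * r.[u^*%C]).
  rewrite cD mulrDl -exprMn e1 mulrBr; congr (_ + _).
  have -> : X2%:C * (la * u) ^+ n = X2%:C * (la * u^*%C) ^+ n * u ^+ n.*2.
    rewrite -addnn exprD !exprMn.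
    transitivity (X2%:C * la ^+ n * u ^+ n * (u ^+ n * u^*%C ^+ n)); last by ring.
    by rewrite un mulr1 mulrA.
  by rewrite e2 e3; ring.
have kp : 0 < nm (u - 1) ^+ k by rewrite exprn_gt0.
have key2 : nm r.[u] + nm r.[u^*%C] = nm (r.[u] - u ^+ n.*2 * u^*%C ^+ k * r.[u^*%C]).
  have := congr1 (@nm R) key; rewrite !nmM !nmX la1 u1 !expr1n !mulr1 mul1r nmR.
  rewrite n1 n2 -mulrDr ger0_norm ?mulr_ge0 ?exprn_ge0 ?addr_ge0 ?nm_ge0//.
  by move/(mulfI (lt0r_neq0 kp)).
have nn1 : nm (1 : C) <= 1 by rewrite nm1.
have u1' : nm u <= 1 by rewrite u1.
have uJ1' : nm u^*%C <= 1 by rewrite uJ1.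
have du : nm (u^*%C - 1) = nm (u - 1) by rewrite -[1 in LHS]conj1 -conjN -conjD nmJ.
have b1 := hB u 1 u1' nn1; have b2 := hB u^*%C 1 uJ1' nn1.
rewrite du in b2.
have b4 := hD u 1 u1' nn1; rewrite !hornerXn expr1n in b4.
have b5 := hE u^*%C 1 uJ1' nn1; rewrite !hornerXn expr1n du in b5.
have r1 : r.[1] = v.[la] by rewrite rE mulr1.
have b6 : nm (u^*%C) <= 1 by rewrite uJ1.
have b7 := hM _ b6.
have c1 : nm v.[la] <= nm r.[u] + B * nm (u - 1).
  apply: (@le_trans _ _ (nm r.[u] + nm (r.[u] - r.[1]))); last by rewrite lerD2l.
  by rewrite r1 (nmB r.[u]); apply: le_trans (nmD _ _); rewrite addrC subrK.
have c2 : nm v.[la] <= nm r.[u^*%C] + B * nm (u - 1).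
  apply: (@le_trans _ _ (nm r.[u^*%C] + nm (r.[u^*%C] - r.[1]))); last by rewrite lerD2l.
  by rewrite r1 (nmB r.[_]); apply: le_trans (nmD _ _); rewrite addrC subrK.
have c3 : nm (r.[u] - u ^+ n.*2 * u^*%C ^+ k * r.[u^*%C]) <=
    2 * B * nm (u - 1) + M * ((D + E) * nm (u - 1)).
  have -> : r.[u] - u ^+ n.*2 * u^*%C ^+ k * r.[u^*%C] =
     ((r.[u] - r.[1]) - (r.[u^*%C] - r.[1])) +
     r.[u^*%C] * ((1 - u ^+ n.*2) + u ^+ n.*2 * (1 - u^*%C ^+ k)) by ring.
  apply: le_trans (nmD _ _) _; apply: lerD.
    apply: le_trans (nmD _ _) _; rewrite nmN; lra.
  rewrite nmM ler_pM ?nm_ge0//; apply: le_trans (nmD _ _) _.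
  rewrite nmM nmX u1 expr1n mul1r mulrDl (nmB 1) (nmB 1 (_ ^+ k)); exact: lerD.
rewrite -key2 in c3.
have c4 : nm (u - 1) * T < nm v.[la] by rewrite -ltr_pdivlMr.
rewrite /T in c4; lra.
Qed.

(** The polynomial whose values on the circle are [z ^+ n * (p.[z])^*]. *)
Definition reflect n p : {poly C} := \poly_(i < n.+1) (p`_(n - i))^*%C.

Lemma size_reflect n p : (size (reflect n p) <= n.+1)%N.
Proof. exact: size_poly. Qed.

Lemma reflectE n p z : (size p <= n.+1)%N -> nm z = 1 ->
  (reflect n p).[z] = z ^+ n * (p.[z])^*%C.
Proof.
move=> sp z1; have zz : z * z^*%C = 1 by rewrite nm_mulJ z1 expr1n.
rewrite horner_poly (horner_coef_wide z sp) rmorph_sum /= mulr_sumr.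
rewrite (reindex_inj rev_ord_inj) /=; apply: eq_bigr => i _.
have le : (i <= n)%N by rewrite -ltnS.
rewrite subSS subKn// conjM conjX.
rewrite (_ : z ^+ n = z ^+ (n - i) * z ^+ i); last by rewrite -exprD subnK.
transitivity ((p`_i)^*%C * z ^+ (n - i) * (z * z^*%C) ^+ i); first by rewrite zz expr1n mulr1.
by rewrite exprMn; ring.
Qed.

End PolynomialBounds.

(** * The boundary behaviour of a rational function *)

Section BoundaryData.
Context {R : realType}.
Local Notation C := R[i].
Local Notation circ := (@circ R).
Implicit Types (z x : C).

Lemma normc_lt1 z : (`|z| < 1) = (nm z < 1).
Proof. by rewrite nmE -[1]/(1%:C) ltcR. Qed.

Lemma normc_le1 z : (`|z| <= 1) = (nm z <= 1).
Proof. by rewrite -[1]/(1%:C) nm_le. Qed.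

Variables (b : C -> C) (p q : {poly C}) (n : nat).
Hypotheses (q0 : q != 0) (pq : coprimep p q).
Hypotheses (sp : (size p <= n.+1)%N) (sq : (size q <= n.+1)%N).
Hypothesis bE : forall z, q.[z] != 0 -> b z = p.[z] / q.[z].
Hypothesis hball : Hinf_ball b.

Lemma num_le z : nm z <= 1 -> nm p.[z] <= nm q.[z].
Proof.
apply: disc_le => // {}z z1 qz; have [|_] := hball (z := z); first by rewrite normc_lt1.
have qp : 0 < nm q.[z] by rewrite lt_def nm_ge0 andbT; apply/eqP => /nm_eq0 /eqP; apply/negP.
by rewrite normc_le1 bE// nmM ComplexField.Normc.normcV ler_pdivrMr// mul1r.
Qed.

Lemma den_neq0 z : nm z <= 1 -> q.[z] != 0.
Proof.
move=> z1; apply/negP => /eqP qz.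
have /nm_eq0 pz : nm p.[z] = 0.
  by apply/eqP; rewrite eq_le nm_ge0 andbT; have := num_le z1; rewrite qz nm0.
by have := coprimep_root pq (x := z); rewrite /root pz qz eqxx => /(_ isT).
Qed.

Definition defect : {poly C} := q * reflect n q - p * reflect n p.

Lemma defectE z : nm z = 1 -> defect.[z] = (nm q.[z] ^+ 2 - nm p.[z] ^+ 2)%:C * z ^+ n.
Proof.
move=> z1; rewrite /defect !hornerE !reflectE// cD cN -!nm_mulJ.
ring.
Qed.

Lemma nm_defect z : nm z = 1 -> nm defect.[z] = nm q.[z] ^+ 2 - nm p.[z] ^+ 2.
Proof.
move=> z1; rewrite defectE// nmM nmX z1 expr1n mulr1 nmR ger0_norm// subr_ge0.
by rewrite ler_pXn2r ?nnegrE ?nm_ge0// num_le// z1.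
Qed.

Lemma size_defect : (size defect <= n.*2.+1)%N.
Proof.
have key (r : {poly C}) : (size r <= n.+1)%N -> (size (r * reflect n r)%R <= n.*2.+1)%N.
  move=> sr; apply: leq_trans (size_polyMleq _ _) _.
  have := leq_add sr (size_reflect n r); case: (size r + _)%N => [|k] //=.
  by rewrite addSn addnS addnn ltnS.
by apply: leq_trans (size_polyD _ _) _; rewrite geq_max size_polyN !key.
Qed.

Lemma defect_factor : defect != 0 -> exists lams : seq C, exists2 v : {poly C},
  [/\ (size lams <= n)%N, forall x, x \in lams -> nm x = 1 & forall z, nm z = 1 -> v.[z] != 0] &
  defect = v * (\prod_(x <- lams) ('X - x%:P)) ^+ 2.
Proof.
move=> w0; have [rs e] := closed_field_poly_normal defect.
have l0 : lead_coef defect != 0 by rewrite lead_coef_eq0.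
pose us := [seq x <- rs | nm x == 1]; pose vs := [seq x <- rs | nm x != 1].
have prod_split : \prod_(x <- rs) ('X - x%:P) =
    \prod_(x <- us) ('X - x%:P) * \prod_(x <- vs) ('X - x%:P).
  by rewrite (bigID (fun x => nm x == 1)) /= !big_filter.
have [t pt] : exists t, perm_eq us (t ++ t).
  apply: halve_seq => x; rewrite mem_filter => /andP [/eqP x1 _].
  have -> : count_mem x us = count_mem x rs.
    by rewrite count_filter; apply: eq_count => y /=; case: eqP => //= ->; rewrite x1 eqxx.
  apply: (@even_multiplicity R defect (lead_coef defect *: \prod_(y <- rs | y != x) ('X - y%:P)) n _ x) => //.
  - by move=> z z1; rewrite nm_defect// defectE.
  - rewrite {1}e (bigID (fun y => y == x)) /= -scalerAr; congr (_ *: (_ * _)).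
    rewrite (eq_bigr (fun=> 'X - x%:P)); last by move=> y /eqP ->.
    by rewrite big_const_seq iter_mulr_1.
  - rewrite hornerZ mulf_neq0// horner_prod prodf_seq_neq0; apply/allP => y _ /=.
    by apply/implyP => yx; rewrite hornerXsubC subr_eq0 eq_sym.
exists t, (lead_coef defect *: \prod_(x <- vs) ('X - x%:P)); last first.
  rewrite {1}e prod_split (perm_big _ pt) big_cat /= -expr2 -scalerAl; congr (_ *: _).
  by rewrite mulrC.
split.
- rewrite -leq_double -addnn -size_cat -(perm_size pt).
  apply: (@leq_trans (size rs)); first by rewrite size_filter count_size.
  have := size_defect; rewrite e size_scale// size_prod_XsubC.
  by rewrite ltnS.
- move=> x xt; have : x \in us by rewrite (perm_mem pt) mem_cat xt.
  by rewrite mem_filter => /andP [/eqP].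
- move=> z z1; rewrite hornerZ mulf_neq0// horner_prod prodf_seq_neq0; apply/allP => y /=.
  rewrite mem_filter => /andP [y1 _]; rewrite hornerXsubC subr_eq0.
  by apply/eqP => zy; rewrite -zy z1 eqxx in y1.
Qed.

Lemma bmult_inv_poly (r : {poly C}) : (forall z, nm z = 1 -> r.[z] != 0) ->
  bmult (fun z => (r.[z])^-1).
Proof.
move=> /poly_lower [c c0 hc]; split; first exact/mT_inv/mT_poly.
exists c^-1 => t; rewrite ComplexField.Normc.normcV.
have h := hc _ (nm_circ t); have h0 := lt_le_trans c0 h.
by rewrite lef_pV2.
Qed.

Lemma b_circ t : b (circ t) = p.[circ t] / q.[circ t].
Proof. by apply: bE; apply: den_neq0; rewrite nm_circ. Qed.

Lemma bmult_b : bmult b.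
Proof.
have [h1 h2] : bmult (fun z => p.[z] / q.[z]).
  apply: bmult_mul; first exact: bmult_poly.
  by apply: bmult_inv_poly => z z1; apply: den_neq0; rewrite z1.
have bt t : b (circ t) = p.[circ t] / q.[circ t] := b_circ t.
split; last by have [K hK] := h2; exists K => t; rewrite bt.
by case: h1 => h11 h12; split; under eq_fun do rewrite bt.
Qed.

Lemma nm_b_circ t : nm (b (circ t)) <= 1.
Proof.
have c1 : nm (circ t) <= 1 by rewrite nm_circ.
have := den_neq0 c1; rewrite b_circ nmM ComplexField.Normc.normcV => qz.
have qp : 0 < nm q.[circ t] by rewrite lt_def nm_ge0 andbT; apply/eqP => /nm_eq0 /eqP; apply/negP.
by rewrite ler_pdivrMr// mul1r num_le.
Qed.

(** [|q| ^ 2 - |p| ^ 2 = |v| * \prod |z - lambda i| ^ 2] with [v] zero-free on the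
    circle gives the comparison.  There [b^* = p# / q#] for the reflected
    polynomials, and [q#], having no zero on the circle, is coprime to [a]:
    [1 = U q# + V a] gives [b^* = U p# + (V p# / q#) a]. *)
Theorem boundary_data : defect != 0 -> exists lams : seq C,
  [/\ (size lams <= n)%N, forall x, x \in lams -> nm x = 1,
    exists c1 c2 : R, [/\ 0 < c1, 0 <= c2,
      forall t, c1 * nm (apoly lams).[circ t] ^+ 2 <= 1 - nm (b (circ t)) ^+ 2 &
      forall t, 1 - nm (b (circ t)) ^+ 2 <= c2 * nm (apoly lams).[circ t] ^+ 2] &
    exists (h : {poly C}) (g0 : C -> C), bmult g0 /\
      forall t, (b (circ t))^*%C = h.[circ t] + g0 (circ t) * (apoly lams).[circ t]].
Proof.
move=> /defect_factor [lams [v [sl l1 v0] dv]]; exists lams; split=> //.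
- have [L L0 hL] := poly_lower v0; have [U U0 hU] := poly_bound v 1.
  have q1 z : nm z = 1 -> q.[z] != 0 by move=> z1; apply: den_neq0; rewrite z1.
  have [l l0 hl] := poly_lower q1; have [u u0 hu] := poly_bound q 1.
  pose k : R := (2 ^+ size lams) ^+ 2.
  have k0 : 0 < k by rewrite !exprn_gt0.
  have key t : 1 - nm (b (circ t)) ^+ 2 =
     nm v.[circ t] * k * (nm (apoly lams).[circ t] ^+ 2) / nm q.[circ t] ^+ 2.
    have c1 := nm_circ t; have h := hl _ c1; have qp : 0 < nm q.[circ t] := lt_le_trans l0 h.
    have d := nm_defect c1; rewrite dv hornerM nmM horner_exp nmX in d.
    rewrite b_circ nmM ComplexField.Normc.normcV exprMn exprVn.
    rewrite -{1}(@mulfV _ (nm q.[circ t] ^+ 2)) ?sqrf_eq0 ?lt0r_neq0// -mulrBl -d.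
    congr (_ / _); rewrite -mulrA; congr (_ * _).
    rewrite /apoly hornerZ nmM exprMn ComplexField.Normc.normcV nmX.
    have -> : nm (2 : C) = 2 by rewrite -[2 : C](rmorph_nat (@real_complex R)) nmR normr_nat.
    by rewrite exprVn mulrA mulfV ?mul1r// lt0r_neq0.
  exists (L * k / (u + 1) ^+ 2), (U * k / l ^+ 2); split.
  + by apply: divr_gt0; [exact: mulr_gt0|rewrite exprn_gt0// ltr_wpDl].
  + by apply: divr_ge0; [rewrite mulr_ge0// ltW|exact: sqr_ge0].
  + move=> t; have c1 := nm_circ t; have h := hl _ c1; have qp := lt_le_trans l0 h.
    rewrite key mulrAC; apply: ler_pM; last 2 first.
    - by rewrite ler_wpM2r ?sqr_ge0// ler_wpM2r ?(ltW k0)// hL.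
    - have h1 : nm q.[circ t] <= u + 1 by rewrite ler_wpDr// hu// c1.
      rewrite lef_pV2 ?posrE ?exprn_gt0// ?(lt_le_trans qp)//.
      by rewrite ler_pXn2r ?nnegrE ?nm_ge0// addr_ge0.
    - by rewrite mulr_ge0 ?sqr_ge0// mulr_ge0// ltW.
    - by rewrite invr_ge0 sqr_ge0.
  + move=> t; have c1 := nm_circ t; have h := hl _ c1; have qp := lt_le_trans l0 h.
    rewrite key [leRHS]mulrAC; apply: ler_pM; last 2 first.
    - by rewrite ler_wpM2r ?sqr_ge0// ler_wpM2r ?(ltW k0)// hU// c1.
    - rewrite lef_pV2 ?posrE ?exprn_gt0//.
      by rewrite ler_pXn2r ?nnegrE ?nm_ge0// ltW.
    - by rewrite mulr_ge0 ?sqr_ge0// mulr_ge0 ?nm_ge0// ltW.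
    - by rewrite invr_ge0 sqr_ge0.
- pose qs := reflect n q; pose ps := reflect n p.
  have qs0 z : nm z = 1 -> qs.[z] != 0.
    move=> z1; rewrite reflectE// mulf_neq0//.
      rewrite expf_neq0//; apply/eqP => z0; move: z1; rewrite z0 nm0 => /eqP.
      by rewrite eq_sym oner_eq0.
    have : q.[z] != 0 by apply: den_neq0; rewrite z1.
    by apply: contra_neq => h; apply: nm_eq0; rewrite -nmJ h nm0.
  have : coprimep qs (apoly lams).
    rewrite /apoly coprimepZr ?invr_neq0 ?expf_neq0 ?pnatr_eq0// coprimep_sym.
    rewrite big_seq; apply: (big_ind (fun r => coprimep r qs)).
    - exact: coprime1p.
    - by move=> x y hx hy; rewrite coprimepMl hx hy.
    - by move=> x xl; rewrite coprimep_sym coprimep_XsubC /root qs0// l1.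
  move=> /Bezout_eq1_coprimepP [[U V]] /= UV.
  exists (ps * U), (fun z => (V * ps).[z] * (qs.[z])^-1); split.
    by apply: bmult_mul; [exact: bmult_poly|exact: bmult_inv_poly].
  move=> t; have c1 := nm_circ t; have qz := qs0 _ c1.
  have -> : (b (circ t))^*%C = ps.[circ t] / qs.[circ t].
    rewrite b_circ !reflectE// conjM conjV -mulf_div mulfV ?mul1r// expf_neq0//.
    by apply/eqP => z0; move: c1; rewrite z0 nm0 => /eqP; rewrite eq_sym oner_eq0.
  have := congr1 (fun r => r.[circ t]) UV; rewrite hornerD hornerC !hornerM => e.
  rewrite -[LHS]mul1r -e; field.
  exact: qz.
Qed.

End BoundaryData.
(** * The mean value property of pointwise differentiable functions *)

Section Goursat.
Context {R : realType}.
Local Notation C := R[i].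
Local Notation circ := (@circ R).
Implicit Types (f g h : C -> C) (z w : C).

(** Complex differentiability at [z]. *)
Definition cdiff f z := exists c, forall e : R, 0 < e -> exists2 d : R, 0 < d &
  forall w, nm (w - z) < d -> nm (f w - f z - c * (w - z)) <= e * nm (w - z).

Lemma derivable_cdiff f z : derivable (f : C^o -> C^o) z 1 -> cdiff f z.
Proof.
move=> /cvg_ex [c hc]; exists c => e e0.
have e0' : 0 < e%:C by rewrite ltcR.
have [d /= d0 hd] := (nbhs_ballP _ _).1 ((cvgrPdist_le _ _).1 hc _ e0').
have dE : d = (Re d)%:C.
  by move: d0; case: (d) => a b' /=; rewrite ltcE /= => /andP [/eqP -> _].
exists (Re d); first by rewrite -ltcR -dE.
move=> w wz; have [->|wz0] := eqVneq w z.
  by rewrite !subrr mulr0 subr0 nm0 mulr0.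
have w0 : w - z != 0 by rewrite subr_eq0.
have := hd (w - z); rewrite /ball /= sub0r normrN nmE dE ltcR => /(_ wz w0).
rewrite /= [(w - z) *: 1]mulr1 subrK nm_le => le.
have -> : f w - f z - c * (w - z) = - (c - (w - z)^-1 * (f w - f z)) * (w - z).
  by rewrite mulNr mulrBl mulrAC mulVf// mul1r opprB.
by rewrite nmM nmN ler_wpM2r ?nm_ge0.
Qed.

Lemma cdiff_lip f z : cdiff f z -> exists (K d : R), [/\ 0 < K, 0 < d &
  forall w, nm (w - z) < d -> nm (f w - f z) <= K * nm (w - z)].
Proof.
move=> [c hc]; have [d d0 hd] := hc 1 ltr01.
exists (nm c + 1), d; split=> //; first by rewrite ltr_wpDl ?nm_ge0.
move=> w /hd le; rewrite -[f w - f z](subrK (c * (w - z))).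
by apply: le_trans (nmD _ _) _; rewrite nmM mulrDl addrC lerD2l.
Qed.

Lemma cdiff_comp f g z : cdiff g z -> cdiff f (g z) -> cdiff (f \o g) z.
Proof.
move=> gz [b hb]; have [K [d1 [K0 d10 h1]]] := cdiff_lip gz; have [a ha] := gz.
exists (b * a) => e e0.
have b1 : 0 < nm b + 1 by rewrite ltr_wpDl ?nm_ge0.
have [|d2 d20 h2] := ha (e / 2 / (nm b + 1)); first by rewrite !divr_gt0.
have [|d3 d30 h3] := hb (e / 2 / K); first by rewrite !divr_gt0.
exists (Num.min d1 (Num.min d2 (d3 / K))); first by rewrite !lt_min d10 d20 divr_gt0.
move=> w; rewrite !lt_min => /andP [w1 /andP [w2 w3]].
have i1 := h1 _ w1; have i2 := h2 _ w2.
have i3 : nm (f (g w) - f (g z) - b * (g w - g z)) <= e / 2 / K * nm (g w - g z).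
  by apply: h3; apply: le_lt_trans i1 _; rewrite mulrC -ltr_pdivlMr.
have -> : (f \o g) w - (f \o g) z - b * a * (w - z) =
   (f (g w) - f (g z) - b * (g w - g z)) + b * (g w - g z - a * (w - z)) by rewrite /=; ring.
apply: le_trans (nmD _ _) _; rewrite [e in leRHS]splitr mulrDl nmM; apply: lerD.
  apply: le_trans i3 _; rewrite -mulrA ler_pM2l ?divr_gt0//.
  by rewrite mulrC ler_pdivrMr// mulrC.
apply: (@le_trans _ _ ((nm b + 1) * (e / 2 / (nm b + 1) * nm (w - z)))).
  by apply: ler_pM; rewrite ?nm_ge0// lerDl.
by rewrite mulrA [_ * (e / 2 / _)]mulrC divfK ?lt0r_neq0.
Qed.

Definition cexp z : C := (expR (Re z))%:C * circ (Im z).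

Lemma nm_cexp z : nm (cexp z) = expR (Re z).
Proof. by rewrite /cexp nmM nm_circ mulr1 nmR ger0_norm// expR_ge0. Qed.

Lemma cexpD z w : cexp (z + w) = cexp z * cexp w.
Proof.
rewrite /cexp ReD ImD expRD cM circD; ring.
Qed.

Lemma derive_eps (F : R -> R) (x a : R) : is_derive x 1 F a -> forall e : R, 0 < e ->
  exists2 d : R, 0 < d & forall y, `|y| < d -> `|F (x + y) - F x - a * y| <= e * `|y|.
Proof.
move=> [dF aE] e e0; move: dF => /cvg_ex [c hc].
have ca : c = a by rewrite -aE; apply/esym/cvg_lim.
have [d /= d0 hd] := (nbhs_ballP _ _).1 ((cvgrPdist_le _ _).1 hc _ e0).
exists d => // y yd; have [->|y0] := eqVneq y 0.
  by rewrite addr0 subrr mulr0 subr0 normr0 mulr0.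
have := hd y; rewrite /ball /= sub0r normrN => /(_ yd y0).
rewrite /= [y *: 1]mulr1 ca [y + x]addrC => le.
have -> : F (x + y) - F x - a * y = - (a - y^-1 * (F (x + y) - F x)) * y.
  by rewrite mulNr mulrBl mulrAC mulVf// mul1r opprB.
by rewrite normrM normrN ler_wpM2r.
Qed.

Lemma cdiff_cexp z : cdiff cexp z.
Proof.
exists (cexp z) => e e0.
pose e1 := Num.min 1 (e / (10 * expR (Re z))).
have ez : 0 < 10 * expR (Re z) by rewrite mulr_gt0// expR_gt0.
have e10 : 0 < e1 by rewrite lt_min ltr01 divr_gt0.
have e11 : e1 <= 1 by rewrite ge_min lexx.
have e12 : e1 * (10 * expR (Re z)) <= e by rewrite -ler_pdivlMr// ge_min lexx orbT.
have [d1 d10 h1] := derive_eps (is_derive_expR 0) e10.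
have [d2 d20 h2] := derive_eps (is_derive_cos 0) e10.
have [d3 d30 h3] := derive_eps (is_derive_sin 0) e10.
exists (Num.min (e1 / 2) (Num.min d1 (Num.min d2 d3))).
  by rewrite !lt_min d10 d20 d30 divr_gt0.
move=> w; rewrite !lt_min => /andP [w0 /andP [w1 /andP [w2 w3]]].
set y := w - z; have -> : w = z + y by rewrite addrC subrK.
have -> : cexp (z + y) - cexp z - cexp z * y = cexp z * (cexp y - 1 - y) by rewrite cexpD; ring.
have sy := Re_le y; have ty := Im_le y.
have ReE : Re (cexp y - 1 - y) = expR (Re y) * cos (Im y) - 1 - Re y.
  by case: (y) => s t; rewrite /cexp /circ /= mul0r subr0.
have ImE : Im (cexp y - 1 - y) = expR (Re y) * sin (Im y) - Im y.
  by case: (y) => s t; rewrite /cexp /circ /= mul0r addr0 subr0.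
have nE := nm_le_ReIm (cexp y - 1 - y); rewrite ReE ImE in nE.
rewrite nmM nm_cexp mulrC; apply: (@le_trans _ _ (e1 * 10 * nm y * expR (Re z))); last first.
  by rewrite mulrAC -[e1 * 10 * _]mulrA ler_wpM2r ?nm_ge0.
rewrite ler_wpM2r ?expR_ge0//; apply: le_trans nE _.
rewrite -/y in w0 w1 w2 w3; have N0 := nm_ge0 y.
move: (Re y) (Im y) (nm y) w0 w1 w2 w3 sy ty N0 => s t N w0 w1 w2 w3 sy ty N0 {ReE ImE}.
have := h1 s (le_lt_trans sy w1); have := h2 t (le_lt_trans ty w2); have := h3 t (le_lt_trans ty w3).
rewrite !add0r expR0 cos0 sin0 oppr0 mul0r !subr0 !mul1r addr0 => i3 i2 i1.
have -> : expR s * cos t - 1 - s = (expR s - 1 - s) * cos t + (1 + s) * (cos t - 1) by ring.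
have -> : expR s * sin t - t = expR s * (sin t - t) + (expR s - 1) * t by ring.
have s1 : `|s| <= e1 / 2 by apply: le_trans sy (ltW w0).
have ct : `|cos t| <= 1 by rewrite ler_norml cos_geN1 cos_le1.
have es : `|expR s - 1| <= e1.
  have -> : expR s - 1 = (expR s - 1 - s) + s by ring.
  apply: le_trans (ler_normD _ _) _; have := normr_ge0 s; nra.
have es2 : `|expR s| <= 2.
  have -> : expR s = (expR s - 1) + 1 by ring.
  apply: le_trans (ler_normD _ _) _; rewrite normr1; lra.
have ss : `|1 + s| <= 2 by apply: le_trans (ler_normD _ _) _; rewrite normr1; lra.
have j1 : `|(expR s - 1 - s) * cos t + (1 + s) * (cos t - 1)| <= e1 * N + 2 * (e1 * N).
  apply: le_trans (ler_normD _ _) _; rewrite !normrM; apply: lerD.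
    rewrite -[leRHS]mulr1; apply: ler_pM => //; apply: le_trans i1 _.
    by rewrite ler_wpM2l// ltW.
  by apply: ler_pM => //; apply: le_trans i2 _; rewrite ler_wpM2l// ltW.
have j2 : `|expR s * (sin t - t) + (expR s - 1) * t| <= 2 * (e1 * N) + e1 * N.
  apply: le_trans (ler_normD _ _) _; rewrite !normrM; apply: lerD.
    by apply: ler_pM => //; apply: le_trans i3 _; rewrite ler_wpM2l// ltW.
  exact: ler_pM.
have : 0 <= e1 * N by rewrite mulr_ge0// ltW.
lra.
Qed.

(** ** Primitives and mean values *)

Definition prim (a : R) (F : R -> R) (x : R) : R :=
  Rintegral (@lebesgue_measure R) `[a, x] F.

Lemma eps_continuous (F : R -> R) :
  (forall x e, 0 < e -> exists2 d, 0 < d & forall y, `|y - x| < d -> `|F y - F x| <= e) ->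
  continuous F.
Proof.
move=> h x; apply/cvgrPdist_le => e e0; have [d d0 hd] := h x e e0.
apply/nbhs_ballP; exists d => //= y; rewrite /ball /= => yx.
by rewrite distrC hd// distrC.
Qed.

Lemma prim_derive (a x : R) (F : R -> R) : continuous F -> a < x -> is_derive x 1 (prim a F) (F x).
Proof.
move=> cF ax.
have [||||dF aF] := @continuous_FTC1 R F (BLeft a) x (x + 1).
- by rewrite ltrDl.
- apply: continuous_compact_integrable; first exact: segment_compact.
  exact/continuous_subspaceT.
- by rewrite /= lte_fin.
- exact: cF.
rewrite -[prim a F]/(fun y : R => \int[lebesgue_measure]_(t in `[a, y]) F t)%R.
move: dF aF; set P := (fun _ : R => _); clearbody P => dF aF.
by apply: DeriveDef; [exact: dF|rewrite -derive1E aF].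
Qed.

Lemma is_derive_shift (F : R -> R) (x y c : R) : is_derive (x + y) 1 F c ->
  is_derive y 1 (fun t => F (x + t)) c.
Proof.
move=> h; have h1 : is_derive y 1 (fun t : R => x + t) 1.
  by rewrite -[X in is_derive _ _ _ X]add0r; apply: is_deriveD.
by rewrite -[X in is_derive _ _ _ X]mulr1; exact: (@is_derive1_comp _ F (fun t => x + t)).
Qed.

Lemma mvt_bound (F f : R -> R) (x l K : R) : 0 < l ->
  (forall t, x <= t <= x + l -> is_derive t 1 F (f t)) ->
  (forall t, x <= t <= x + l -> `|f t| <= K) -> `|F (x + l) - F x| <= K * l.
Proof.
move=> l0 dF bf; have xl : x < x + l by rewrite ltrDl.
have [||c] := @MVT R F f x (x + l) xl.
- by move=> t; rewrite in_itv /= => /andP [/ltW t1 /ltW t2]; apply: dF; rewrite t1.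
- apply: derivable_within_continuous => t; rewrite in_itv /= => tt.
  by have [] := dF t tt.
rewrite in_itv /= => /andP [/ltW c1 /ltW c2] ->; rewrite addrAC subrr add0r normrM (gtr0_norm l0).
by rewrite ler_wpM2r ?(ltW l0)// bf// c1.
Qed.

(** ** Subdivision of squares *)

Lemma nested_point (a b : nat -> R) : (forall i j, a i <= b j) ->
  exists s, forall i, a i <= s <= b i.
Proof.
move=> h; exists (sup (range a)) => i; apply/andP; split.
  by apply: ub_le_sup; [exists (b 0%N) => _ [k _ <-]|exists i].
by apply: ge_sup; [exists (a 0%N), 0%N|move=> _ [k _ <-]].
Qed.

(** An additive function of squares that is locally at most [e] times the area is
    so globally: otherwise a nested sequence of bad squares shrinks to a point. *)
Lemma square_subdivision (E : R -> R -> R -> R) (x0 y0 l0 e : R) : 0 < l0 ->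
  (forall x y l, E x y (l + l) = E x y l + E (x + l) y l + E x (y + l) l + E (x + l) (y + l) l) ->
  (forall s t, x0 <= s <= x0 + l0 -> y0 <= t <= y0 + l0 -> exists2 d, 0 < d &
     forall x y l, 0 < l < d -> x0 <= x <= s -> y0 <= y <= t ->
       s <= x + l <= x0 + l0 -> t <= y + l <= y0 + l0 -> `|E x y l| <= e * l ^+ 2) ->
  `|E x0 y0 l0| <= e * l0 ^+ 2.
Proof.
move=> l00 add loc; rewrite leNgt; apply/negP => bad.
pose P (q : R * R * R) := e * q.2 ^+ 2 < `|E q.1.1 q.1.2 q.2|.
have step (q : R * R * R) : exists q' : R * R * R, P q -> [/\ P q', q.2 = q'.2 + q'.2,
    q.1.1 <= q'.1.1 <= q.1.1 + q'.2 \/ q'.2 <= 0 & q.1.2 <= q'.1.2 <= q.1.2 + q'.2 \/ q'.2 <= 0].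
  case: q => [[x y] l]; set m := l / 2; have lm : l = m + m by rewrite /m -splitr.
  case: (pselect (P (x, y, l))) => [Pq|nP]; last by exists (x, y, l).
  suff : exists q', [/\ P q', q'.2 = m, q'.1.1 = x \/ q'.1.1 = x + m & q'.1.2 = y \/ q'.1.2 = y + m].
    move=> [q' [h1 h2 h3 h4]]; exists q' => _; rewrite h2; split=> //=.
    - have [m0|m0] := leP m 0; [by right|left; case: h3 => ->; apply/andP; split; lra].
    - have [m0|m0] := leP m 0; [by right|left; case: h4 => ->; apply/andP; split; lra].
  apply: contrapT => no.
  have q1 a b' : a = x \/ a = x + m -> b' = y \/ b' = y + m -> `|E a b' m| <= e * m ^+ 2.
    by move=> ha hb; rewrite leNgt; apply/negP => h; apply: no; exists (a, b', m).
  move: Pq; rewrite /P /= lm add; apply/negP; rewrite -leNgt.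
  have := q1 x y (or_introl erefl) (or_introl erefl).
  have := q1 (x + m) y (or_intror erefl) (or_introl erefl).
  have := q1 x (y + m) (or_introl erefl) (or_intror erefl).
  have := q1 (x + m) (y + m) (or_intror erefl) (or_intror erefl).
  move=> i1 i2 i3 i4; apply: le_trans (ler_normD _ _) _.
  apply: le_trans (lerD (ler_normD _ _) (lexx _)) _.
  apply: le_trans (lerD (lerD (ler_normD _ _) (lexx _)) (lexx _)) _.
  have -> : (m + m) ^+ 2 = m ^+ 2 + m ^+ 2 + m ^+ 2 + m ^+ 2 by ring.
  rewrite !mulrDr; lra.
have [nx hnx] := choice step.
pose q k := iter k nx (x0, y0, l0).
have lq k : (q k).2 = l0 / 2 ^+ k /\ P (q k).
  elim: k => [|k [IH1 IH2]]; first by rewrite expr0 divr1.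
  have [h1 h2 _ _] := hnx _ IH2; split=> //.
  have -> : (q k.+1).2 = (q k).2 / 2 by rewrite h2 -[q k.+1]/(nx (q k)); field.
  by rewrite IH1 exprSr invfM mulrA.
have lp k : 0 < (q k).2 by rewrite (lq k).1 divr_gt0// exprn_gt0.
have st k : [/\ (q k).2 = (q k.+1).2 + (q k.+1).2,
     (q k).1.1 <= (q k.+1).1.1 <= (q k).1.1 + (q k.+1).2 &
     (q k).1.2 <= (q k.+1).1.2 <= (q k).1.2 + (q k.+1).2].
  have [_ h2 h3 h4] := hnx _ (lq k).2; have := lp k.+1; rewrite ltNge => /negP lk.
  by split=> //; [case: h3|case: h4].
have nest (c : nat -> R) : (forall k, c k <= c k.+1 <= c k + (q k.+1).2) ->
    exists s, forall i, c i <= s <= c i + (q i).2.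
  move=> hc; apply: nested_point => i j.
  have up k : c k <= c k.+1 by have /andP [] := hc k.
  have dn k : c k.+1 + (q k.+1).2 <= c k + (q k).2.
    by have [-> _ _] := st k; have /andP [_] := hc k; rewrite addrA lerD2r.
  have upm k m : c k <= c (m + k)%N by elim: m => // m IH; apply: le_trans IH _; exact: up.
  have dnm k m : c (m + k)%N + (q (m + k)%N).2 <= c k + (q k).2.
    by elim: m => // m IH; apply: le_trans IH; exact: dn.
  apply: le_trans (upm i j) _; rewrite addnC; apply: le_trans (dnm j i).
  by rewrite lerDl ltW.
have [s hs] := nest (fun k => (q k).1.1) (fun k => let: And3 _ h _ := st k in h).
have [t ht] := nest (fun k => (q k).1.2) (fun k => let: And3 _ _ h := st k in h).
have [d d0 hd] := loc s t (hs 0%N) (ht 0%N).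
have inside (c : nat -> R) : (forall k, c k <= c k.+1 <= c k + (q k.+1).2) ->
    forall k, c 0%N <= c k /\ c k + (q k).2 <= c 0%N + l0.
  move=> hc; elim=> [|k [IH1 IH2]]; first by rewrite lexx.
  have [e1 _ _] := st k; have /andP [h1 h2] := hc k; split; first exact: le_trans IH1 h1.
  by apply: le_trans IH2; rewrite e1 addrA lerD2r.
have [k hk] := half_pow_lt (divr_gt0 d0 l00).
have [a1 a2] := inside (fun k => (q k).1.1) (fun k => let: And3 _ h _ := st k in h) k.
have [b1 b2] := inside (fun k => (q k).1.2) (fun k => let: And3 _ _ h := st k in h) k.
have /andP [s1 s2] := hs k; have /andP [t1 t2] := ht k.
have := (lq k).2; rewrite /P ltNge => /negP; apply; apply: hd.
- by rewrite lp (lq k).1/= mulrC -ltr_pdivlMr// -exprVn.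
- by apply/andP.
- by apply/andP.
- by apply/andP.
- by apply/andP.
Qed.

Lemma continuous_slices f (phi : R -> C) : (forall s t, nm (phi s - phi t) <= `|s - t|) ->
  (forall s, cdiff f (phi s)) -> continuous (fun s => Re (f (phi s))) /\ continuous (fun s => Im (f (phi s))).
Proof.
move=> lip df.
have key x e : 0 < e -> exists2 d, 0 < d & forall y, `|y - x| < d -> nm (f (phi y) - f (phi x)) <= e.
  move=> e0; have [K [d [K0 d0 hd]]] := cdiff_lip (df x).
  exists (Num.min d (e / K)); first by rewrite lt_min d0 divr_gt0.
  move=> y; rewrite lt_min => /andP [y1 y2].
  apply: le_trans (hd _ (le_lt_trans (lip _ _) y1)) _.
  rewrite mulrC -ler_pdivlMr//; exact: le_trans (lip _ _) (ltW y2).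
split; apply: eps_continuous => x e /(key x) [d d0 hd]; exists d => // y /hd le; apply: le_trans le.
- by rewrite -ReN -ReD; exact: Re_le.
- by rewrite -ImN -ImD; exact: Im_le.
Qed.

(** With [U] a primitive of [Re G] in the first variable and [V] one of [Im G] in the
    second, this is the real part of the integral of [G] along the boundary of the
    square. *)
Definition boundary (U V : R -> R -> R) (x y l : R) : R :=
  (U (x + l) y - U x y - (U (x + l) (y + l) - U x (y + l))) -
  (V (x + l) (y + l) - V (x + l) y - (V x (y + l) - V x y)).

Lemma boundary_add U V x y l : boundary U V x y (l + l) = boundary U V x y l +
  boundary U V (x + l) y l + boundary U V x (y + l) l + boundary U V (x + l) (y + l) l.
Proof. by rewrite /boundary !addrA; ring. Qed.

(** Goursat's local estimate: on opposite sides of the square the contributions of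
    an affine function cancel pointwise, and [G] differs from one by at most [e]
    times the distance to [s0 +i* t0]. *)
Lemma goursat_local (G : C -> C) (U V : R -> R -> R) (x y l s0 t0 e d : R) (c : C) :
  0 < l -> x <= s0 <= x + l -> y <= t0 <= y + l -> l + l < d -> 0 <= e ->
  (forall w, nm (w - (s0 +i* t0)) < d ->
    nm (G w - G (s0 +i* t0) - c * (w - (s0 +i* t0))) <= e * nm (w - (s0 +i* t0))) ->
  (forall s t, x <= s <= x + l -> (t = y \/ t = y + l) ->
     is_derive s 1 (fun s => U s t) (Re (G (s +i* t)))) ->
  (forall s t, y <= t <= y + l -> (s = x \/ s = x + l) ->
     is_derive t 1 (V s) (Im (G (s +i* t)))) ->
  `|boundary U V x y l| <= 8 * e * l ^+ 2.
Proof.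
move=> l0 hs ht ld e0 hG dU dV.
pose F tau := U (x + tau) y - U (x + tau) (y + l) - V (x + l) (y + tau) + V x (y + tau).
pose f tau := Re (G ((x + tau) +i* y)) - Re (G ((x + tau) +i* (y + l)))
  - Im (G ((x + l) +i* (y + tau))) + Im (G (x +i* (y + tau))).
have dF tau : 0 <= tau <= 0 + l -> is_derive tau 1 F (f tau).
  rewrite add0r => /andP [t1 t2].
  have xt : x <= x + tau <= x + l by rewrite lerDl t1 lerD2l.
  have yt : y <= y + tau <= y + l by rewrite lerDl t1 lerD2l.
  have a1 := is_derive_shift (dU _ _ xt (or_introl erefl)).
  have a2 := is_derive_shift (dU _ _ xt (or_intror erefl)).
  have a3 := is_derive_shift (dV _ _ yt (or_intror erefl)).
  have a4 := is_derive_shift (dV _ _ yt (or_introl erefl)).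
  by apply: is_deriveD; apply: is_deriveB; apply: is_deriveB.
have bf tau : 0 <= tau <= 0 + l -> `|f tau| <= 8 * e * l.
  rewrite add0r => /andP [t1 t2].
  pose r w := G w - G (s0 +i* t0) - c * (w - (s0 +i* t0)).
  have near a b : x <= a <= x + l -> y <= b <= y + l -> nm (r (a +i* b)) <= e * (l + l).
    move=> ha hb; have nl : nm (a +i* b - (s0 +i* t0)) <= l + l.
      apply: le_trans (nm_le_ReIm _) _; rewrite ReD ImD ReN ImN /=.
      by apply: lerD; rewrite ler_norml; apply/andP; split; lra.
    apply: le_trans (hG _ (le_lt_trans nl ld)) _; exact: ler_wpM2l.
  have xl : x <= x + l <= x + l by rewrite lexx lerDl ltW.
  have yl : y <= y + l <= y + l by rewrite lexx lerDl ltW.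
  have xx : x <= x <= x + l by rewrite lexx lerDl ltW.
  have yy : y <= y <= y + l by rewrite lexx lerDl ltW.
  have xt : x <= x + tau <= x + l by rewrite lerDl t1 lerD2l.
  have yt : y <= y + tau <= y + l by rewrite lerDl t1 lerD2l.
  have n1 := near _ _ xt yy; have n2 := near _ _ xt yl.
  have n3 := near _ _ xl yt; have n4 := near _ _ xx yt.
  have -> : f tau = Re (r ((x + tau) +i* y)) - Re (r ((x + tau) +i* (y + l)))
     - Im (r ((x + l) +i* (y + tau))) + Im (r (x +i* (y + tau))).
    rewrite /f /r !ReD !ImD !ReN !ImN !ReM !ImM !ReD !ImD !ReN !ImN /=; ring.
  have m1 := le_trans (Re_le _) n1; have m2 := le_trans (Re_le _) n2.
  have m3 := le_trans (Im_le _) n3; have m4 := le_trans (Im_le _) n4.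
  apply: le_trans (ler_normD _ _) _.
  apply: le_trans (lerD (ler_normB _ _) (lexx _)) _.
  apply: le_trans (lerD (lerD (ler_normB _ _) (lexx _)) (lexx _)) _.
  lra.
have := mvt_bound l0 dF bf.
rewrite /boundary /F !add0r !addr0 expr2 mulrA; congr (`|_| <= _); ring.
Qed.

Section CircularMeans.
Variables (k : C -> C) (L : R).
Hypothesis dk : forall z, nm z < 1 -> cdiff k z.
Hypothesis bk : forall z, nm z < 1 -> nm (k z) ^+ 2 <= L * (1 - nm z ^+ 2).

Let G z := k (cexp z).

Lemma cdiff_G z : Re z < 0 -> cdiff G z.
Proof.
move=> z0; apply: cdiff_comp; first exact: cdiff_cexp.
by apply: dk; rewrite nm_cexp -expR0 ltr_expR.
Qed.

Lemma nm_iR (s t u v : R) : nm ((s +i* t) - (u +i* v)) <= `|s - u| + `|t - v|.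
Proof. by apply: le_trans (nm_le_ReIm _) _; rewrite ReD ImD ReN ImN. Qed.

Lemma slice_t (s : R) : s < 0 -> continuous (fun t : R => Im (G (s +i* t))).
Proof.
move=> s0; have [] := @continuous_slices G (fun t => s +i* t) _ _ => //.
  by move=> t u; apply: le_trans (nm_iR _ _ _ _) _; rewrite subrr normr0 add0r.
by move=> t; exact: cdiff_G.
Qed.

(** Cutting off at [s1 < 0] keeps the slices in the disc without changing them on
    the squares to the left of [s1]. *)
Lemma slice_s (s1 t : R) : s1 < 0 -> continuous (fun s : R => Re (G (Num.min s s1 +i* t))).
Proof.
move=> s0; have [] := @continuous_slices G (fun s => Num.min s s1 +i* t) _ _ => //.
  move=> s u; apply: le_trans (nm_iR _ _ _ _) _; rewrite subrr normr0 addr0.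
  rewrite !minEle; case: (leP s s1) => h1; case: (leP u s1) => h2 //.
  - by rewrite !ler0_norm; lra.
  - by rewrite !ger0_norm; lra.
  - by rewrite subrr normr0.
by move=> s; apply: cdiff_G => /=; rewrite gt_min s0 orbT.
Qed.

(** [2 pi] times the mean of [Im k] over the circle of radius [exp s]. *)
Definition mean s : R := prim (- 1) (fun t => Im (G (s +i* t))) (2 * pi) -
  prim (- 1) (fun t => Im (G (s +i* t))) 0.

Lemma G_period s : G (s +i* (2 * pi)) = G (s +i* 0).
Proof.
rewrite /G /cexp /circ /= (_ : 2 * pi = pi *+ 2); last by rewrite mulr2n; ring.
by rewrite cos2pi sin2pi cos0 sin0.
Qed.

(** In the coordinate [s + i t] of [k \o cexp] the strip between two circles is a
    rectangle whose horizontal sides cancel by periodicity; squares of side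
    [2 pi] suffice. *)
Lemma mean_step s1 : s1 < 0 -> mean s1 = mean (s1 - 2 * pi).
Proof.
move=> s10; have l0 : 0 < 2 * pi :> R := @two_pi_gt0 R.
pose l := 2 * pi : R; pose x0 := s1 - l; have x0l : x0 + l = s1 by rewrite subrK.
pose U s t := prim (x0 - 1) (fun s => Re (G (Num.min s s1 +i* t))) s.
pose V s t := prim (- 1) (fun t => Im (G (s +i* t))) t.
have dU s t : x0 <= s <= s1 -> is_derive s 1 (fun s => U s t) (Re (G (s +i* t))).
  move=> /andP [h1 h2]; have := @prim_derive (x0 - 1) s _ (@slice_s s1 t s10).
  rewrite min_l//; apply; lra.
have dV (s t : R) : s <= s1 -> 0 <= t -> is_derive t 1 (V s) (Im (G (s +i* t))).
  move=> h1 h2; apply: (@prim_derive (-1) t) => //; last lra.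
  by apply: slice_t; exact: le_lt_trans h1 s10.
have UU s : U s (0 + l) = U s 0.
  rewrite add0r /U; congr (prim _ _ s); apply/funext => a.
  by congr Re; exact: G_period.
have VV s : mean s = V s l - V s 0 by [].
clearbody U V.
have E0 : boundary U V x0 0 l = 0.
  apply/eqP; rewrite -normr_le0; apply/ler_addgt0Pl => e e0; rewrite addr0.
  have e1 : 0 < e / l ^+ 2 by rewrite divr_gt0// exprn_gt0.
  suff : `|boundary U V x0 0 l| <= e / l ^+ 2 * l ^+ 2 by rewrite divfK// lt0r_neq0// exprn_gt0.
  apply: square_subdivision => //; first exact: boundary_add.
  move=> s t /andP [s2 s3] /andP [t2 t3].
  have [|c hc] := @cdiff_G (s +i* t); first by rewrite /= (le_lt_trans s3)// x0l.
  have [|d d0 hd] := hc (e / l ^+ 2 / 8); first by rewrite divr_gt0.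
  exists (d / 2); first by rewrite divr_gt0.
  move=> x y m /andP [m0 md] /andP [x1 x2] /andP [y1 y2] /andP [x3 x4] /andP [y3 y4].
  have -> : e / l ^+ 2 * m ^+ 2 = 8 * (e / l ^+ 2 / 8) * m ^+ 2 by field; rewrite lt0r_neq0.
  apply: (goursat_local (G := G) (s0 := s) (t0 := t) (d := d) (c := c)) => //.
  - by rewrite x2.
  - by rewrite y2.
  - lra.
  - by rewrite ltW// divr_gt0.
  - by move=> a b /andP [a1 a2] _; apply: dU; rewrite -x0l (le_trans x1)//= (le_trans a2).
  - move=> a b /andP [b1 b2] ab; apply: dV; last exact: le_trans y1 b1.
    by rewrite -x0l; case: ab => ->//; apply: le_trans x4; rewrite lerDl ltW.
move: E0; rewrite /boundary !UU x0l subrr sub0r => /eqP; rewrite oppr_eq0 subr_eq0 add0r => /eqP.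
by rewrite !VV.
Qed.

Lemma mean_bound s (v e : R) : s < 0 -> (forall t, `|Im (G (s +i* t)) - v| <= e) ->
  `|mean s - v * (2 * pi)| <= e * (2 * pi).
Proof.
move=> s0 h; have l0 : 0 < 2 * pi :> R := @two_pi_gt0 R.
pose P := prim (- 1) (fun t => Im (G (s +i* t))).
have := @mvt_bound (fun t => P t - v * t) (fun t => Im (G (s +i* t)) - v) 0 (2 * pi) e l0.
rewrite add0r mulr0 subr0 addrAC -/(mean s); apply.
- move=> t /andP [t0 _]; apply: is_deriveB.
    by apply: prim_derive; [exact: slice_t|lra].
  have := @is_deriveZ R R R id v t 1 1 (is_derive_id _ _).
  by rewrite [v *: 1]mulr1.
- by move=> t _; exact: h.
Qed.

(** The mean is close to [2 pi Im (k 0)] on small circles and close to [0] near the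
    unit circle, and it takes the same value on circles whose radii differ by a
    factor [exp (2 pi)]. *)
Lemma center_Im : Im (k 0) = 0.
Proof.
apply/eqP; rewrite -normr_eq0 eq_le normr_ge0 andbT leNgt; apply/negP => K0.
set v := Im (k 0) in K0; have l0 : 0 < 2 * pi :> R := @two_pi_gt0 R.
have q0 : 0 < `|v| / 4 by rewrite divr_gt0.
have nm01 : nm (0 : C) < 1 by rewrite nm0.
have L0 : 0 <= L by have := bk nm01; rewrite nm0 expr0n subr0 mulr1; apply: le_trans; rewrite sqr_ge0.
have [M [d [M0 d0 hd]]] := cdiff_lip (dk nm01).
(* circles so small that Im k differs there from v by at most |v| / 4 *)
pose S := ln (Num.min (1 / 2) (Num.min (d / 2) (`|v| / 4 / M))).
have eS : 0 < Num.min (1 / 2) (Num.min (d / 2) (`|v| / 4 / M)) by rewrite !lt_min !divr_gt0.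
have h1 s : s <= S -> `|mean s - v * (2 * pi)| <= `|v| / 4 * (2 * pi).
  move=> sS; have : expR s <= expR S by rewrite ler_expR.
  rewrite lnK ?posrE// !le_min => /andP [e1 /andP [e2 e3]].
  apply: mean_bound => [|t]; first by rewrite -ltr_expR expR0; lra.
  rewrite /v -ImN -ImD; apply: le_trans (Im_le _) _.
  have := hd (cexp (s +i* t)); rewrite subr0 nm_cexp /= => /(_ _) le.
  apply: le_trans (le _) _; first by lra.
  by rewrite mulrC -ler_pdivlMr.
(* a circle so large that |k| is at most |v| / 4 on it *)
pose rr := Num.min (1 / 2) ((`|v| / 4) ^+ 2 / (2 * L + 1)).
have LL : 0 < 2 * L + 1 by rewrite ltr_wpDl// mulr_ge0.
have rr0 : 0 < rr by rewrite lt_min divr_gt0//= divr_gt0// exprn_gt0.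
have rr1 : rr <= 1 / 2 by rewrite ge_min lexx.
have rr2 : rr * (2 * L + 1) <= (`|v| / 4) ^+ 2 by rewrite -ler_pdivlMr// ge_min lexx orbT.
pose s1 := ln (1 - rr).
have r1 : 0 < 1 - rr by lra.
have s10 : s1 < 0 by rewrite -ltr_expR lnK ?posrE// expR0; lra.
have h2 : `|mean s1 - 0 * (2 * pi)| <= `|v| / 4 * (2 * pi).
  apply: mean_bound => // t; rewrite subr0; apply: le_trans (Im_le _) _.
  rewrite -(@ler_pXn2r _ 2) ?nnegrE ?nm_ge0 ?(ltW q0)//.
  have z1 : nm (cexp (s1 +i* t)) < 1 by rewrite nm_cexp -expR0 ltr_expR.
  apply: le_trans (bk z1) _; rewrite nm_cexp /= lnK ?posrE//.
  apply: le_trans rr2; have := mulr_ge0 L0 (sqr_ge0 rr).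
  have -> : L * (1 - (1 - rr) ^+ 2) = 2 * L * rr - L * rr ^+ 2 by ring.
  rewrite mulrDr mulr1; lra.
have steps n : mean s1 = mean (s1 - n%:R * (2 * pi)).
  elim: n => [|n ->]; first by rewrite mul0r subr0.
  rewrite mean_step; last first.
    by apply: le_lt_trans s10; rewrite gerBl mulr_ge0// ltW.
  by congr mean; rewrite -natr1; ring.
pose N := (Num.truncn ((s1 - S) / (2 * pi))).+1.
have hN : s1 - N%:R * (2 * pi) <= S.
  rewrite lerBlDr -lerBlDl -ler_pdivrMr// ltW//.
  exact: truncnS_gt.
have := h1 _ hN; rewrite -steps => h3.
rewrite mul0r subr0 in h2.
have h4 : `|v| * (2 * pi) <= `|mean s1| + `|mean s1 - v * (2 * pi)|.
  rewrite -[X in _ * X <= _](gtr0_norm l0) -normrM.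
  rewrite {1}(_ : v * (2 * pi) = mean s1 - (mean s1 - v * (2 * pi))); last by ring.
  exact: ler_normB.
have : `|v| * (2 * pi) <= `|v| / 2 * (2 * pi) by lra.
rewrite ler_pM2r//; lra.
Qed.

End CircularMeans.

Lemma cdiff_scale (c : C) f z : cdiff f z -> cdiff (fun w => c * f w) z.
Proof.
move=> [a ha]; exists (c * a) => e e0.
have c1 : 0 < nm c + 1 by rewrite ltr_wpDl ?nm_ge0.
have [|d d0 hd] := ha (e / (nm c + 1)); first by rewrite divr_gt0.
exists d => // w /hd le.
have -> : c * f w - c * f z - c * a * (w - z) = c * (f w - f z - a * (w - z)) by ring.
rewrite nmM; apply: (@le_trans _ _ ((nm c + 1) * (e / (nm c + 1) * nm (w - z)))).
  by apply: ler_pM; rewrite ?nm_ge0// lerDl.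
by rewrite mulrA [(_ + 1) * _]mulrC divfK// lt0r_neq0.
Qed.

(** [Re k = Im (i k)]. *)
Lemma center_zero (k : C -> C) (L : R) : (forall z, nm z < 1 -> cdiff k z) ->
  (forall z, nm z < 1 -> nm (k z) ^+ 2 <= L * (1 - nm z ^+ 2)) -> k 0 = 0.
Proof.
move=> dk bk; apply/eqP; rewrite eq_complex; apply/andP; split; apply/eqP; last first.
  exact: center_Im dk bk.
have ni : nm ('i%C : C) = 1 by rewrite /= expr0n expr1n add0r sqrtr1.
have bi z : nm z < 1 -> nm ('i%C * k z) ^+ 2 <= L * (1 - nm z ^+ 2).
  by move=> z1; rewrite nmM ni mul1r bk.
have di z : nm z < 1 -> cdiff (fun w => 'i%C * k w) z by move=> /dk; exact: cdiff_scale.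
have := center_Im di bi.
by rewrite ImM /= mul0r mul1r add0r.
Qed.

(** A Moebius transformation moves [w] to the origin; it multiplies [1 - nm z ^+ 2]
    by a factor bounded from above. *)
Lemma disc_zero (h : C -> C) (L : R) : (forall z, nm z < 1 -> cdiff h z) -> 0 <= L ->
  (forall z, nm z < 1 -> nm (h z) ^+ 2 <= L * (1 - nm z ^+ 2)) ->
  forall w, nm w < 1 -> h w = 0.
Proof.
move=> dh L0 bh w w1.
pose phi (z : C) := (z + w) / (1 + w^*%C * z).
have den z : nm z < 1 -> 1 - nm w <= nm (1 + w^*%C * z).
  move=> z1; have : nm (1 : C) <= nm (1 + w^*%C * z) + nm (w^*%C * z).
    by rewrite -(nmN (_ * z)); apply: le_trans (nmD _ _); rewrite addrK.
  rewrite nm1 nmM nmJ; have := ler_wpM2l (nm_ge0 w) (ltW z1); lra.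
have w0 : 0 < 1 - nm w by rewrite subr_gt0.
have den0 z : nm z < 1 -> 0 < nm (1 + w^*%C * z).
  by move=> /den; exact: lt_le_trans.
have dd z : nm z < 1 -> 1 + w^*%C * z != 0.
  by move=> /den0; apply: contraTneq => ->; rewrite nm0 ltxx.
have quot z : nm z < 1 -> 1 - nm (phi z) ^+ 2 =
    (1 - nm w ^+ 2) * (1 - nm z ^+ 2) / nm (1 + w^*%C * z) ^+ 2.
  move=> z1; rewrite nmM ComplexField.Normc.normcV exprMn exprVn.
  have d2 : nm (1 + w^*%C * z) ^+ 2 != 0 by rewrite sqrf_eq0 lt0r_neq0// den0.
  rewrite -{1}(mulfV d2) -mulrBl; congr (_ / _).
  apply: (@complexI R); rewrite cD cN -!nm_mulJ cM !cD !cN -!nm_mulJ.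
  rewrite !conjD !conjM conjcK conj1 -[1%:C]/(1 : C); ring.
have phi1 z : nm z < 1 -> nm (phi z) < 1.
  move=> z1; rewrite -(@ltr_pXn2r _ 2) ?nnegrE ?nm_ge0// expr1n -subr_gt0 quot//.
  have sq (x : C) : nm x < 1 -> 0 < 1 - nm x ^+ 2 by move=> x1; rewrite subr_gt0 expr_lt1// nm_ge0.
  by rewrite divr_gt0//; [apply: mulr_gt0; exact: sq|rewrite exprn_gt0// den0].
have := @center_zero (h \o phi) (L / (1 - nm w) ^+ 2).
rewrite /= /phi add0r mulr0 addr0 divr1; apply.
- move=> z z1; apply: cdiff_comp; last by apply: dh; exact: phi1.
  apply: derivable_cdiff; rewrite /phi.
  apply: (@derivableM _ C^o (fun x : C^o => x + w) (fun x : C^o => (1 + w^*%C * x)^-1)).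
    by apply: derivableD; [exact: derivable_id|exact: derivable_cst].
  apply: derivableV; first exact: dd.
  apply: derivableD; first exact: derivable_cst.
  by apply: (@derivableM _ C^o (fun=> w^*%C) id); [exact: derivable_cst|exact: derivable_id].
- move=> z z1; apply: le_trans (bh _ (phi1 _ z1)) _; rewrite quot//.
  rewrite -[leRHS]mulrA; apply: ler_wpM2l => //.
  have z0 : 0 <= 1 - nm z ^+ 2 by rewrite subr_ge0 expr_le1 ?nm_ge0// ltW.
  rewrite mulrAC; apply: ler_wpM2r => //.
  rewrite -[leRHS]mul1r; apply: ler_pM.
  + by rewrite subr_ge0 expr_le1 ?nm_ge0// ltW.
  + by rewrite invr_ge0 sqr_ge0.
  + by rewrite gerBl sqr_ge0.
  + rewrite lef_pV2 ?posrE ?exprn_gt0 ?den0// ler_pXn2r ?nnegrE ?nm_ge0 ?(ltW w0)//.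
    exact: den.
Qed.

End Goursat.
(** * Rational functions unimodular on the circle are extreme *)

Section Extreme.
Context {R : realType}.
Local Notation C := R[i].
Implicit Types (z w : C).

Lemma derivable_poly (q : {poly C}) z : derivable ((fun w => q.[w]) : C^o -> C^o) z 1.
Proof.
elim/poly_ind: q => [|q c IH].
  by under eq_fun do rewrite horner0; exact: derivable_cst.
under eq_fun do rewrite hornerMXaddC.
apply: derivableD; last exact: derivable_cst.
by apply: (@derivableM _ C^o (fun w : C^o => q.[w]) id); [exact: IH|exact: derivable_id].
Qed.

(** The nearest point of the circle. *)
Lemma nm_radial z : nm z < 1 -> exists2 u, nm u = 1 & nm (z - u) = 1 - nm z.
Proof.
move=> z1; have [->|z0] := eqVneq z 0.
  by exists 1; [exact: nm1|rewrite sub0r nmN nm1 nm0 subr0].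
have zp : 0 < nm z by rewrite lt_def nm_ge0 andbT; apply/eqP => /nm_eq0 /eqP; apply/negP.
exists (z * (nm z)^-1%:C).
  by rewrite nmM nmR ger0_norm ?invr_ge0 ?nm_ge0// mulfV// lt0r_neq0.
have -> : z - z * (nm z)^-1%:C = - (z * ((nm z)^-1 - 1)%:C).
  by rewrite cD cN -[1%:C]/(1 : C); ring.
rewrite nmN nmM nmR ger0_norm; last by rewrite subr_ge0 invf_ge1// ltW.
by rewrite mulrBr mulfV ?mulr1// lt0r_neq0.
Qed.

Lemma nm_convex (t : R) z w : nm (t%:C * z + (1 - t)%:C * w) ^+ 2 =
  t * nm z ^+ 2 + (1 - t) * nm w ^+ 2 - t * (1 - t) * nm (z - w) ^+ 2.
Proof. by rewrite !nm_sqr; case: z => a b; case: w => c d /=; ring. Qed.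

(** [t (1 - t) |f - g| ^ 2 <= 1 - |b| ^ 2], so [h = q (f - g)] satisfies
    [|h| ^ 2 <= L (|q| ^ 2 - |p| ^ 2)], which is at most a multiple of the distance to
    the circle. *)
Lemma extreme_of_unimodular (b : C -> C) (p q : {poly C}) :
  (forall z, nm z <= 1 -> nm p.[z] <= nm q.[z]) -> (forall z, nm z <= 1 -> q.[z] != 0) ->
  (forall z, nm z = 1 -> nm q.[z] = nm p.[z]) ->
  (forall z, q.[z] != 0 -> b z = p.[z] / q.[z]) -> Hinf_ball b -> extreme_Hinf_ball b.
Proof.
move=> ple q0 circ_eq bE hball; split=> // f g t hf hg /andP [t0 t1] hb z.
rewrite normc_lt1 => z1.
have tt : 0 < t * (1 - t) by rewrite mulr_gt0// subr_gt0.
have [Bp Bp0 hp] := poly_lip p; have [Bq Bq0 hq] := poly_lip q.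
have [U U0 hU] := poly_bound q 1.
have dq w : nm w < 1 -> nm q.[w] ^+ 2 - nm p.[w] ^+ 2 <= (Bq + Bp) * (2 * U) * (1 - nm w ^+ 2).
  move=> w1; have [u u1 wu] := nm_radial w1.
  have u1' : nm u <= 1 by rewrite u1.
  have i1 := hq w u (ltW w1) u1'; have i2 := hp u w u1' (ltW w1).
  rewrite (nmB u) in i2; rewrite wu in i1 i2.
  have i3 : nm q.[w] <= nm q.[u] + nm (q.[w] - q.[u]).
    by apply: le_trans (nmD _ _); rewrite addrC subrK.
  have i4 : nm p.[u] <= nm p.[w] + nm (p.[u] - p.[w]).
    by apply: le_trans (nmD _ _); rewrite addrC subrK.
  have i5 := circ_eq _ u1; have i6 := ple _ (ltW w1); have i7 := hU _ (ltW w1).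
  have i8 : nm q.[w] - nm p.[w] <= (Bq + Bp) * (1 - nm w) by lra.
  have -> : nm q.[w] ^+ 2 - nm p.[w] ^+ 2 = (nm q.[w] - nm p.[w]) * (nm q.[w] + nm p.[w]) by ring.
  rewrite mulrAC; apply: ler_pM; [by rewrite subr_ge0|by rewrite addr_ge0 ?nm_ge0| |lra].
  apply: le_trans i8 _; apply: ler_wpM2l; first exact: addr_ge0.
  by rewrite lerD2l lerN2 expr2 ler_piMr ?nm_ge0// ltW.
pose h w := q.[w] * (f w - g w).
have hz : h z = 0.
  apply: (@disc_zero R h ((Bq + Bp) * (2 * U) / (t * (1 - t)))) z1.
  - move=> w w1; apply: derivable_cdiff; rewrite -normc_lt1 in w1.
    apply: (@derivableM _ C^o (fun w : C^o => q.[w]) (fun w : C^o => f w - g w)).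
      exact: derivable_poly.
    by apply: derivableB; [exact: (hf _ w1).1|exact: (hg _ w1).1].
  - by apply: divr_ge0; [rewrite !mulr_ge0// addr_ge0|exact: ltW].
  - move=> w w1; have w1' := w1; rewrite -normc_lt1 in w1'.
    have [_] := hf _ w1'; have [_] := hg _ w1'; rewrite !normc_le1 => g1 f1.
    have := hb _ w1'; rewrite bE; last exact/q0/ltW.
    move=> /(congr1 (fun x => nm x ^+ 2)).
    rewrite nm_convex nmM ComplexField.Normc.normcV => e.
    have qw : 0 < nm q.[w].
      by rewrite lt_def nm_ge0 andbT; apply/eqP => /nm_eq0 /eqP; apply/negP/q0/ltW.
    have sq (x : C) : nm x <= 1 -> nm x ^+ 2 <= 1 by move=> x1; rewrite expr_le1// nm_ge0.
    have f2 := sq _ f1; have g2 := sq _ g1.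
    have e2 : t * (1 - t) * nm (f w - g w) ^+ 2 <= 1 - (nm p.[w] * (nm q.[w])^-1) ^+ 2.
      rewrite e; have : t * nm (f w) ^+ 2 <= t by rewrite ler_piMr// ltW.
      have : (1 - t) * nm (g w) ^+ 2 <= 1 - t by rewrite ler_piMr// subr_ge0 ltW.
      lra.
    have e3 : t * (1 - t) * nm (h w) ^+ 2 <= nm q.[w] ^+ 2 - nm p.[w] ^+ 2.
      rewrite /h nmM exprMn mulrCA.
      have -> : nm q.[w] ^+ 2 - nm p.[w] ^+ 2 = nm q.[w] ^+ 2 * (1 - (nm p.[w] * (nm q.[w])^-1) ^+ 2).
        by field; rewrite lt0r_neq0.
      by rewrite ler_wpM2l ?sqr_ge0.
    rewrite mulrAC ler_pdivlMr// mulrC; exact: le_trans e3 (dq _ w1).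
have fg : f z = g z.
  apply/eqP; rewrite -subr_eq0; move/eqP: hz; rewrite mulf_eq0 => /orP [|//].
  by rewrite (negbTE (q0 _ (ltW z1))).
have := hb z; rewrite normc_lt1 fg => /(_ z1) ->.
have -> : t%:C * g z + (1 - t)%:C * g z = g z by rewrite cD cN -[1%:C]/(1 : C); ring.
by [].
Qed.

End Extreme.

(** * Description of H(b) and of its invariant subspaces *)

Section Identity.
Context {R : realType}.
Local Notation C := R[i].
Local Notation L := (@L2m R).
Implicit Types (f : C -> C).

Lemma id_lifts : lifts (fun f : C -> C => f) (fun u : L => u).
Proof. by []. Qed.

Lemma range_space_id : range_space (fun f : C -> C => f) = H2.
Proof.
apply/seteqP; split=> f; first by case.
by move=> hf; split=> //; exists f => //; exact: ae_eqT_refl.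
Qed.

Lemma range_norm_id f : H2 f -> range_norm (fun f : C -> C => f) f = norm2 f.
Proof.
move=> hf; rewrite (range_normE id_lifts)// -nrm_cls; last exact: H2_L2.
rewrite /rnorm [X in inf X](_ : _ = [set nrm (@ip R) (cls f)]) ?inf1//.
apply/seteqP; split=> x; first by move=> [u [_ ->] <-].
by move=> ->; exists (cls f) => //; split=> //; exact: H2_cls.
Qed.

End Identity.

Theorem theorem2p10 (R : realType) (n : nat) (b : R[i] -> R[i])
    (hrat : rational_of_degree b n)
    (hball : Hinf_ball b)
    (hnonext : ~ extreme_Hinf_ball b) :
  exists (m : nat) (lambda : 'I_m -> R[i]),
    [/\ (m <= n)%N,
        forall i, `|lambda i| = 1,
        same_space (Hb b) (Hb_norm b)
          (Mbar (fun z => (2 ^+ m)^-1 * \prod_(i < m) (z - lambda i)))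
          (Mbar_norm (fun z => (2 ^+ m)^-1 * \prod_(i < m) (z - lambda i))),
        m = 0%N -> same_space (Hb b) (Hb_norm b) H2 norm2 &
        forall M : set (R[i] -> R[i]),
          closed_subspace b M -> shift_invariant M -> nonzero_sub M ->
          exists (k : nat) (i : 'I_k -> 'I_m) (theta : R[i] -> R[i]),
            let F := fun z => \prod_(j < k) (z - lambda (i j)) * theta z in
            [/\ (k <= m)%N, injective i, inner_fun theta, Hb b F &
                M = cyclic_sub b F]].
Proof.
have [p [q [q0 pq sn bE]]] := hrat.
have sp : (size p <= n.+1)%N by rewrite -sn (leq_trans (leqSpred _))// ltnS leq_maxl.
have sq : (size q <= n.+1)%N by rewrite -sn (leq_trans (leqSpred _))// ltnS leq_maxr.
have d0 : defect p q n != 0.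
  apply/eqP => d0; apply: hnonext; apply: (@extreme_of_unimodular R b p q) => //.
  - exact: (num_le q0 bE hball).
  - exact: (den_neq0 q0 pq bE hball).
  - move=> z z1; have := nm_defect q0 sp sq bE hball z1; rewrite d0 horner0 nm0 => /eqP.
    by rewrite eq_sym subr_eq0 eqrXn2 ?nm_ge0// => /eqP.
have [lams [sl l1 [c1 [c2 [c10 c20 hlo hhi]]] [h [g0 [bg hsplit]]]]] :=
  boundary_data q0 pq sp sq bE hball d0.
pose a z : R[i] := (apoly lams).[z].
have ba : bmult a := bmult_apoly lams.
have [A0 [K [K' [A0l Kp Kp' r1 r2]]]] := Hb_operator (bmult_b q0 pq bE hball) ba bg
  (nm_b_circ q0 pq bE hball) c10 c20 hlo hhi hsplit (@Mul_a_HH R lams).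
exists (size lams), (fun i => lams`_i).
have aE : (fun z => (2 ^+ size lams)^-1 * \prod_(i < size lams) (z - lams`_i)) = a.
  apply/funext => z; rewrite /a /apoly hornerZ horner_prod; congr (_ * _).
  rewrite (big_nth 0) big_mkord; apply: eq_bigr => i _; by rewrite hornerXsubC.
split.
- exact: sl.
- by move=> i; rewrite nmE l1// mem_nth.
- rewrite aE; exact: (same_space_lifts A0l (toeplitz_lifts (bmult_conjT ba)) Kp Kp' r1 r2).
- move=> m0.
  have T1 u : HH u -> Top (conjT a) u = u.
    move=> hu; rewrite /Top -[RHS]PH_id//; congr PH; rewrite -[RHS]Mul1.
    apply: eq_Mul; [exact: bmult_conjT|exact: bmult_cst|move=> t].
    by rewrite /conjT /a /apoly (size0nil m0) big_nil expr0 invr1 scale1r hornerC conj1.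
  have := same_space_lifts A0l (@id_lifts R) Kp Kp' _ _; rewrite range_space_id => H.
  have [||VE [d1 [d2 [d10 d20 hd]]]] := H.
  + by move=> v hv; have [w [hw e le]] := r1 v hv; exists w; split=> //; rewrite -e T1.
  + by move=> v hv; have [w [hw e le]] := r2 v hv; exists w; split=> //; rewrite e T1.
  split=> //; exists d1, d2; split=> // f Xf.
  by have := hd f Xf; rewrite range_norm_id//; rewrite -VE.
- move=> M hM sM nM; apply: (invariant_cyclic A0l l1 Kp' _ r2 hM sM nM).
  by move=> v hv; have [w [hw e _]] := r1 v hv; exists w.
Qed.
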